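(* Let $0<y<1$ and let $p=p(n)$ be a sequence of positive integers such that $p,n\to\infty$ and $p/n\to y$. For each $n$ let $x_1,\ldots,x_n\in\mathbb{R}^p$ be i.i.d. samples from the Gaussian distribution $\mathcal{N}(0,I)$ on $\mathbb{R}^p$, let $S_n=\frac1n\sum_{i=1}^n x_ix_i^\top$, and let $\hat\Sigma$ be Tyler's M-estimator of $x_1,\ldots,x_n$. Then $\|p\,\hat\Sigma-S_n\|\to 0$ almost surely, and there exist constants $C,c,c'>0$ (independent of $n$, $p$ and $\varepsilon$, but possibly depending on $y$) such that for every $0<\varepsilon<c'$ and all sufficiently large $n$ (with threshold not depending on $\varepsilon$), $$\Pr\left(\left\|p\,\hat\Sigma-\frac1n\sum_{i=1}^n x_ix_i^\top\right\|\le\varepsilon\right)\ge 1-C\,n\,e^{-c\varepsilon^2 n}.$$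
   Context: $\|\cdot\|$ denotes the operator (spectral) norm. Given $x_1,\ldots,x_n\in\mathbb{R}^p$, Tyler's M-estimator $\hat\Sigma$ is the unique positive definite $p\times p$ matrix satisfying $$\hat\Sigma=\frac pn\sum_{i=1}^n\frac{x_ix_i^\top}{x_i^\top\hat\Sigma^{-1}x_i},\qquad \mathrm{tr}(\hat\Sigma)=1.$$ For i.i.d. Gaussian $\mathcal{N}(0,I)$ samples with $n>p$ (which holds for all large $n$ since $y<1$) it is well defined almost surely. The samples $x_1,\ldots,x_n$ depend on $n$ since their dimension $p$ does; all of them are defined on a common probability space. *)

(* Defs.v *)
From HB Require Import structures.
From mathcomp Require Import all_boot all_order all_algebra.
From mathcomp Require Import all_classical all_reals all_analysis.

Set Implicit Arguments.
Unset Strict Implicit.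
Unset Printing Implicit Defensive.

Import Order.TTheory GRing.Theory Num.Theory.
Import numFieldNormedType.Exports.

Local Open Scope classical_set_scope.
Local Open Scope ring_scope.

Definition enorm (R : realType) (p : nat) (v : 'cV[R]_p) : R :=
  Num.sqrt (\sum_(j < p) v j ord0 ^+ 2).

(* Spectral norm; the library's norm on matrices is the largest absolute value
   of an entry. *)
Definition opnorm (R : realType) (p : nat) (A : 'M[R]_p) : R :=
  sup [set enorm (A *m v) | v in [set v : 'cV[R]_p | enorm v <= 1]].

Definition posdefmx (R : realType) (p : nat) (A : 'M[R]_p) : Prop :=
  A^T = A /\
  forall v : 'cV[R]_p, v != 0 -> 0 < (v^T *m A *m v) ord0 ord0.

Definition sample_cov (R : realType) (n p : nat) (x : 'I_n -> 'cV[R]_p) :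
    'M[R]_p :=
  n%:R^-1 *: \sum_(i < n) (x i *m (x i)^T).

Definition tyler_eq (R : realType) (n p : nat) (x : 'I_n -> 'cV[R]_p)
    (S : 'M[R]_p) : Prop :=
  [/\ posdefmx S,
      S = (p%:R / n%:R) *: \sum_(i < n)
            (((x i)^T *m invmx S *m x i) ord0 ord0)^-1 *: (x i *m (x i)^T) &
      \tr S = 1].

(* The unique solution of [tyler_eq x], and 0 (which is not positive definite
   for 0 < p) when there is no solution or more than one. *)
Definition tyler (R : realType) (n p : nat) (x : 'I_n -> 'cV[R]_p) :
    'M[R]_p :=
  xget 0 [set S | tyler_eq x S /\ forall S', tyler_eq x S' -> S' = S].

Definition col_of_tuple (R : realType) (p : nat) (t : p.-tuple R) : 'cV[R]_p :=
  \col_(j < p) tnth t j.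

(* The law of Z is N(0, I), the p-fold product of N(0, 1): a probability on the
   product sigma-algebra is determined by its values on measurable boxes. *)
Definition std_gaussian_vector (R : realType) (d : measure_display)
    (T : measurableType d) (P : probability T R) (p : nat)
    (Z : {mfun T >-> p.-tuple R}) : Prop :=
  forall A : 'I_p -> set R, (forall j, measurable (A j)) ->
    distribution P Z [set t | forall j, A j (tnth t j)] =
    (\prod_(j < p) normal_prob (0 : R) 1 (A j))%E.

(* Subfamilies are covered by taking some of the B i to be the full space. *)
Definition mutually_independent (R : realType) (d : measure_display)
    (T : measurableType d) (P : probability T R)
    (d' : measure_display) (U : measurableType d') (n : nat)
    (X : 'I_n -> {mfun T >-> U}) : Prop :=
  forall B : 'I_n -> set U, (forall i, measurable (B i)) ->
    P [set w | forall i, B i (X i w)] = (\prod_(i < n) P (X i @^-1` B i))%E.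

(* Probability of a set not known to be measurable (the estimator is obtained by
   choice and P is not assumed complete): the inner probability, which is P on
   measurable sets by [inner_probE]. *)
Definition inner_prob (R : realType) (d : measure_display)
    (T : measurableType d) (P : probability T R) (A : set T) : \bar R :=
  ereal_sup [set P B | B in [set B | measurable B /\ B `<=` A]].

Lemma inner_probE (R : realType) (d : measure_display)
    (T : measurableType d) (P : probability T R) (A : set T) :
  measurable A -> inner_prob P A = P A.
Proof.
move=> mA; apply/eqP; rewrite eq_le; apply/andP; split.
  apply: ge_ereal_sup => _ [B [mB BA] <-].
  by apply: le_measure => //; rewrite inE.
by apply: ereal_sup_ubound; exists A => /=; [split|].
Qed.

(* Main.v *)
Require Import Defs.
From HB Require Import structures.
From mathcomp Require Import all_boot all_order all_algebra.
From mathcomp Require Import all_classical all_reals all_analysis.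
From mathcomp Require Import measurable_realfun normal_distribution.
From mathcomp Require Import ring lra zify.

Set Implicit Arguments.
Unset Strict Implicit.
Unset Printing Implicit Defensive.

Import Order.TTheory GRing.Theory Num.Theory.
Import numFieldNormedType.Exports.

Local Open Scope classical_set_scope.
Local Open Scope ring_scope.

(** Tyler's matrix is, up to its trace, a weighted scatter matrix
    [A(w) = \sum_i w i x i (x i)^T] whose weights solve
    [w i <x i, A(w)^-1 x i> = p / n] for all [i].  The theorem says that these
    weights are nearly constant, since [S_n] is the scatter matrix with constant
    weights.

    Constant weights almost solve the equation.  With [W = \sum_j x j (x j)^T], the
    leverage [h i = <x i, W^-1 x i>] equals [r i / (1 + r i)], where [r i] is the
    same quadratic form for the scatter matrix [M i] of the other samples.  As [x i]
    is independent of [M i], the form [r i] is close to the trace of the inverse of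
    [M i], which hardly depends on [i]; hence all leverages are close to each other,
    and they add up to [p] exactly ([leverage_close]).

    The equation is stable ([weight_ratio]).  Suppose that the row
    [(<x j, W^-1 x i>)_j] has square mass bounded below on each half of the indices
    that avoids [i].  Monotonicity of [w |-> A(w)^-1], in the quantitative form of
    [gram_solution_ge] and [gram_solution_le], then bounds the ratio of the largest
    to the smallest weight by the error of the leverages.  The norms of the samples
    fix the scale ([tyler_close]).  The same estimate keeps a minimiser of a cost
    function on a box of weights away from the boundary, which yields a solution,
    and a similar argument shows that there is only one; this is what identifies
    the estimator with the solution of its equation ([tylerP]).

    All hypotheses of this deterministic part hold outside an exceptional event
    ([tyler_close_of_events]): [W] is bounded; the scatter matrix stays bounded
    below when a small proportion of the samples is removed; the rows are spread
    out; the norms and the forms [r i] concentrate.  Each is a Chernoff bound for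
    Gaussian quadratic forms ([gauss_quad_mgf], [gauss_rank1]) in which a matrix or
    a direction may depend on the samples that are not integrated ([chain_tail]),
    followed by a union over a net of the ball and over subsets of the samples.
    The first three fail with probability of order [n exp(- n)], because the
    constants are free; the last two determine the rate [n exp(- c eps^2 n)].

    The deterministic part loses an additive error of order [1 / n].  It is
    harmless: the claimed bound is vacuous unless [eps^2 n] exceeds a constant, and
    then [1 / n] is at most a multiple of [eps].  The almost sure convergence
    follows from the tail bound by the Borel--Cantelli lemma. *)

(** * Gram matrices with weights *)

Section Dot.
Variable R : realType.
Implicit Types p n : nat.

Definition dot p (u v : 'cV[R]_p) : R := (u^T *m v) ord0 ord0.

Lemma dotE p (u v : 'cV[R]_p) : dot u v = \sum_j u j ord0 * v j ord0.
Proof. by rewrite /dot mxE; apply: eq_bigr => j _; rewrite mxE. Qed.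

Lemma dotC p (u v : 'cV[R]_p) : dot u v = dot v u.
Proof. by rewrite !dotE; apply: eq_bigr => j _; rewrite mulrC. Qed.

Lemma dotDr p (u v w : 'cV[R]_p) : dot u (v + w) = dot u v + dot u w.
Proof. by rewrite /dot mulmxDr mxE. Qed.

Lemma dotZr p a (u v : 'cV[R]_p) : dot u (a *: v) = a * dot u v.
Proof. by rewrite /dot -scalemxAr mxE. Qed.

Lemma dotDl p (u v w : 'cV[R]_p) : dot (u + v) w = dot u w + dot v w.
Proof. by rewrite dotC dotDr !(dotC w). Qed.

Lemma dotZl p a (u v : 'cV[R]_p) : dot (a *: u) v = a * dot u v.
Proof. by rewrite dotC dotZr dotC. Qed.

Lemma dotNr p (u v : 'cV[R]_p) : dot u (- v) = - dot u v.
Proof. by rewrite -scaleN1r dotZr mulN1r. Qed.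

Lemma dot0r p (u : 'cV[R]_p) : dot u 0 = 0.
Proof. by rewrite -(scale0r 0) dotZr mul0r. Qed.

Lemma dot_sumr p (I : Type) (r : seq I) (P : pred I) (u : 'cV[R]_p) F :
  dot u (\sum_(i <- r | P i) F i) = \sum_(i <- r | P i) dot u (F i).
Proof. by rewrite (big_morph (dot u) (dotDr u) (dot0r u)). Qed.

Lemma dot_ge0 p (u : 'cV[R]_p) : 0 <= dot u u.
Proof. by rewrite dotE sumr_ge0// => j _; rewrite -expr2 sqr_ge0. Qed.

Lemma dot_eq0 p (u : 'cV[R]_p) : (dot u u == 0) = (u == 0).
Proof.
apply/eqP/eqP => [|->]; last by rewrite dot0r.
rewrite dotE => /eqP; rewrite psumr_eq0; last by move=> j _; rewrite -expr2 sqr_ge0.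
move=> /allP u0; apply/colP => j; rewrite mxE.
by apply/eqP; have := u0 j (mem_index_enum _); rewrite mulf_eq0 orbb.
Qed.

Lemma dot_gt0 p (u : 'cV[R]_p) : u != 0 -> 0 < dot u u.
Proof. by move=> u0; rewrite lt_neqAle dot_ge0 eq_sym dot_eq0 u0. Qed.

Lemma enormE p (u : 'cV[R]_p) : enorm u = Num.sqrt (dot u u).
Proof. by rewrite /enorm dotE; congr Num.sqrt; apply: eq_bigr => j _; rewrite expr2. Qed.

Lemma sum_CS (I : finType) (P : pred I) (f g : I -> R) :
  (\sum_(i | P i) f i * g i) ^+ 2 <=
  (\sum_(i | P i) f i ^+ 2) * (\sum_(i | P i) g i ^+ 2).
Proof.
set A := \sum_(i | P i) f i ^+ 2; set B := \sum_(i | P i) g i ^+ 2.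
set C := \sum_(i | P i) _.
have A0 : 0 <= A by apply: sumr_ge0 => i _; exact: sqr_ge0.
have B0 : 0 <= B by apply: sumr_ge0 => i _; exact: sqr_ge0.
have H s t : 0 <= s ^+ 2 * A + t ^+ 2 * B - 2 * s * t * C.
  rewrite /A /B /C !mulr_sumr -big_split -sumrB /=; apply: sumr_ge0 => i _.
  have -> : s ^+ 2 * f i ^+ 2 + t ^+ 2 * g i ^+ 2 - 2 * s * t * (f i * g i) =
            (s * f i - t * g i) ^+ 2 by ring.
  exact: sqr_ge0.
have [B1|B1] := eqVneq B 0.
  have [->|C0] := eqVneq C 0; first by rewrite B1 expr0n mulr0.
  have := H 1 ((A + 1) / C); rewrite B1 mulr0.
  have -> : 2 * 1 * ((A + 1) / C) * C = 2 * (A + 1) by field.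
  by lra.
have Bp : 0 < B by rewrite lt_neqAle eq_sym B1.
have := H B C.
have -> : B ^+ 2 * A + C ^+ 2 * B - 2 * B * C * C = B * (A * B - C ^+ 2) by ring.
by rewrite pmulr_rge0// subr_ge0.
Qed.

Lemma dot_CS p (u v : 'cV[R]_p) : dot u v ^+ 2 <= dot u u * dot v v.
Proof.
by rewrite !dotE (le_trans (sum_CS _ _ _)).
Qed.

End Dot.

Section Gram.
Variables (R : realType) (n p : nat) (x : 'I_n -> 'cV[R]_p).

Definition gram (w : 'I_n -> R) : 'M[R]_p := \sum_i w i *: (x i *m (x i)^T).

Lemma gram_mul w v : gram w *m v = \sum_i (w i * dot (x i) v) *: x i.
Proof.
rewrite /gram mulmx_suml; apply: eq_bigr => i _.
rewrite -scalemxAl -scalerA; congr (_ *: _).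
rewrite -mulmxA [(x i)^T *m v]mx11_scalar -/(dot _ _).
by rewrite mul_mx_scalar.
Qed.

Lemma dot_gram w z v :
  dot z (gram w *m v) = \sum_i w i * (dot (x i) z * dot (x i) v).
Proof.
rewrite gram_mul dot_sumr; apply: eq_bigr => i _.
by rewrite dotZr (dotC z); ring.
Qed.

Lemma gram_sym w : (gram w)^T = gram w.
Proof.
rewrite /gram linear_sum; apply: eq_bigr => i _ /=.
by rewrite linearZ /= trmx_mul trmxK.
Qed.

Lemma gramZ c w : gram (fun i => c * w i) = c *: gram w.
Proof. by rewrite /gram scaler_sumr; apply: eq_bigr => i _; rewrite scalerA. Qed.

(** Both sides are values of a concave maximisation
   [z |-> 2 <x0, z> - <z, gram w' z>], whose maximum is attained at [v];
   the bound evaluates it at [u]. *)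
Lemma gram_solution_ge w w' x0 u v : (forall j, 0 <= w' j) ->
  gram w *m u = x0 -> gram w' *m v = x0 ->
  dot x0 u + \sum_j (w j - w' j) * dot (x j) u ^+ 2 <= dot x0 v.
Proof.
move=> w'0 wu wv.
have e1 : dot x0 u = \sum_i w i * (dot (x i) u * dot (x i) u).
  by rewrite -dot_gram wu dotC.
have e2 : dot x0 v = \sum_i w' i * (dot (x i) v * dot (x i) v).
  by rewrite -dot_gram wv dotC.
have e3 : dot x0 u = \sum_i w' i * (dot (x i) u * dot (x i) v).
  by rewrite -dot_gram wv dotC.
have : 0 <= \sum_i w' i * (dot (x i) v - dot (x i) u) ^+ 2.
  by apply: sumr_ge0 => i _; rewrite mulr_ge0 ?sqr_ge0.
have -> : \sum_i w' i * (dot (x i) v - dot (x i) u) ^+ 2 =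
   dot x0 v - 2 * dot x0 u + dot x0 u - \sum_j (w j - w' j) * dot (x j) u ^+ 2.
  rewrite {2}e1 e2 e3 !mulr_sumr -!sumrB -!big_split -!sumrB /=.
  by apply: eq_bigr => i _; ring.
lra.
Qed.

(** The same maximisation, now bounded from above term by term: with
   [a = <x j, u>] and [b = <x j, v>] it comes down to
   [(a - b) ^+ 2 + b ^+ 2 >= a ^+ 2 / 2]. *)
Lemma gram_solution_le w w' b x0 u v :
  (forall j, 0 <= b j <= w j) -> (forall j, w j + b j <= w' j) ->
  gram w *m u = x0 -> gram w' *m v = x0 ->
  dot x0 v <= dot x0 u - 2^-1 * \sum_j b j * dot (x j) u ^+ 2.
Proof.
move=> b0 bw wu wv.
have e1 : dot x0 u = \sum_i w i * (dot (x i) u * dot (x i) u).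
  by rewrite -dot_gram wu dotC.
have e2 : dot x0 v = \sum_i w' i * (dot (x i) v * dot (x i) v).
  by rewrite -dot_gram wv dotC.
have e3 : dot x0 v = \sum_i w i * (dot (x i) v * dot (x i) u).
  by rewrite -dot_gram wu dotC.
suff : 2 * dot x0 v - dot x0 v - dot x0 u + 2^-1 * \sum_j b j * dot (x j) u ^+ 2 <= 0.
  lra.
rewrite {1}e3 e2 e1 !mulr_sumr -!sumrB -!big_split /=.
apply: sumr_le0 => j _.
have /andP[bj0 bjw] := b0 j; have bwj := bw j.
set s := dot (x j) u; set t := dot (x j) v.
have h1 : 0 <= (w j - b j) * (s - t) ^+ 2 by rewrite mulr_ge0 ?sqr_ge0// subr_ge0.
have h2 : 0 <= (w' j - w j - b j) * t ^+ 2 by rewrite mulr_ge0 ?sqr_ge0//; lra.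
have h3 : 0 <= b j * (2 * (t - s / 2) ^+ 2) by rewrite mulr_ge0// mulr_ge0 ?sqr_ge0.
have -> : 2 * (w j * (t * s)) - w' j * (t * t) - w j * (s * s) + 2^-1 * (b j * s ^+ 2) =
  - ((w j - b j) * (s - t) ^+ 2) - (w' j - w j - b j) * t ^+ 2
  - b j * (2 * (t - s / 2) ^+ 2) by field.
lra.
Qed.

End Gram.

(** * Weights that equalise the leverages are nearly constant *)

(** If the extreme weights [w a >= w b] differ by a relative amount [D], the two
   comparison lemmas say that the leverage row of [a] puts little mass on the
   indices whose weight is far from [w a], and the row of [b] little mass on those
   whose weight is far from [w b].  Every index is of one of the two kinds, so one
   kind contains half of them, and the spreading hypothesis bounds [D].  The
   weights need to solve the equation in one direction only at [a] and in the
   other only at [b], which is what a constrained minimiser provides. *)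
Lemma weight_ratio (R : realType) (n p : nat) (x : 'I_n -> 'cV[R]_p)
    (u : 'I_n -> 'cV[R]_p) (q e k : R) (w : 'I_n -> R) (a b : 'I_n)
    (va vb : 'cV[R]_p) :
  0 < k -> 0 <= e -> 4 * e < k ->
  (forall i, gram x (fun=> 1) *m u i = x i) ->
  (forall i, `| dot (x i) (u i) - q | <= e) ->
  (forall i (J : {set 'I_n}), i \notin J -> (n <= 2 * #|J|)%N ->
     k <= \sum_(j in J) dot (x j) (u i) ^+ 2) ->
  (forall j, 0 < w j) -> (forall j, w b <= w j <= w a) ->
  gram x w *m va = x a -> w a * dot (x a) va <= q ->
  gram x w *m vb = x b -> q <= w b * dot (x b) vb ->
  w a <= (1 + 4 * e / k) * w b.
Proof.
move=> k0 e0 ek Wu hq spread w0 wab Wva qa Wvb qb.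
have wa0 := w0 a; have wb0 := w0 b.
have wane : w a != 0 by rewrite gt_eqF.
have wbne : w b != 0 by rewrite gt_eqF.
(* mass of the row of [a], weighted by the relative defects from the maximum *)
have massa : \sum_j (1 - w j / w a) * dot (x j) (u a) ^+ 2 <= e.
  have := @gram_solution_ge R n p x (fun=> 1) (fun j => (w a)^-1 * w j) (x a) (u a)
    (w a *: va) _ (Wu a) _.
  rewrite dotZr gramZ -scalemxAl -scalemxAr scalerA mulVf// scale1r.
  have h0 j : 0 <= (w a)^-1 * w j by rewrite mulr_ge0 ?invr_ge0 ?ltW.
  move=> /(_ h0 Wva) H.
  under eq_bigr do rewrite [w _ / _]mulrC.
  have := hq a; rewrite ler_norml => /andP[+ _]; lra.
have massb : \sum_j Num.min 1 (w j / w b - 1) * dot (x j) (u b) ^+ 2 <= 2 * e.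
  have h0 j : 0 <= w j / w b - 1.
    by rewrite subr_ge0 ler_pdivlMr// mul1r; case/andP: (wab j).
  have h1 j : 0 <= Num.min 1 (w j / w b - 1) <= 1.
    by rewrite le_min ler01 h0 /= ge_min lexx.
  have h2 j : 1 + Num.min 1 (w j / w b - 1) <= (w b)^-1 * w j.
    rewrite [_ * w j]mulrC -lerBrDl ge_min; apply/orP; right; exact: lexx.
  have := @gram_solution_le R n p x (fun=> 1) (fun j => (w b)^-1 * w j) _ (x b) (u b)
    (w b *: vb) h1 h2 (Wu b).
  rewrite dotZr gramZ -scalemxAl -scalemxAr scalerA mulVf// scale1r.
  move=> /(_ Wvb) H.
  have := hq b; rewrite ler_norml => /andP[_ +]; lra.
set D := Num.min 1 (w a / w b - 1).
have [D0|D0] := leP D 0.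
  have : w a / w b - 1 <= 0 by move: D0; rewrite /D ge_min ler10.
  rewrite subr_le0 ler_pdivrMr// mul1r => /le_trans; apply.
  apply: ler_peMl; first exact: ltW.
  by rewrite lerDl divr_ge0 ?mulr_ge0// ltW.
have D1 : D <= 1 by rewrite /D ge_min lexx.
have Dw : (1 + D) * w b <= w a.
  rewrite -ler_pdivlMr// -lerBrDl /D ge_min; apply/orP; right; exact: lexx.
suff Dk : D * k <= 4 * e.
  have Dlt1 : D < 1.
    rewrite ltNge; apply/negP => hD.
    have : k <= D * k by rewrite ler_peMl// ltW.
    lra.
  have DE : D = w a / w b - 1.
    by apply/min_idPr; move: Dlt1; rewrite gt_min ltxx => /ltW.
  rewrite -ler_pdivrMr// -lerBlDl -DE ler_pdivlMr//.
(* the threshold exceeds [(1 + D / 2) * w b] since [D <= 1] *)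
pose J : {set 'I_n} := [set j | w j < w a * (1 - D / 4)]%SET.
have aJ : a \notin J.
  by rewrite inE -leNgt ger_pMr// lerBlDl lerDr divr_ge0// ltW.
have bJ : b \notin (~: J)%SET.
  rewrite !inE negbK.
  apply: (@lt_le_trans _ _ ((1 + D) * w b * (1 - D / 4))).
    rewrite mulrAC -[X in X < _]mul1r ltr_pM2r//.
    have : 0 < D * (3 - D) by rewrite mulr_gt0//; lra.
    have -> : (1 + D) * (1 - D / 4) = 1 + D * (3 - D) / 4 by field.
    lra.
  by rewrite ler_pM2r//; lra.
have key (i : 'I_n) (K : {set 'I_n}) : i \notin K -> (n <= 2 * #|K|)%N ->
    forall c : 'I_n -> R, (forall j, 0 <= c j) -> 
    forall t s, (forall j, j \in K -> t <= c j) -> 0 < t ->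
    \sum_j c j * dot (x j) (u i) ^+ 2 <= s :> R -> t * k <= s.
  move=> iK cK c c0 t s ct t0 cs.
  apply: le_trans cs; rewrite (bigID (mem K)) /=.
  apply: ler_wpDr; first by apply: sumr_ge0 => j _; rewrite mulr_ge0 ?sqr_ge0.
  apply: (@le_trans _ _ (\sum_(j in K) t * dot (x j) (u i) ^+ 2)).
    by rewrite -mulr_sumr ler_pM2l// spread.
  by apply: ler_sum => j jK; rewrite ler_wpM2r ?sqr_ge0 ?ct.
have D4 : 0 < D / 4 by rewrite divr_gt0.
have D2 : 0 < D / 2 by rewrite divr_gt0.
have [cJ|cJ] := leqP n (2 * #|J|).
  suff : D / 4 * k <= e by lra.
  apply: (key a J aJ cJ _ _ _ _ _ D4 massa) => j.
    by rewrite subr_ge0 ler_pdivrMr// mul1r; case/andP: (wab j).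
  rewrite inE => /ltW; rewrite mulrC -ler_pdivrMr//; lra.
have cJ' : (n <= 2 * #|(~: J)%SET|)%N.
  have := cardsC J; rewrite card_ord => cn; clear -cn cJ; lia.
suff : D / 2 * k <= 2 * e by lra.
apply: (key b _ bJ cJ' _ _ _ _ _ D2 massb) => j.
  rewrite le_min ler01 /= subr_ge0 ler_pdivlMr// mul1r; by case/andP: (wab j).
rewrite !inE -leNgt => h; rewrite le_min; apply/andP; split; first lra.
rewrite lerBrDl ler_pdivlMr//.
apply: le_trans h.
apply: (@le_trans _ _ ((1 + D) * w b * (1 - D / 4))); last first.
  by rewrite ler_pM2r//; lra.
rewrite [leRHS]mulrAC ler_pM2r//.
have : 0 <= D * (1 - D) by rewrite mulr_ge0//; lra.
have -> : (1 + D) * (1 - D / 4) = 1 + D / 2 + D * (1 - D) / 4 by field.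
lra.
Qed.

(** * Existence and uniqueness of the estimator *)

Section PosDef.
Variable R : realType.

Lemma posdefmx_unit p (A : 'M[R]_p) : posdefmx A -> A \in unitmx.
Proof.
move=> [symA posA]; rewrite -row_free_unit; apply: inj_row_free => v vA.
have [//|v0] := eqVneq v 0.
have vT0 : v^T != 0 by apply: contra_neq v0 => vT; rewrite -[v]trmxK vT linear0.
by have := posA _ vT0; rewrite trmxK vA mul0mx mxE ltxx.
Qed.

Lemma posdefmxP p (A : 'M[R]_p) : posdefmx A -> forall v, v != 0 ->
  0 < dot v (A *m v).
Proof. by move=> [_ posA] v v0; rewrite /dot mulmxA; exact: posA. Qed.

Lemma gram_posdef n p (x : 'I_n -> 'cV[R]_p) w : posdefmx (gram x (fun=> 1)) ->
  (forall i, 0 < w i) -> posdefmx (gram x w).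
Proof.
move=> W w0; split; first exact: gram_sym.
move=> v v0; rewrite -mulmxA -/(dot _ _) dot_gram.
have := posdefmxP W v0; rewrite dot_gram => h.
rewrite lt_neqAle sumr_ge0 ?andbT; last first.
  by move=> i _; rewrite mulr_ge0 ?(ltW (w0 i))// -expr2 sqr_ge0.
apply: contraTneq h => /esym/eqP; rewrite psumr_eq0; last first.
  by move=> i _; rewrite mulr_ge0 ?(ltW (w0 i))// -expr2 sqr_ge0.
move=> /allP h; rewrite -leNgt; apply: sumr_le0 => i _.
have := h i (mem_index_enum _); rewrite /= mulf_eq0 gt_eqF//= => /eqP ->.
by rewrite mulr0.
Qed.

Lemma gram_tr n p (x : 'I_n -> 'cV[R]_p) w :
  \tr (gram x w) = \sum_i w i * dot (x i) (x i).
Proof.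
rewrite /gram raddf_sum; apply: eq_bigr => i _ /=.
by rewrite linearZ /= mxtrace_mulC /mxtrace big_ord_recl big_ord0 addr0.
Qed.

(** The trace of [gram x w] times its inverse. *)
Lemma gram_leverage_sum n p (x : 'I_n -> 'cV[R]_p) w :
  gram x w \in unitmx ->
  \sum_i w i * dot (x i) (invmx (gram x w) *m x i) = p%:R.
Proof.
move=> U; rewrite -[RHS](mxtrace1 R p) -(mulVmx U) [X in _ *m X]/gram.
rewrite mulmx_sumr raddf_sum; apply: eq_bigr => i _ /=.
rewrite -scalemxAr linearZ /= mulmxA mxtrace_mulC /mxtrace.
by rewrite big_ord_recl big_ord0 addr0.
Qed.

Lemma det_1Drank1 p (u v : 'cV[R]_p) : \det (1%:M + u *m v^T) = 1 + dot v u.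
Proof.
pose A := block_mx (1%:M : 'M[R]_p) 0 v^T (1%:M : 'M[R]_1).
pose B := block_mx (1%:M + u *m v^T) u 0 (1%:M : 'M[R]_1).
pose C := block_mx (1%:M : 'M[R]_p) 0 (- v^T) (1%:M : 'M[R]_1).
have ABC : A *m B *m C = block_mx 1%:M u 0 (1%:M + v^T *m u).
  rewrite /A /B /C !mulmx_block !mul1mx !mulmx1 !mul0mx !mulmx0 !addr0 !add0r.
  congr block_mx; last by rewrite addrC.
    by rewrite mulmxN addrK.
  by rewrite mulmxDr mulmx1 mulmxN mulmxDl mul1mx mulmxA [X in _ - X]addrC subrr.
have := congr1 determinant ABC.
rewrite !det_mulmx /A /C !det_lblock /B !det_ublock !det1 !mul1r !mulr1 => ->.
by rewrite [LHS]det_mx11 mxE [X in X + _]mxE eqxx.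
Qed.

Lemma det_rank1_update p (A : 'M[R]_p) t (v : 'cV[R]_p) : A \in unitmx ->
  \det (A + t *: (v *m v^T)) = \det A * (1 + t * dot v (invmx A *m v)).
Proof.
move=> U.
have -> : A + t *: (v *m v^T) = A *m (1%:M + (t *: (invmx A *m v)) *m v^T).
  rewrite mulmxDr mulmx1; congr (_ + _).
  by rewrite -scalemxAl -scalemxAr !mulmxA mulmxV// mul1mx.
by rewrite det_mulmx det_1Drank1 dotZr.
Qed.

End PosDef.

Lemma continuous_at_sum (R : realType) (T : topologicalType) (I : Type)
    (r : seq I) (P : pred I) (F : I -> T -> R) (t : T) :
  (forall i, {for t, continuous (F i)}) ->
  {for t, continuous (fun s => \sum_(i <- r | P i) F i s)}.
Proof.
move=> cF; rewrite /prop_for /continuous_at.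
by apply: cvg_big => [|i _]; [exact: add_continuous|exact: cF].
Qed.

Lemma continuous_at_prod (R : realType) (T : topologicalType) (I : Type)
    (r : seq I) (P : pred I) (F : I -> T -> R) (t : T) :
  (forall i, {for t, continuous (F i)}) ->
  {for t, continuous (fun s => \prod_(i <- r | P i) F i s)}.
Proof.
move=> cF; rewrite /prop_for /continuous_at.
by apply: cvg_big => [|i _]; [exact: mul_continuous|exact: cF].
Qed.

Section Existence.
Variables (R : realType) (n p : nat) (x : 'I_n -> 'cV[R]_p).
Hypothesis W : posdefmx (gram x (fun=> 1)).

Let lev w i := dot (x i) (invmx (gram x w) *m x i).

(** Up to a scale, Tyler's equation is the critical point equation of this
   function of the weights. *)
Definition tyler_cost (w : 'I_n -> R) : R :=
  n%:R * ln `|\det (gram x w)| - p%:R * \sum_i ln (w i).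

Let box (w : 'I_n -> R) := forall i, 1 <= w i <= 4.

Lemma ln_le_subr1 (z : R) : 0 < z -> ln z <= z - 1.
Proof.
by move=> z0; have := expR_ge1Dx (ln z); rewrite lnK ?posrE//; lra.
Qed.

Lemma gram_det_neq0 w : (forall i, 0 < w i) -> \det (gram x w) != 0.
Proof.
by move=> w0; rewrite -unitfE -unitmxE; apply: posdefmx_unit; exact: gram_posdef.
Qed.

(** First order comparison of [w] with a perturbation of one weight; both signs
   of [t] are used. *)
Lemma tyler_cost_step w i t (w' := fun j => if j == i then w i + t else w j) :
  (forall j, 0 < w j) -> 0 < w i + t -> 0 < 1 + t * lev w i ->
  tyler_cost w <= tyler_cost w' -> p%:R * t <= n%:R * (t * lev w i) * (w i + t).
Proof.
move=> w0 wt0 lt0; rewrite /tyler_cost.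
have U : gram x w \in unitmx by apply: posdefmx_unit; exact: gram_posdef.
have -> : gram x w' = gram x w + t *: (x i *m (x i)^T).
  rewrite /gram (bigD1 i)//= [in RHS](bigD1 i)//= /w' eqxx scalerDl -!addrA.
  congr (_ + _); rewrite addrC; congr (_ + _); apply: eq_bigr => j ji.
  by rewrite (negbTE ji).
rewrite det_rank1_update// normrM lnM ?posrE ?normr_gt0 ?gram_det_neq0//; last first.
  by rewrite gt_eqF.
rewrite -/(lev w i) (gtr0_norm lt0).
have -> : \sum_j ln (w' j) = \sum_j ln (w j) + (ln (w i + t) - ln (w i)).
  rewrite (bigD1 i)//= [in RHS](bigD1 i)//= /w' eqxx.
  under eq_bigr => j ji do rewrite (negbTE ji).
  by ring.
have h1 := ln_le_subr1 lt0.
have h2 : ln (w i / (w i + t)) <= w i / (w i + t) - 1.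
  by apply: ln_le_subr1; rewrite divr_gt0.
move: h2; rewrite ln_div ?posrE// => h2 h3.
have n0 : (0 : R) <= n%:R by [].
have p0 : (0 : R) <= p%:R by [].
have h1' := ler_wpM2l n0 h1; have h2' := ler_wpM2l p0 h2.
have : p%:R * (t / (w i + t)) <= n%:R * (t * lev w i).
  have -> : t / (w i + t) = 1 - w i / (w i + t) by field; rewrite gt_eqF.
  lra.
by rewrite mulrA ler_pdivrMr.
Qed.

Hypothesis n0 : (0 < n)%N.

Let n0R : 0 < n%:R :> R. Proof. by rewrite ltr0n. Qed.

Lemma lev_ge0 w i : (forall j, 0 < w j) -> 0 <= lev w i.
Proof.
move=> w0.
have U : gram x w \in unitmx by apply: posdefmx_unit; exact: gram_posdef.
rewrite /lev -{1}[x i]mul1mx -(mulmxV U) -mulmxA dotC dot_gram.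
by apply: sumr_ge0 => j _; rewrite mulr_ge0 ?(ltW (w0 j))// -expr2 sqr_ge0.
Qed.

Section Minimiser.
Variable w : 'I_n -> R.
Hypothesis bw : box w.
Hypothesis minw : forall w', box w' -> tyler_cost w <= tyler_cost w'.

Let w0 j : 0 < w j. Proof. by have /andP[h _] := bw j; exact: lt_le_trans h. Qed.

(** At a minimiser over the box the weight [i] may be increased unless it is
   maximal; dividing [tyler_cost_step] by [t] and letting [t] tend to [0] gives half
   of the critical point equation. *)
Lemma tyler_min_up i : w i < 4 -> p%:R / n%:R <= w i * lev w i.
Proof.
move=> wi; rewrite ler_pdivrMr//; apply/ler_addgt0Pr => e e0.
have l0 := lev_ge0 i w0.
pose t := Num.min (4 - w i) (e / (n%:R * lev w i + 1)).
have d0 : 0 < n%:R * lev w i + 1 by rewrite ltr_wpDl ?mulr_ge0.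
have t0 : 0 < t by rewrite lt_min subr_gt0 wi divr_gt0.
have te : t * (n%:R * lev w i + 1) <= e.
  by rewrite -ler_pdivlMr// /t ge_min lexx orbT.
have t4 : w i + t <= 4 by rewrite -lerBrDl /t ge_min lexx.
have := @tyler_cost_step w i t w0.
rewrite addr_gt0// => /(_ isT); rewrite ltr_pwDl ?mulr_ge0 ?(ltW t0)// => /(_ isT) H.
have {}H : p%:R * t <= n%:R * (t * lev w i) * (w i + t).
  apply: H; apply: minw => j; case: ifP => _; last exact: bw.
  by rewrite t4 andbT; have /andP[h _] := bw i; rewrite (le_trans h)// lerDl ltW.
have {}H : p%:R <= n%:R * lev w i * (w i + t).
  rewrite -(ler_pM2r t0); apply: le_trans H _.
  by rewrite le_eqVlt; apply/orP; left; apply/eqP; ring.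
have : t * (n%:R * lev w i) <= t * (n%:R * lev w i + 1).
  by rewrite ler_pM2l// lerDl.
by rewrite mulrDr in H; lra.
Qed.

Lemma tyler_min_down i : 1 < w i -> w i * lev w i <= p%:R / n%:R.
Proof.
move=> wi; rewrite ler_pdivlMr//; apply/ler_addgt0Pr => e e0.
have l0 := lev_ge0 i w0.
have d0 : 0 < n%:R * lev w i + 1 by rewrite ltr_wpDl ?mulr_ge0.
have d1 : 0 < 2 * (lev w i + 1) by lra.
pose t := Num.min (w i - 1) (Num.min (e / (n%:R * lev w i + 1)) (2 * (lev w i + 1))^-1).
have t0 : 0 < t by rewrite !lt_min subr_gt0 wi divr_gt0 ?invr_gt0.
have te : t * (n%:R * lev w i + 1) <= e.
  by rewrite -ler_pdivlMr// /t !ge_min lexx ?orbT.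
have tl : t * (2 * (lev w i + 1)) <= 1.
  by rewrite -ler_pdivlMr// div1r /t !ge_min lexx ?orbT.
have t4 : t <= w i - 1 by rewrite /t ge_min lexx.
have := @tyler_cost_step w i (- t) w0.
have -> : 0 < w i - t by lra.
have -> : 0 < 1 + - t * lev w i by nra.
move=> /(_ isT isT) H.
have {}H : p%:R * - t <= n%:R * (- t * lev w i) * (w i - t).
  apply: H; apply: minw => j; case: ifP => _; last exact: bw.
  by have /andP[h1 h2] := bw i; apply/andP; split; lra.
have {}H : n%:R * lev w i * (w i - t) <= p%:R.
  rewrite -(ler_pM2r t0) -lerN2; apply: le_trans (le_trans _ H) _.
    by rewrite mulrN.
  by rewrite le_eqVlt; apply/orP; left; apply/eqP; ring.
have : t * (n%:R * lev w i) <= t * (n%:R * lev w i + 1).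
  by rewrite ler_pM2l// lerDl.
by rewrite mulrBr in H; lra.
Qed.

End Minimiser.

Lemma tyler_cost_cvg (r : 'rV[R]_n) : (forall i, 0 < r ord0 i) ->
  {for r, continuous (fun s : 'rV[R]_n => tyler_cost (fun i => s ord0 i))}.
Proof.
move=> r0; rewrite /tyler_cost.
have cc i : {for r, continuous (fun s : 'rV[R]_n => s ord0 i)}.
  exact: coord_continuous.
have cgram j k : {for r, continuous (fun s : 'rV[R]_n => gram x (fun i => s ord0 i) j k)}.
  rewrite /gram.
  have -> : (fun s : 'rV[R]_n => (\sum_i s ord0 i *: (x i *m (x i)^T)) j k) =
      (fun s : 'rV[R]_n => \sum_i s ord0 i * (x i *m (x i)^T) j k).
    by apply/funext => s; rewrite summxE; apply: eq_bigr => i _; rewrite mxE.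
  apply: continuous_at_sum => i.
  by apply: continuousM; [exact: cc|exact: cst_continuous].
have cdet : {for r, continuous (fun s : 'rV[R]_n => \det (gram x (fun i => s ord0 i)))}.
  rewrite /determinant; apply: continuous_at_sum => s.
  apply: continuousM; first exact: cst_continuous.
  by apply: continuous_at_prod => i; exact: cgram.
apply: continuousB; apply: continuousM; [exact: cst_continuous| |exact: cst_continuous|].
  apply: (@continuous_comp _ _ _ (fun s : 'rV[R]_n => `|\det (gram x (fun i => s ord0 i))|) (@ln R)).
    by apply: (@continuous_comp _ _ _ (fun s : 'rV[R]_n => \det (gram x (fun i => s ord0 i))) (fun z : R => `|z|)) => //; exact: norm_continuous.
  by apply: continuous_ln; rewrite normr_gt0 gram_det_neq0.
apply: continuous_at_sum => i.
apply: (@continuous_comp _ _ _ (fun s : 'rV[R]_n => s ord0 i) (@ln R)); first exact: cc.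
exact: continuous_ln.
Qed.

Lemma tyler_min_exists :
  exists2 w, box w & forall w', box w' -> tyler_cost w <= tyler_cost w'.
Proof.
pose A := [set r : 'rV[R]_n | forall i, `[(1:R), 4]%classic (r ord0 i)].
have A0 : A !=set0.
  by exists (const_mx 1) => i; rewrite /= mxE in_itv /= lexx ler1n.
have cA : compact A := @rV_compact R n _ (fun=> @segment_compact R 1 4).
have cf : {within A, continuous (fun s : 'rV[R]_n => tyler_cost (fun i => s ord0 i))}.
  apply: continuous_in_subspaceT => r /set_mem Ar; apply: tyler_cost_cvg => i.
  by have := Ar i; rewrite /= in_itv /= => /andP[h _]; exact: lt_le_trans h.
have [r /set_mem Ar minr] := EVT_min_rV A0 cA cf.
exists (fun i => r ord0 i) => [i|w' bw'].
  by have := Ar i; rewrite /= in_itv.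
have := minr (\row_i w' i).
have -> : (fun i => (\row_i w' i) ord0 i) = w' by apply/funext => i; rewrite mxE.
by apply; apply: mem_set => i; rewrite /= in_itv mxE /= bw'.
Qed.

Lemma tyler_costZ s w : 0 < s -> (forall i, 0 < w i) ->
  tyler_cost (fun i => s * w i) = tyler_cost w.
Proof.
move=> s0 w0; rewrite /tyler_cost gramZ detZ normrM lnM ?posrE ?normr_gt0 ?gram_det_neq0//; last first.
  by rewrite expf_neq0 ?gt_eqF.
rewrite ger0_norm ?exprn_ge0 ?ltW// lnXn//.
have -> : \sum_i ln (s * w i) = n%:R * ln s + \sum_i ln (w i).
  under eq_bigr do rewrite lnM ?posrE//.
  by rewrite big_split /= sumr_const card_ord mulr_natl.
by rewrite -mulr_natl; ring.
Qed.

End Existence.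

Section Close.
Variables (R : realType) (n p : nat) (x : 'I_n -> 'cV[R]_p).
Hypotheses (n0 : (0 < n)%N) (p0 : (0 < p)%N).
Hypothesis W : posdefmx (gram x (fun=> 1)).

Let u i := invmx (gram x (fun=> 1)) *m x i.

Definition tyler_weights (w : 'I_n -> R) :=
  (forall i, 0 < w i) /\
  forall i, w i * dot (x i) (invmx (gram x w) *m x i) = p%:R / n%:R.

Lemma dot_gramC w (v z : 'cV[R]_p) : dot z (gram x w *m v) = dot v (gram x w *m z).
Proof. by rewrite !dot_gram; apply: eq_bigr => i _; rewrite [dot _ z * _]mulrC. Qed.

Let unitW (w : 'I_n -> R) : (forall i, 0 < w i) -> gram x w \in unitmx.
Proof. by move=> w0; apply: posdefmx_unit; exact: gram_posdef. Qed.

Let gramK (w : 'I_n -> R) i : (forall i, 0 < w i) -> gram x w *m (invmx (gram x w) *m x i) = x i.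
Proof. by move=> w0; rewrite mulKVmx// unitW. Qed.

Let Wu i : gram x (fun=> 1) *m u i = x i.
Proof. by rewrite gramK. Qed.

Let levC (w : 'I_n -> R) i j : (forall i, 0 < w i) ->
  dot (x i) (invmx (gram x w) *m x j) = dot (x j) (invmx (gram x w) *m x i).
Proof. by move=> w0; rewrite -{1}(gramK i w0) dotC dot_gramC gramK// dotC. Qed.

Let pn0 : 0 < p%:R / n%:R :> R.
Proof. by rewrite divr_gt0// ltr0n. Qed.

(** If every cross leverage between [J] and its complement vanishes for the
   weights [w], the space splits as a sum of the spans of the two subfamilies,
   so the cross leverages vanish for constant weights too. *)
Lemma leverage_split (w : 'I_n -> R) (J : {set 'I_n}) : (forall i, 0 < w i) ->
  (forall i j, i \in J -> j \notin J -> dot (x j) (invmx (gram x w) *m x i) = 0) ->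
  forall i j, i \in J -> j \notin J -> dot (x j) (u i) = 0.
Proof.
move=> w0 h i j iJ jJ.
set A := gram x w; set z := u i.
pose r := \sum_(k | k \notin J) dot (x k) z *: x k.
pose y := invmx A *m r.
have Ay : A *m y = r by rewrite mulKVmx// unitW.
have xy k : k \in J -> dot (x k) y = 0.
  move=> kJ; rewrite /y /r mulmx_sumr dot_sumr big1// => l lJ.
  have xkl : dot (x k) (invmx A *m x l) = 0 by rewrite /A levC// h.
  by rewrite -scalemxAr dotZr xkl mulr0.
have y0 : y = 0.
  apply/eqP; apply: contraT => yn0.
  have := posdefmxP (gram_posdef W w0) yn0; rewrite -/A Ay.
  have -> : r = x i - \sum_(k in J) dot (x k) z *: x k.
    rewrite -{1}[x i]Wu gram_mul; under eq_bigr do rewrite mul1r.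
    by rewrite (bigID (mem J)) /= [X in _ = X - _]addrC addrK.
  rewrite dotDr dotNr [dot y (x i)]dotC xy// dot_sumr big1 ?subr0 ?ltxx// => k kJ.
  by rewrite dotZr [dot y _]dotC xy// mulr0.
have /eqP : dot z r = 0 by rewrite -Ay y0 mulmx0 dot0r.
rewrite /r dot_sumr.
under eq_bigr do rewrite dotZr [dot z _]dotC.
rewrite psumr_eq0; last by move=> k _; rewrite -expr2 sqr_ge0.
move=> /allP /(_ j (mem_index_enum _)); rewrite jJ /= mulf_eq0 orbb.
by move=> /eqP.
Qed.

Section Spread.
Variables (k : R).
Hypothesis k0 : 0 < k.
Hypothesis spread : forall i (J : {set 'I_n}), i \notin J -> (n <= 2 * #|J|)%N ->
     k <= \sum_(j in J) dot (x j) (u i) ^+ 2.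

Let large (J : {set 'I_n}) : (n <= 2 * #|J|)%N \/ (n <= 2 * #|(~: J)%SET|)%N.
Proof. by have := cardsC J; rewrite card_ord => cn; lia. Qed.

(** At the indices where [w' / w] is largest, the comparison lemma is an
   equality; this decouples them from all other indices. *)
Lemma tyler_weights_unique w w' : tyler_weights w -> tyler_weights w' ->
  exists c, forall i, w' i = c * w i.
Proof.
move=> [w0 wE] [w'0 w'E].
pose rho i := w' i / w i.
have [a _ amax] := @arg_maxP _ _ _ (Ordinal n0) xpredT rho isT.
have rho0 i : 0 < rho i by rewrite divr_gt0.
exists (rho a) => i.
suff -> : rho a = rho i by rewrite /rho divfK// gt_eqF.
pose J : {set 'I_n} := [set j | rho j == rho a]%SET.
have cross j l : j \in J -> l \notin J -> dot (x l) (invmx (gram x w) *m x j) = 0.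
  rewrite !inE => /eqP jJ lJ.
  have c0 m : 0 <= (rho a)^-1 * w' m by rewrite mulr_ge0 ?invr_ge0 ?ltW.
  have := @gram_solution_ge R n p x w (fun m => (rho a)^-1 * w' m) (x j) _
    (rho a *: (invmx (gram x w') *m x j)) c0 (gramK j w0).
  rewrite gramZ -scalemxAl -scalemxAr scalerA mulVf ?gt_eqF// scale1r gramK//.
  move=> /(_ erefl); rewrite dotZr.
  have -> : rho a * dot (x j) (invmx (gram x w') *m x j) =
            dot (x j) (invmx (gram x w) *m x j).
    by rewrite -jJ /rho mulrAC w'E -(wE j) mulrC mulKf// gt_eqF.
  rewrite gerDl => hs.
  have d0 m : 0 <= w m - (rho a)^-1 * w' m.
    rewrite subr_ge0 mulrC ler_pdivrMr// -ler_pdivrMl//.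
    by rewrite mulrC; exact: amax.
  have t0 m : 0 <= (w m - (rho a)^-1 * w' m) * dot (x m) (invmx (gram x w) *m x j) ^+ 2.
    by rewrite mulr_ge0 ?sqr_ge0.
  have : \sum_m (w m - (rho a)^-1 * w' m) * dot (x m) (invmx (gram x w) *m x j) ^+ 2 == 0.
    by rewrite eq_le hs sumr_ge0.
  rewrite psumr_eq0// => /allP /(_ l (mem_index_enum _)) /=.
  rewrite mulf_eq0 sqrf_eq0 subr_eq0 => /orP[|/eqP//] /eqP wl.
  case/eqP: lJ; have -> : rho l = w' l / w l by [].
  by rewrite wl invfM invrK mulrCA divff ?mulr1// gt_eqF.
have cross1 := leverage_split w0 cross.
have aJ : a \in J by rewrite inE.
have [iJ|iJ] := boolP (i \in J); first by move: iJ; rewrite inE => /eqP.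
suff : k <= 0 by rewrite leNgt k0.
have symu j l : dot (x l) (u j) = dot (x j) (u l) by exact: levC.
case: (large J) => cJ.
  apply: (le_trans (spread iJ cJ)); rewrite big1// => j jJ.
  by rewrite symu cross1// expr0n.
have aJ' : a \notin (~: J)%SET by rewrite inE aJ.
apply: (le_trans (spread aJ' cJ)); rewrite big1// => j; rewrite inE => jJ.
by rewrite cross1// expr0n.
Qed.

Variable e : R.
Hypotheses (e0 : 0 <= e) (ek : 4 * e < k).
Hypothesis hlev : forall i, `|dot (x i) (u i) - p%:R / n%:R| <= e.

(** A minimiser of the cost over the box [1 <= w <= 4] satisfies at its extreme
   weights the one-sided equations that [weight_ratio] asks for.  Its weights are
   therefore within a factor 2 of each other, a multiple of it lies in the
   interior of the box, and there all one-sided equations become equalities. *)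
Lemma tyler_weights_exist : exists w, tyler_weights w.
Proof.
have [w bw minw] := @tyler_min_exists R n p x W.
have w0 i : 0 < w i by have /andP[h _] := bw i; exact: lt_le_trans h.
have [a _ amax] := @arg_maxP _ _ _ (Ordinal n0) xpredT w isT.
have [b _ bmin] := @arg_minP _ _ _ (Ordinal n0) xpredT w isT.
have rab : w a <= 2 * w b.
  have /andP[b1 b4] := bw b; have /andP[a1 a4] := bw a.
  have [wa1|wa1] := leP (w a) 1; first by lra.
  have [wb4|wb4] := leP 4 (w b); first by lra.
  have wab j : w b <= w j <= w a by rewrite bmin//=; exact: amax.
  have := weight_ratio k0 e0 ek Wu hlev spread w0 wab (gramK a w0)
    (tyler_min_down W n0 bw minw wa1) (gramK b w0) (tyler_min_up W n0 bw minw wb4).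
  move=> /le_trans; apply; rewrite ler_pM2r//.
  have : 4 * e / k <= 1 by rewrite ler_pdivrMr// mul1r ltW.
  lra.
pose s := 3 / 2 / w b.
have s0 : 0 < s by rewrite divr_gt0// divr_gt0.
have sb : s * w b = 3 / 2 by rewrite divfK// gt_eqF.
have sj j : 1 < s * w j < 4.
  have h1 : s * w b <= s * w j by rewrite ler_pM2l// bmin.
  have h2 : s * w j <= s * (2 * w b) by rewrite ler_pM2l//; apply: le_trans rab; exact: amax.
  rewrite mulrCA sb in h2; rewrite sb in h1.
  by apply/andP; split; lra.
exists (fun j => s * w j); split=> [j|j]; first by rewrite mulr_gt0.
have bs j' : 1 <= s * w j' <= 4 by have /andP[h1 h2] := sj j'; rewrite !ltW.
have mins w' : (forall i, 1 <= w' i <= 4) ->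
    tyler_cost x (fun j => s * w j) <= tyler_cost x w'.
  by move=> bw'; rewrite tyler_costZ//; exact: minw.
have /andP[h1 h2] := sj j.
apply/eqP; rewrite eq_le; apply/andP; split.
  exact: (tyler_min_down W n0 bs mins h1).
exact: (tyler_min_up W n0 bs mins h2).
Qed.

(** * Distance to the sample covariance *)

Variables (K eps : R).
Hypotheses (eps0 : 0 <= eps) (eps1 : eps <= 1 / 2) (K0 : 0 <= K).
Hypothesis hup : forall v, \sum_j dot (x j) v ^+ 2 <= K * n%:R * dot v v.
Hypothesis hnorm : forall i, `|dot (x i) (x i) - p%:R| <= eps * p%:R.

Let pR0 : 0 < p%:R :> R. Proof. by rewrite ltr0n. Qed.
Let nR0 : 0 < n%:R :> R. Proof. by rewrite ltr0n. Qed.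

Let eps1' : 0 <= 1 - eps.
Proof. by have := eps1; lra. Qed.

Let xx0 i : 0 < dot (x i) (x i).
Proof.
have := hnorm i; rewrite ler_norml => /andP[h _].
have : eps * p%:R <= 1 / 2 * p%:R by rewrite ler_pM2r.
have := pR0; lra.
Qed.

Let invmxZ (c : R) (A : 'M[R]_p) : c != 0 -> A \in unitmx ->
  invmx (c *: A) = c^-1 *: invmx A.
Proof.
move=> c0 U.
have cU : c *: A \in unitmx by rewrite unitmxZ// unitfE.
apply: (can_inj (mulKmx cU)).
by rewrite mulmxV// -scalemxAl -scalemxAr scalerA mulfV// scale1r mulmxV.
Qed.

Let lev_gt0 (w : 'I_n -> R) i : (forall i, 0 < w i) ->
  0 < dot (x i) (invmx (gram x w) *m x i).
Proof.
move=> w0; set v := _ *m _.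
have v0 : v != 0.
  apply: contraTneq (xx0 i) => v0.
  by rewrite -{1}(gramK i w0) -/v v0 mulmx0 dotC dot0r ltxx.
by have := posdefmxP (gram_posdef W w0) v0; rewrite gramK// dotC.
Qed.

Lemma tyler_eq_weights S : tyler_eq x S ->
  exists w, [/\ tyler_weights w, S = gram x w & \tr S = 1].
Proof.
move=> [posS eqS trS].
pose w i := (p%:R / n%:R) * (dot (x i) (invmx S *m x i))^-1.
have levS i : 0 < dot (x i) (invmx S *m x i).
  have v0 : invmx S *m x i != 0.
    apply: contraTneq (xx0 i) => v0.
    by rewrite -{1}[x i](mulKVmx (posdefmx_unit posS)) v0 mulmx0 dotC dot0r ltxx.
  have := posdefmxP posS v0.
  by rewrite mulKVmx ?posdefmx_unit// dotC.
have SE : S = gram x w.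
  rewrite [LHS]eqS /gram scaler_sumr; apply: eq_bigr => i _.
  by rewrite scalerA /w /dot mulmxA.
have w0 i : 0 < w i by rewrite mulr_gt0// invr_gt0.
exists w; split=> //; split=> // i.
by rewrite -SE /w divfK// gt_eqF.
Qed.

(** Tyler's equation is invariant under scaling, except for the trace. *)
Lemma tyler_weights_eq w : tyler_weights w ->
  tyler_eq x ((\tr (gram x w))^-1 *: gram x w).
Proof.
move=> [w0 wE].
have t0 : 0 < \tr (gram x w).
  rewrite gram_tr (bigD1 (Ordinal n0))//= ltr_pwDl ?mulr_gt0//.
  by apply: sumr_ge0 => i _; rewrite mulr_ge0// ltW.
set c := (\tr (gram x w))^-1.
have c0 : 0 < c by rewrite invr_gt0.
have cE : c *: gram x w = gram x (fun i => c * w i) by rewrite gramZ.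
split.
- by rewrite cE; apply: gram_posdef => // i; rewrite mulr_gt0.
- rewrite {1}cE /gram scaler_sumr; apply: eq_bigr => i _.
  rewrite scalerA -/(gram x w) invmxZ ?gt_eqF ?unitW// -mulmxA -/(dot _ _).
  rewrite -scalemxAl dotZr; congr (_ *: _).
  have l0 := lev_gt0 i w0.
  rewrite -(wE i) invfM invrK mulrCA; congr (_ * _).
  by rewrite mulfK// gt_eqF.
- by rewrite linearZ /= /c mulVf// gt_eqF.
Qed.

Lemma tylerP : tyler_eq x (tyler x).
Proof.
have [w wT] := tyler_weights_exist.
have teq := tyler_weights_eq wT.
rewrite /tyler; set P := (X in xget 0 X).
suff : P (xget 0 P) by case.
apply: xgetPex; exists ((\tr (gram x w))^-1 *: gram x w).
split=> // S' S'eq.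
have [w' [w'T -> tr']] := tyler_eq_weights S'eq.
have [c cE] := tyler_weights_unique wT w'T.
have e1 : gram x w' = c *: gram x w by rewrite -gramZ; congr gram; exact/funext.
rewrite e1 in tr' *; rewrite linearZ /= in tr'.
congr (_ *: _); have tw0 : \tr (gram x w) != 0.
  by apply: contra_eq_neq tr' => ->; rewrite mulr0 eq_sym oner_eq0.
by rewrite -[LHS](mulfK tw0) tr' mul1r.
Qed.

(** Cauchy--Schwarz applied to [<z, gram x w v>] with [z = gram x w v].  The
   weights will be the differences between two families, hence of either sign. *)
Lemma opnorm_gram_le (w : 'I_n -> R) (t L : R) : 0 <= t -> 0 <= L ->
  (forall i, `|w i| <= t) ->
  (forall v, \sum_j dot (x j) v ^+ 2 <= L * dot v v) ->
  opnorm (gram x w) <= t * L.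
Proof.
move=> t0 L0 wt hL; apply: ge_sup.
  by exists 0; exists 0 => /=; rewrite ?mulmx0 enormE dot0r sqrtr0 ?ler01.
move=> _ [v /= v1 <-].
have vv1 : dot v v <= 1.
  have := v1; rewrite enormE => h.
  by rewrite -(sqr_sqrtr (dot_ge0 v)) -(expr1n R 2) lerXn2r ?nnegrE ?sqrtr_ge0.
rewrite enormE -[leRHS]ger0_norm ?mulr_ge0// -sqrtr_sqr; apply: ler_wsqrtr.
set z := gram x w *m v.
have [->|z0] := eqVneq z 0; first by rewrite dot0r sqr_ge0.
have zz0 := dot_gt0 z0.
have : dot z z ^+ 2 <= dot z z * (t * L) ^+ 2.
  have zE : dot z z = \sum_i (w i * dot (x i) z) * dot (x i) v.
    by rewrite {2}/z dot_gram; apply: eq_bigr => i _; rewrite mulrA.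
  rewrite {1}zE; apply: (le_trans (sum_CS _ _ _)).
  have -> : dot z z * (t * L) ^+ 2 = t ^+ 2 * (L * dot z z) * L by ring.
  apply: ler_pM.
  - by apply: sumr_ge0 => i _; exact: sqr_ge0.
  - by apply: sumr_ge0 => i _; exact: sqr_ge0.
  - apply: (@le_trans _ _ (t ^+ 2 * \sum_i dot (x i) z ^+ 2)).
      rewrite mulr_sumr; apply: ler_sum => i _; rewrite exprMn ler_wpM2r ?sqr_ge0//.
      by rewrite -real_normK ?num_real// lerXn2r ?nnegrE.
    by rewrite ler_wpM2l ?sqr_ge0.
  - by apply: (le_trans (hL v)); rewrite -[leRHS]mulr1 ler_wpM2l.
by rewrite expr2 ler_pM2l.
Qed.

(** The trace normalisation fixes the common scale of the nearly constant
   weights, because all the [x i] have nearly the same length. *)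
Theorem tyler_close :
  opnorm (p%:R *: tyler x - sample_cov x) <= 2 * K * (4 * e / k + eps).
Proof.
have [w [[w0 wE] -> trS]] := tyler_eq_weights tylerP.
have [a _ amax] := @arg_maxP _ _ _ (Ordinal n0) xpredT w isT.
have [b _ bmin] := @arg_minP _ _ _ (Ordinal n0) xpredT w isT.
have wab j : w b <= w j <= w a by rewrite bmin//=; exact: amax.
have eps0' := eps0; have eps2' := eps1.
set D := 4 * e / k.
have D0 : 0 <= D by rewrite divr_ge0 ?mulr_ge0// ltW.
have D1 : D <= 1 by rewrite ler_pdivrMr// mul1r ltW.
have rab : w a <= (1 + D) * w b.
  apply: weight_ratio k0 e0 ek Wu hlev spread w0 wab (gramK a w0) _ (gramK b w0) _;
  by rewrite wE.
have hx i : (1 - eps) * p%:R <= dot (x i) (x i) <= (1 + eps) * p%:R.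
  by have := hnorm i; rewrite ler_norml => /andP[h1 h2]; apply/andP; split; lra.
have np0 : 0 < n%:R * p%:R :> R by rewrite mulr_gt0.
have hb : w b * (n%:R * p%:R) * (1 - eps) <= 1.
  rewrite -[leRHS]trS gram_tr.
  apply: (@le_trans _ _ (\sum_(i < n) w b * ((1 - eps) * p%:R))).
    rewrite sumr_const card_ord -mulr_natl.
    by rewrite le_eqVlt; apply/orP; left; apply/eqP; ring.
  apply: ler_sum => i _; have /andP[h1 _] := hx i; have /andP[h3 _] := wab i.
  apply: ler_pM => //; first exact: ltW.
  by apply: mulr_ge0; [exact: eps1'|exact: ltW].
have ha : 1 <= w a * (n%:R * p%:R) * (1 + eps).
  rewrite -[leLHS]trS gram_tr.
  apply: (@le_trans _ _ (\sum_(i < n) w a * ((1 + eps) * p%:R))).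
    apply: ler_sum => i _; have /andP[_ h1] := hx i; have /andP[_ h3] := wab i.
    by apply: ler_pM => //; exact: ltW.
  rewrite sumr_const card_ord -mulr_natl.
  by rewrite le_eqVlt; apply/orP; left; apply/eqP; ring.
have -> : p%:R *: gram x w - sample_cov x = gram x (fun i => p%:R * w i - n%:R^-1).
  rewrite /sample_cov /gram !scaler_sumr -sumrB; apply: eq_bigr => i _.
  by rewrite scalerA scalerBl.
have -> : 2 * K * (D + eps) = 2 * (D + eps) / n%:R * (K * n%:R).
  by field; rewrite gt_eqF.
apply: opnorm_gram_le => //.
- by rewrite divr_ge0 ?mulr_ge0 ?addr_ge0.
- by rewrite mulr_ge0.
move=> i.
have -> : p%:R * w i - n%:R^-1 = (w i * (n%:R * p%:R) - 1) / n%:R.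
  by field; rewrite gt_eqF.
rewrite normrM [X in _ * X]ger0_norm ?invr_ge0// ler_wpM2r ?invr_ge0//.
have /andP[h1 h2] := wab i.
set N := n%:R * p%:R in hb ha np0 *.
have g1 : w b * N <= w i * N by rewrite ler_pM2r.
have g2 : w i * N <= w a * N by rewrite ler_pM2r.
have g3 : w a * N <= (1 + D) * (w b * N) by rewrite mulrA ler_pM2r.
have b0 : 0 <= w b * N by rewrite mulr_ge0// ltW.
set A := w a * N in ha g2 g3 *; set B := w b * N in hb g1 g3 b0 *.
rewrite ler_norml; apply/andP; split.
  have : 1 <= (1 + D) * B * (1 + eps).
    by apply: (le_trans ha); rewrite ler_wpM2r//; lra.
  have : 0 <= B * ((1 - D) * D + (1 - eps) * eps) by rewrite mulr_ge0// addr_ge0// mulr_ge0//; lra.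
  have [hs|hs] := leP (1 / 2) (D + eps); first by lra.
  nra.
have : A * (1 - eps) <= 1 + D.
  apply: (@le_trans _ _ ((1 + D) * (B * (1 - eps)))).
    by rewrite mulrA ler_wpM2r//; lra.
  by rewrite -[leRHS]mulr1 ler_wpM2l//; lra.
nra.
Qed.

End Spread.
End Close.

(** * Resampling one coordinate *)

Section Resampling.
Local Open Scope ereal_scope.
Context (R : realType) (d : measure_display) (U : measurableType d) (m : nat).

Definition upd (t : m.-tuple U) (i : 'I_m) (u : U) : m.-tuple U :=
  [tuple (if j == i then u else tnth t j) | j < m].

Lemma tnth_upd t i u j : tnth (upd t i u) j = if j == i then u else tnth t j.
Proof. by rewrite tnth_mktuple. Qed.

Let boxes : set (set (m.-tuple U)) :=
  [set B | exists2 A : 'I_m -> set U, (forall j, measurable (A j)) &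
           B = [set t | forall j, A j (tnth t j)]].

Let measurable_box (A : 'I_m -> set U) : (forall j, measurable (A j)) ->
  measurable [set t : m.-tuple U | forall j, A j (tnth t j)].
Proof.
move=> mA.
have -> : [set t : m.-tuple U | forall j, A j (tnth t j)] =
    \bigcap_(j in setT) ((fun t : m.-tuple U => tnth t j) @^-1` A j).
  by apply/seteqP; split=> t /= h j; [move=> _|]; exact: h.
apply: fin_bigcap_measurable => // j _; rewrite -[X in measurable X]setTI.
exact: measurable_tnth.
Qed.

Lemma measurable_tuple_boxes : measurable = <<s boxes >>.
Proof.
apply/seteqP; split; last first.
  apply: smallest_sub; first exact: sigma_algebra_measurable.
  by move=> _ [A mA ->]; exact: measurable_box.
apply: smallest_sub; first exact: smallest_sigma_algebra.
move=> B.
suff : forall s : seq 'I_m,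
    (\big[setU/set0]_(i <- s) preimage_set_system setT
       (fun x : m.-tuple U => tnth x i) measurable) B -> <<s boxes >> B.
  by apply.
elim => [|i s IH]; first by rewrite big_nil.
rewrite big_cons => -[[A mA <-]|]; last exact: IH.
apply: sub_sigma_algebra; exists (fun j => if j == i then A else setT).
  by move=> j; case: ifP.
rewrite setTI; apply/seteqP; split=> t /=.
  by move=> At j; case: ifPn => // /eqP ->.
by move=> /(_ i); rewrite eqxx.
Qed.

Lemma measurable_upd i : measurable_fun [set: m.-tuple U * U]
  (fun z => upd z.1 i z.2).
Proof.
apply/measurable_fun_tnthP => j.
have [ji|ji] := boolP (j == i).
  rewrite (_ : _ \o _ = snd); first exact: measurable_snd.
  by apply/funext => z /=; rewrite tnth_upd ji.
rewrite (_ : _ \o _ = (fun t => tnth t j) \o fst).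
  by apply: measurableT_comp; [exact: measurable_tnth|exact: measurable_fst].
by apply/funext => z /=; rewrite tnth_upd (negbTE ji).
Qed.

Let V : measurableType (measure_tuple_display d) := (m.-tuple U)%type.
Context (mu : probability V R) (nu : 'I_m -> probability U R).

(** The coordinates are independent, the [i]-th one with law [nu i]. *)
Definition box_product := forall A : 'I_m -> set U,
  (forall j, measurable (A j)) ->
  mu [set t | forall j, A j (tnth t j)] = \prod_(j < m) nu j (A j).

Hypothesis muE : box_product.

(** Replacing one of several independent coordinates by a fresh copy does not
   change the joint law; this is how every conditional expectation below is
   taken. *)
Lemma resample (i : 'I_m) (f : V -> \bar R) : (forall t, 0 <= f t) ->
  measurable_fun setT f ->
  \int[mu]_t f t = \int[mu]_t \int[nu i]_u f (upd t i u).
Proof.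
move=> f0 mf.
have mupd := measurable_upd i.
have lawE A : measurable A ->
    pushforward (mu \x nu i) (fun z => upd z.1 i z.2) A = mu A.
  pose phi : {mfun (m.-tuple U * U)%type >-> m.-tuple U} :=
    HB.pack (fun z : m.-tuple U * U => upd z.1 i z.2)
      (isMeasurableFun.Build _ _ _ _ _ mupd).
  apply: (measure_unique boxes (fun=> setT) measurable_tuple_boxes _ _ _
    (pushforward (mu \x nu i) phi) mu) => //.
  - move=> _ _ [A1 mA1 ->] [A2 mA2 ->]; exists (fun j => A1 j `&` A2 j).
      by move=> j; exact: measurableI.
    apply/seteqP; split=> t /=; first by move=> [h1 h2] j.
    by move=> h; split=> j; case: (h j).
  - by move=> _; exists (fun=> setT) => //; apply/seteqP; split.
  - by apply/seteqP; split => // t _; exists 0%N.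
  - move=> _ [B mB ->].
    rewrite /= /pushforward; set S := (X in (mu \x nu i) X).
    have -> : S = [set t | forall j, (if j == i then setT else B j) (tnth t j)] `*` B i.
      apply/seteqP; split=> -[t v] /=.
        move=> h; split; last by have := h i; rewrite tnth_upd eqxx.
        by move=> j; case: ifPn => // ji; have := h j; rewrite tnth_upd (negbTE ji).
      move=> [h Bi] j; rewrite tnth_upd; case: ifPn => [/eqP -> //|ji].
      by have := h j; rewrite (negbTE ji).
    have mB' j : measurable (if j == i then setT else B j) by case: ifP.
    rewrite product_measure1E//; last exact: (measurable_box mB').
    transitivity ((\prod_(j < m) nu j (if j == i then setT else B j)) * nu i (B i)).
      by congr mule; exact: (muE mB').
    transitivity (\prod_(j < m) nu j (B j)); last exact/esym/(muE mB).
    rewrite (bigD1 i)//= eqxx probability_setT mul1e [RHS](bigD1 i)//= muleC.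
    by congr mule; apply: eq_bigr => j ji; rewrite (negbTE ji).
  - by move=> _; rewrite /= /pushforward preimage_setT probability_setT ltry.
transitivity (\int[pushforward (mu \x nu i) (fun z => upd z.1 i z.2)]_t f t).
  by apply: eq_measure_integral => A mA _; first [exact: lawE|exact/esym/lawE].
rewrite ge0_integral_pushforward//.
rewrite preimage_setT fubini_tonelli1//; first exact: measurableT_comp.
by move=> z; exact: f0.
Qed.

Lemma resample_le (i : 'I_m) (f g : V -> \bar R) : (forall t, 0 <= f t) ->
  measurable_fun setT f -> measurable_fun setT g ->
  (forall t, \int[nu i]_u f (upd t i u) <= g t) ->
  \int[mu]_t f t <= \int[mu]_t g t.
Proof.
move=> f0 mf mg fg; rewrite (resample i f0 mf).
have mupd := measurable_upd i.
apply: ge0_le_integral => //.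
- by move=> t _; apply: integral_ge0 => u _; exact: f0.
- apply: (@measurable_fun_fubini_tonelli_F _ _ _ _ _ (nu i)
    (fun z : V * U => f (upd z.1 i z.2))).
    exact: measurableT_comp.
  by move=> z; exact: f0.
Qed.

End Resampling.

(** * Moment generating functions of Gaussian quadratic forms *)

Section Gauss1.
Variable R : realType.
Notation mu := (@lebesgue_measure R).

Lemma integral_normal_prob (m s : R) (f : R -> \bar R) :
  (forall x, 0 <= f x)%E -> measurable_fun setT f ->
  (\int[normal_prob m s]_x f x = \int[mu]_x (f x * (normal_pdf m s x)%:E))%E.
Proof.
move=> f0 mf.
have dom := normal_prob_dominates m s.
rewrite -(Radon_Nikodym_SigmaFinite.change_of_variables dom f0 measurableT mf).
have RNi := Radon_Nikodym_SigmaFinite.f_integrable dom.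
have mpdf : measurable_fun setT (fun x => (normal_pdf m s x)%:E).
  by apply/measurable_EFinP; exact: measurable_normal_pdf.
have ae : ae_eq mu setT (Radon_Nikodym_SigmaFinite.f (normal_prob m s) mu)
    (fun x => (normal_pdf m s x)%:E).
  apply: integral_ae_eq => // A _ mA.
  by rewrite -Radon_Nikodym_SigmaFinite.f_integral.
apply: ae_eq_integral => //.
- by apply: emeasurable_funM => //; exact: measurable_int RNi.
- exact: emeasurable_funM.
- by apply: filterS ae => x /= xE _; rewrite xE.
Qed.

(** Completing the square turns the integrand into a multiple of another normal
   density. *)
Lemma gauss_quad (a b : R) : a < 1 ->
  (\int[normal_prob 0 1]_x (expR (2^-1 * a * x ^+ 2 + b * x))%:E =
   ((Num.sqrt (1 - a))^-1 * expR (b ^+ 2 / (2 * (1 - a))))%:E)%E.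
Proof.
move=> a1.
have c0 : 0 < 1 - a by rewrite subr_gt0.
have s0 : 0 < Num.sqrt (1 - a) by rewrite sqrtr_gt0.
rewrite integral_normal_prob; last 2 first.
- by move=> x; rewrite lee_fin expR_ge0.
- apply/measurable_EFinP; apply: measurableT_comp; first exact: measurable_expR.
  by apply: measurable_funD; apply: measurable_funM => //; exact: measurable_funX.
set C := (X in _ = X%:E).
have -> : (\int[mu]_x ((expR (2^-1 * a * x ^+ 2 + b * x))%:E * (normal_pdf 0 1 x)%:E))%E =
   (\int[mu]_x (C%:E * (normal_pdf (b / (1 - a)) (Num.sqrt (1 - a))^-1 x)%:E))%E.
  apply: eq_integral => x _; rewrite -!EFinM; congr EFin.
  rewrite !normal_pdfE ?oner_eq0 ?invr_eq0 ?gt_eqF//= /normal_fun.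
  have -> : normal_peak 1 = (Num.sqrt (1 - a))^-1 * normal_peak (Num.sqrt (1 - a))^-1 :> R.
    rewrite /normal_peak exprVn sqr_sqrtr ?ltW// expr1n mul1r -mulrnAr.
    rewrite sqrtrM ?invr_ge0 ?ltW// sqrtrV ?ltW// invfM invrK mulrA mulVf ?mul1r//.
    by rewrite gt_eqF.
  rewrite /C exprVn sqr_sqrtr ?ltW//.
  set E1 := expR (2^-1 * _ * _ + _); set E2 := expR (- (x - 0) ^+ 2 / _).
  set E3 := expR (b ^+ 2 / _); set E4 := expR (- (x - _) ^+ 2 / _).
  have E12 : E1 * E2 = E3 * E4.
    rewrite /E1 /E2 /E3 /E4 -!expRD; congr expR; rewrite expr1n subr0.
    by field; rewrite gt_eqF.
  by rewrite mulrCA E12; ring.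
rewrite ge0_integralZl//; last 3 first.
- by apply/measurable_EFinP; exact: measurable_normal_pdf.
- by move=> x _; rewrite lee_fin normal_pdf_ge0.
- by rewrite lee_fin mulr_ge0 ?invr_ge0 ?sqrtr_ge0 ?expR_ge0.
by rewrite integral_normal_pdf mule1.
Qed.

End Gauss1.

Section StdNormal.
Variable R : realType.

(** [normal_prob] lives on the Borel sigma-algebra of [measurableTypeR R], while
   tuples of reals are built on the default measurable structure of [R]; these
   have the same measurable sets, so the law is transported along the identity. *)
Definition borel_id (x : measurableTypeR R) : R := x.

Lemma measurable_borel_id : measurable_fun setT borel_id.
Proof. by move=> _ A mA; rewrite setTI. Qed.

HB.instance Definition _ := isMeasurableFun.Build _ _ _ _ borel_id
  measurable_borel_id.

Definition std_normal : probability R R :=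
  distribution (normal_prob (0 : R) 1 : probability (measurableTypeR R) R) borel_id.

Lemma std_normal_quad (a b : R) : a < 1 ->
  (\int[std_normal]_x (expR (2^-1 * a * x ^+ 2 + b * x))%:E =
   ((Num.sqrt (1 - a))^-1 * expR (b ^+ 2 / (2 * (1 - a))))%:E)%E.
Proof.
move=> a1; rewrite -gauss_quad// ge0_integral_distribution//.
apply/measurable_EFinP; apply: measurableT_comp; first exact: measurable_expR.
by apply: measurable_funD; apply: measurable_funM => //; exact: measurable_funX.
Qed.

End StdNormal.

Section GaussVector.
Variables (R : realType) (p : nat).
Let V : measurableType _ := (p.-tuple R)%type.
Variable mu : probability V R.
Hypothesis muE : box_product mu (fun=> std_normal R).

Implicit Types (A : 'M[R]_p) (v z : 'cV[R]_p).

Definition quad (A : 'M[R]_p) (z : 'cV[R]_p) : R := dot z (A *m z).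

(** Pivoting on the [i]-th coordinate: [1 - gauss_pivot A i] is the Schur
   complement of the entry [(i, i)] in [1 - A], padded by the identity so that
   the size does not change. *)
Definition gauss_pivot (A : 'M[R]_p) (i : 'I_p) : 'M[R]_p :=
  let e : 'cV[R]_p := delta_mx i ord0 in
  let P := 1%:M - e *m e^T in
  P *m A *m P + (1 - A i i)^-1 *: (P *m A *m e *m (P *m A *m e)^T).

Section Pivot.
Variables (A : 'M[R]_p) (i : 'I_p).
Hypothesis symA : A^T = A.
Let e : 'cV[R]_p := delta_mx i ord0.
Let P : 'M[R]_p := 1%:M - e *m e^T.
Let a := P *m A *m e.

Let gpE : gauss_pivot A i = P *m A *m P + (1 - A i i)^-1 *: (a *m a^T).
Proof. by []. Qed.

Let dote v : dot e v = v i ord0.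
Proof.
rewrite dotE (bigD1 i)//= big1 => [|j ji]; rewrite mxE ?eqxx ?mul1r ?addr0//.
by rewrite (negbTE ji) mul0r.
Qed.

Let dee : dot e e = 1.
Proof. by rewrite dote mxE !eqxx. Qed.

Let Pv v : P *m v = v - v i ord0 *: e.
Proof.
rewrite mulmxBl mul1mx -mulmxA [e^T *m v]mx11_scalar -/(dot e v) dote.
by rewrite mul_mx_scalar.
Qed.

Let symP : P^T = P.
Proof. by rewrite linearB /= trmx1 trmx_mul trmxK. Qed.

Let dotP u v : dot (P *m u) v = dot u (P *m v).
Proof. by rewrite /dot trmx_mul symP mulmxA. Qed.

Let dotA u v : dot (A *m u) v = dot u (A *m v).
Proof. by rewrite /dot trmx_mul symA mulmxA. Qed.

Let Pe : P *m e = 0.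
Proof. by rewrite Pv mxE !eqxx scale1r subrr. Qed.

Let PP : P *m P = P.
Proof. by rewrite {2}/P mulmxBr mulmx1 mulmxA Pe mul0mx subr0. Qed.

Let Aii : A i i = dot e (A *m e).
Proof.
rewrite dote mxE (bigD1 i)//= big1 => [|j ji]; rewrite mxE ?eqxx ?mulr1 ?addr0//.
by rewrite (negbTE ji) mulr0.
Qed.

Lemma quad_pivot z : quad (gauss_pivot A i) z =
  quad A (P *m z) + (1 - A i i)^-1 * dot a z ^+ 2.
Proof.
rewrite /quad gpE mulmxDl dotDr; congr (_ + _).
  by rewrite -!mulmxA -dotP.
rewrite -scalemxAl dotZr -mulmxA [a^T *m z]mx11_scalar -/(dot a z) mul_mx_scalar dotZr.
by rewrite (dotC z a) expr2.
Qed.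

Lemma quad_shift z u : quad A (P *m z + u *: e) =
  quad A (P *m z) + 2 * u * dot a z + u ^+ 2 * A i i.
Proof.
rewrite /quad mulmxDr !(dotDl, dotDr) -!scalemxAr !(dotZl, dotZr) Aii.
have -> : dot (P *m z) (A *m e) = dot a z.
  by rewrite dotP dotC /a -!mulmxA.
have -> : dot e (A *m (P *m z)) = dot a z.
  by rewrite -dotA dotC dotP dotC /a -!mulmxA.
ring.
Qed.

Lemma gauss_pivot_sym : (gauss_pivot A i)^T = gauss_pivot A i.
Proof.
rewrite gpE linearD linearZ /=; congr (_ + _ *: _).
  by rewrite !trmx_mul symP symA mulmxA.
by rewrite trmx_mul trmxK.
Qed.

Lemma gauss_pivot_col j :
  A *m delta_mx j ord0 = (0 : 'cV[R]_p) \/ j = i ->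
  gauss_pivot A i *m delta_mx j ord0 = (0 : 'cV[R]_p).
Proof.
move=> h.
have APj : A *m (P *m (delta_mx j ord0 : 'cV[R]_p)) = 0.
  have [->|ji] := eqVneq j i; first by rewrite -/e Pe mulmx0.
  case: h => [h|/eqP]; last by rewrite (negbTE ji).
  by rewrite Pv mxE eq_sym (negbTE ji) scale0r subr0.
rewrite gpE mulmxDl -!mulmxA APj mulmx0 add0r -scalemxAl -mulmxA.
by rewrite /a !trmx_mul symP symA -!mulmxA APj !mulmx0 scaler0.
Qed.

Let al : R := 8^-1.
Hypothesis boundA : forall v, `|quad A v| <= al * dot v v.

Let dPv v : dot v v = dot (P *m v) (P *m v) + v i ord0 ^+ 2.
Proof.
rewrite dotP mulmxA PP Pv dotDr dotNr dotZr (dotC v e) dote expr2.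
by rewrite addrNK.
Qed.

Let dnn : A i i <= al.
Proof.
have := boundA e; rewrite /quad -Aii dote mxE !eqxx mulr1.
by rewrite ler_norml => /andP[].
Qed.

Let dnn' : - al <= A i i.
Proof.
have := boundA e; rewrite /quad -Aii dote mxE !eqxx mulr1.
by rewrite ler_norml => /andP[].
Qed.

(** The Schur complement stays between the same multiples of the identity; for
   the upper bound evaluate the form at the best completion of [P v]. *)
Lemma gauss_pivot_bound v : `|quad (gauss_pivot A i) v| <= al * dot v v.
Proof.
have dlt : 0 < 1 - A i i by have := dnn; rewrite /al; lra.
rewrite quad_pivot ler_norml; apply/andP; split.
  apply: (@le_trans _ _ (quad A (P *m v))).
    have := boundA (P *m v); rewrite ler_norml => /andP[+ _]; apply: le_trans.
    by rewrite lerN2 ler_wpM2l ?invr_ge0// (dPv v) lerDl sqr_ge0.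
  by rewrite lerDl mulr_ge0 ?sqr_ge0// invr_ge0 ltW.
set s := (1 - A i i)^-1 * dot a v.
have sE : dot a v = (1 - A i i) * s by rewrite mulVKf// gt_eqF.
have := boundA (P *m v + s *: e); rewrite ler_norml => /andP[_].
rewrite quad_shift.
have -> : dot (P *m v + s *: e) (P *m v + s *: e) = dot (P *m v) (P *m v) + s ^+ 2.
  have Pev : dot e (P *m v) = 0 by rewrite -dotP Pe dotC dot0r.
  rewrite !(dotDl, dotDr, dotZl, dotZr) (dotC (P *m v) e) Pev dee; ring.
have h1 : al * dot (P *m v) (P *m v) <= al * dot v v.
  by rewrite ler_wpM2l ?invr_ge0// (dPv v) lerDl sqr_ge0.
have -> : (1 - A i i)^-1 * dot a v ^+ 2 = (1 - A i i) * s ^+ 2.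
  by rewrite sE; field; rewrite gt_eqF.
rewrite sE; have h2 : 0 <= s ^+ 2 by exact: sqr_ge0.
have : al * s ^+ 2 <= s ^+ 2 by rewrite ler_piMl// /al; lra.
nra.
Qed.

Lemma tr_rank1 n (u v : 'cV[R]_n) : \tr (u *m v^T) = dot v u.
Proof. by rewrite mxtrace_mulC /mxtrace big_ord_recl big_ord0 addr0. Qed.

Lemma gauss_pivot_tr : \tr (gauss_pivot A i) =
  \tr A - A i i + (1 - A i i)^-1 * dot a a.
Proof.
rewrite gpE linearD linearZ /= tr_rank1; congr (_ + _).
rewrite mxtrace_mulC mulmxA PP /P mulmxBl mul1mx linearB /=; congr (_ - _).
by rewrite mxtrace_mulC mulmxA tr_rank1 Aii.
Qed.

(** For symmetric matrices both traces are squared Frobenius norms. *)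
Lemma gauss_pivot_frob : \tr (gauss_pivot A i *m gauss_pivot A i) =
  \tr (A *m A) - 2 * dot a a - A i i ^+ 2 +
  2 * (1 - A i i)^-1 * quad A a + (1 - A i i)^-1 ^+ 2 * dot a a ^+ 2.
Proof.
have Pa : P *m a = a by rewrite /a !mulmxA PP.
set c := (1 - A i i)^-1.
rewrite gpE -/c.
set B := P *m A *m P.
have BTB : B^T = B by rewrite /B !trmx_mul symP symA mulmxA.
have h1 : \tr (B *m (c *: (a *m a^T))) = c * quad A a.
  rewrite -scalemxAr linearZ /= mulmxA tr_rank1; congr (_ * _).
  by rewrite /B -!mulmxA Pa -dotP Pa.
have h2 : \tr (c *: (a *m a^T) *m B) = c * quad A a by rewrite mxtrace_mulC h1.
have h3 : \tr (c *: (a *m a^T) *m (c *: (a *m a^T))) = c ^+ 2 * dot a a ^+ 2.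
  rewrite -scalemxAl -scalemxAr scalerA -expr2 linearZ /=; congr (_ * _).
  rewrite mulmxA -(mulmxA a) [a^T *m a]mx11_scalar -/(dot a a) mul_mx_scalar.
  by rewrite -scalemxAl linearZ /= tr_rank1.
have h4 : \tr (B *m B) = \tr (A *m A) - 2 * dot a a - A i i ^+ 2.
  have daa : dot a a = dot (A *m e) (A *m e) - A i i ^+ 2.
    rewrite (dPv (A *m e)) {1 2}/a -!mulmxA.
    by rewrite -(dote (A *m e)) -Aii addrK.
  have trP (M : 'M[R]_p) : \tr (P *m M) = \tr M - dot e (M *m e).
    rewrite /P mulmxBl mul1mx linearB /=; congr (_ - _).
    by rewrite mxtrace_mulC mulmxA tr_rank1.
  have -> : \tr (B *m B) = \tr (P *m (A *m P *m A)).
    rewrite /B -!mulmxA (mulmxA P P) PP mxtrace_mulC -!mulmxA PP.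
    by rewrite mxtrace_mulC -!mulmxA.
  rewrite trP.
  have -> : \tr (A *m P *m A) = \tr (A *m A) - dot (A *m e) (A *m e).
    by rewrite mxtrace_mulC mulmxA mxtrace_mulC trP -mulmxA dotA.
  have -> : dot e (A *m P *m A *m e) = dot a a.
    by rewrite /a -!mulmxA dotP (mulmxA P P) PP -dotA.
  rewrite daa; ring.
rewrite mulmxDl !mulmxDr !linearD /= h1 h2 h3 h4; ring.
Qed.

(** Integrating [expR (quad A z / 2)] over one coordinate produces the square root,
   and this inequality makes the bound of [gauss_quad_mgf] pass through that step:
   it is one pivot of the expansion to second order of [- ln det (1 - A) / 2]. *)
Lemma gauss_pivot_step :
  (Num.sqrt (1 - A i i))^-1 *
    expR (2^-1 * \tr (gauss_pivot A i) + \tr (gauss_pivot A i *m gauss_pivot A i)) <=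
  expR (2^-1 * \tr A + \tr (A *m A)).
Proof.
have d1 := dnn; have d2 := dnn'.
have c0 : 0 < 1 - A i i by rewrite /al in d1; lra.
have s0 : 0 < Num.sqrt (1 - A i i) by rewrite sqrtr_gt0.
set d := A i i in d1 d2 c0 s0 *.
have h1 : (Num.sqrt (1 - d))^-1 <= expR (2^-1 * d + d ^+ 2).
  rewrite -[leRHS]invrK lef_pV2 ?posrE ?invr_gt0 ?expR_gt0// -expRN.
  rewrite -[leLHS]ger0_norm ?expR_ge0// -sqrtr_sqr; apply: ler_wsqrtr.
  rewrite expr2 -expRD -[leRHS]invrK -[leLHS]invrK lef_pV2 ?posrE ?invr_gt0 ?expR_gt0//.
  rewrite -expRN; apply: le_trans (expR_ge1Dx _).
  rewrite -div1r ler_pdivrMr//.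
  have : 0 <= d ^+ 2 * (1 - 2 * d) by rewrite mulr_ge0 ?sqr_ge0//; rewrite /al in d1 d2; lra.
  lra.
apply: le_trans (ler_wpM2r (expR_ge0 _) h1) _.
rewrite -expRD ler_expR gauss_pivot_tr gauss_pivot_frob -/d.
set c := (1 - d)^-1.
have c1 : c <= 8 / 7.
  rewrite /c -div1r ler_pdivrMr//; rewrite /al in d1; lra.
have c2 : 0 <= c by rewrite invr_ge0 ltW.
have qa := boundA a.
have aa0 := dot_ge0 a.
(* the off-diagonal part of a column is small: evaluate the form at [a + e / 2] *)
have aa : dot a a <= 12^-1.
  have Pa : P *m a = a by rewrite /a !mulmxA PP.
  have ea : dot e a = 0 by rewrite -Pa -dotP Pe dotC dot0r.
  have := boundA (P *m a + 2^-1 *: e).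
  rewrite quad_shift Pa !(dotDl, dotDr, dotZl, dotZr) (dotC a e) ea dee -/d.
  move: qa; rewrite !ler_norml => /andP[q1 q2] /andP[q3 q4].
  rewrite /al in d1 d2 q1 q2 q3 q4.
  lra.
set t := dot a a in aa aa0 qa *.
have q1 : quad A a <= 8^-1 * t by move: qa; rewrite ler_norml => /andP[].
have e1 : 2 * c * quad A a <= 2 * c * (8^-1 * t) by rewrite ler_wpM2l// mulr_ge0.
have e2 : c * t <= 8 / 7 * t by rewrite ler_wpM2r.
have e3 : c ^+ 2 <= (8 / 7) ^+ 2 by rewrite lerXn2r ?nnegrE//; lra.
have e4 : c ^+ 2 * t ^+ 2 <= (8 / 7) ^+ 2 * (12^-1 * t).
  apply: ler_pM; rewrite ?sqr_ge0//; rewrite expr2; exact: ler_wpM2r.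
lra.
Qed.

End Pivot.

Notation "''E' f" := (\int[mu]_t (f (col_of_tuple t))%:E)%E (at level 10).

Lemma measurable_coord j :
  measurable_fun setT (fun t : V => col_of_tuple t j ord0 : R).
Proof.
rewrite (_ : (fun _ => _) = (fun t : V => tnth t j)); first exact: measurable_tnth.
by apply/funext => t; rewrite mxE.
Qed.

Lemma measurable_exp_quad A : measurable_fun setT
  (fun t : V => (expR (2^-1 * quad A (col_of_tuple t)))%:E).
Proof.
apply/measurable_EFinP; apply: measurableT_comp; first exact: measurable_expR.
apply: measurable_funM => //.
rewrite (_ : (fun t => _) = (fun t : V =>
   \sum_j col_of_tuple t j ord0 * \sum_k A j k * col_of_tuple t k ord0)).
  apply: measurable_sum => j; apply: measurable_funM; first exact: measurable_coord.
  apply: measurable_sum => k; apply: measurable_funM => //; exact: measurable_coord.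
apply/funext => t; rewrite /quad dotE; apply: eq_bigr => j _.
by congr (_ * _); rewrite mxE.
Qed.

Lemma col_of_upd (t : V) i u (e : 'cV[R]_p := delta_mx i ord0) :
  col_of_tuple (upd t i u) = (1%:M - e *m e^T) *m col_of_tuple t + u *: e.
Proof.
rewrite mulmxBl mul1mx -mulmxA [e^T *m _]mx11_scalar mul_mx_scalar.
have -> : (e^T *m col_of_tuple t) ord0 ord0 = tnth t i.
  rewrite mxE (bigD1 i)//= big1 => [|j ji]; rewrite !mxE ?eqxx ?mul1r ?addr0//.
  by rewrite (negbTE ji) mul0r.
apply/colP => j; rewrite !mxE tnth_upd eqxx andbT.
by case: eqVneq => [->|ji]; rewrite /= ?mulr1 ?subrr ?add0r// !mulr0 subr0 addr0.
Qed.

Lemma gauss_pivotE A i : A^T = A -> A i i < 1 ->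
  'E (fun z => expR (2^-1 * quad A z)) =
  ((Num.sqrt (1 - A i i))^-1%:E * 'E (fun z => expR (2^-1 * quad (gauss_pivot A i) z)))%E.
Proof.
move=> symA Ai; rewrite (resample muE i); last 2 first.
- by move=> t; rewrite lee_fin expR_ge0.
- exact: measurable_exp_quad.
rewrite -ge0_integralZl//; last exact: measurable_exp_quad.
apply: eq_integral => t _.
set z := col_of_tuple t.
rewrite quad_pivot//.
set Pz := (_ - _) *m z; set az := dot _ z.
under eq_integral => u _.
  rewrite col_of_upd quad_shift// -/Pz -/az.
  rewrite (_ : 2^-1 * (quad A Pz + 2 * u * az + u ^+ 2 * A i i) =
    2^-1 * quad A Pz + (2^-1 * A i i * u ^+ 2 + az * u)); last by field.
  rewrite expRD EFinM.
over.
rewrite ge0_integralZl//; last first.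
  apply/measurable_EFinP; apply: measurableT_comp; first exact: measurable_expR.
  by apply: measurable_funD; apply: measurable_funM => //; exact: measurable_funX.
rewrite std_normal_quad// -!EFinM; congr EFin.
rewrite mulrCA -expRD; congr (_ * expR _).
by field; rewrite subr_eq0 eq_sym lt_eqF.
Qed.

Let integral1 (c : R) : (\int[mu]_t c%:E = c%:E)%E.
Proof. by rewrite integral_cst//= probability_setT mule1. Qed.

(** Hanson--Wright, as a bound on the moment generating function of a Gaussian
   quadratic form: integrate the coordinates out one after the other. *)
Theorem gauss_quad_mgf A : A^T = A ->
  (forall v, `|quad A v| <= 8^-1 * dot v v) ->
  ('E (fun z => expR (2^-1 * quad A z)) <=
     (expR (2^-1 * \tr A + \tr (A *m A)))%:E)%E.
Proof.
move=> symA bA.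
suff H (m : nat) : forall (K : {set 'I_p}) A, #|K| = m -> A^T = A ->
    (forall v, `|quad A v| <= 8^-1 * dot v v) ->
    (forall j, j \notin K -> A *m delta_mx j ord0 = (0 : 'cV[R]_p)) ->
    ('E (fun z => expR (2^-1 * quad A z)) <=
     (expR (2^-1 * \tr A + \tr (A *m A)))%:E)%E.
  by apply: (H _ [set: 'I_p]%SET) => // j; rewrite inE.
elim: m => [|m IH] K B cK symB bB KB.
  have B0 : B = 0.
    apply/matrixP => j k; have := KB k; rewrite (cards0_eq cK) inE => /(_ isT).
    move=> /(congr1 (fun M : 'cV_p => M j ord0)); rewrite !mxE => <-.
    rewrite (bigD1 k)//= big1 => [|l lk]; rewrite mxE ?eqxx ?mulr1 ?addr0//.
    by rewrite (negbTE lk) mulr0.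
  rewrite B0 mul0mx mxtrace0 mulr0 addr0 expR0.
  under eq_integral do rewrite /quad mul0mx dot0r mulr0 expR0.
  by rewrite integral1.
have [i iK] : exists i, i \in K by apply/set0Pn; rewrite -card_gt0 cK.
have B1 : B i i < 1.
  have := bB (delta_mx i ord0); rewrite /quad.
  have -> : dot (delta_mx i ord0) (B *m delta_mx i ord0) = B i i.
    rewrite dotE (bigD1 i)//= big1 => [|j ji]; last by rewrite mxE (negbTE ji) mul0r.
    rewrite mxE !eqxx mul1r addr0 mxE (bigD1 i)//= big1 => [|j ji].
      by rewrite mxE !eqxx mulr1 addr0.
    by rewrite mxE (negbTE ji) mulr0.
  have -> : dot (delta_mx i ord0 : 'cV[R]_p) (delta_mx i ord0) = 1.
    rewrite dotE (bigD1 i)//= big1 => [|j ji]; last by rewrite mxE (negbTE ji) mul0r.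
    by rewrite mxE !eqxx mul1r addr0.
  rewrite ler_norml => /andP[_ h]; lra.
rewrite (gauss_pivotE symB B1).
apply: le_trans (_ : (_ <= ((Num.sqrt (1 - B i i))^-1 *
    expR (2^-1 * \tr (gauss_pivot B i) + \tr (gauss_pivot B i *m gauss_pivot B i)))%:E)%E) _.
  rewrite EFinM lee_pmul2l ?lte_fin ?invr_gt0 ?sqrtr_gt0 ?subr_gt0//.
  apply: (IH (K :\ i)%SET).
  - by move: cK; rewrite (cardsD1 i) iK => -[].
  - exact: gauss_pivot_sym.
  - exact: gauss_pivot_bound.
  - move=> j jK; apply: gauss_pivot_col => //.
    by move: jK; rewrite !inE negb_and negbK => /orP[/eqP|/KB]; [right|left].
by rewrite lee_fin; exact: gauss_pivot_step.
Qed.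

(** Rank one forms stay rank one under pivoting, so that the integration is exact.
   The lower tails need large values of [c], far outside the range of small forms
   that [gauss_quad_mgf] covers. *)
Lemma gauss_rank1 (c : R) v : 0 <= c ->
  ('E (fun z => expR (- (2^-1 * c * dot v z ^+ 2))) =
    ((Num.sqrt (1 + c * dot v v))^-1)%:E)%E.
Proof.
move=> c0.
suff H (m : nat) : forall (K : {set 'I_p}) c v, #|K| = m -> 0 <= c ->
    (forall j, j \notin K -> v j ord0 = 0) ->
    ('E (fun z => expR (2^-1 * quad (- c *: (v *m v^T)) z)) =
    ((Num.sqrt (1 + c * dot v v))^-1)%:E)%E.
  rewrite -(H _ [set: 'I_p]%SET c v erefl c0); last by move=> j; rewrite inE.
  apply: eq_integral => t _; congr (expR _)%:E.
  rewrite /quad -scalemxAl dotZr -mulmxA [v^T *m _]mx11_scalar -/(dot v _).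
  rewrite mul_mx_scalar dotZr (dotC _ v); ring.
elim: m => [|m IH] K {}c {}v cK {}c0 Kv.
  have v0 : v = 0.
    by apply/colP => j; rewrite Kv ?mxE// (cards0_eq cK) inE.
  rewrite v0 mul0mx scaler0.
  under eq_integral do rewrite /quad mul0mx dot0r mulr0 expR0.
  by rewrite integral1 dot0r mulr0 addr0 sqrtr1 invr1.
have [i iK] : exists i, i \in K by apply/set0Pn; rewrite -card_gt0 cK.
set A := - c *: (v *m v^T).
have AE j k : A j k = - c * (v j ord0 * v k ord0).
  by rewrite mxE; congr (_ * _); rewrite mxE big_ord_recl big_ord0 addr0 mxE.
have symA : A^T = A by apply/matrixP => j k; rewrite mxE !AE (mulrC (v k _)).
have q0 : 0 <= c * v i ord0 ^+ 2 by rewrite mulr_ge0 ?sqr_ge0.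
have Ai : A i i < 1 by rewrite AE -expr2; lra.
rewrite (gauss_pivotE symA Ai).
pose e : 'cV[R]_p := delta_mx i ord0.
pose v' := v - v i ord0 *: e.
pose c' := c / (1 + c * v i ord0 ^+ 2).
have d0 : 0 < 1 + c * v i ord0 ^+ 2 by lra.
have v'E j : v' j ord0 = if j == i then 0 else v j ord0.
  rewrite !mxE eqxx andbT; case: eqVneq => [->|_]; first by rewrite mulr1 subrr.
  by rewrite mulr0 subr0.
have PvE : (1%:M - e *m e^T) *m v = v'.
  rewrite mulmxBl mul1mx -mulmxA [e^T *m v]mx11_scalar mul_mx_scalar.
  congr (_ - _ *: _); rewrite mxE (bigD1 i)//= big1 => [|j ji]; rewrite !mxE ?eqxx ?mul1r ?addr0//.
  by rewrite (negbTE ji) mul0r.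
have -> : gauss_pivot A i = - c' *: (v' *m v'^T).
  rewrite /gauss_pivot -/e.
  set P := 1%:M - e *m e^T in PvE *.
  have symP : P^T = P by rewrite linearB /= trmx1 trmx_mul trmxK.
  have vP : v^T *m P = v'^T by rewrite -PvE trmx_mul symP.
  have ve : v^T *m e = (v i ord0)%:M.
    rewrite [LHS]mx11_scalar; congr _%:M.
    rewrite mxE (bigD1 i)//= big1 => [|j ji]; rewrite !mxE ?eqxx ?mulr1 ?addr0//.
    by rewrite (negbTE ji) mulr0.
  have PAP : P *m A *m P = - c *: (v' *m v'^T).
    by rewrite -vP -PvE /A -scalemxAr -scalemxAl !mulmxA.
  have PAe : P *m A *m e = (- c * v i ord0) *: v'.
    have -> : P *m A *m e = - c *: ((P *m v) *m (v^T *m e)).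
      by rewrite /A -scalemxAr -scalemxAl !mulmxA.
    by rewrite ve PvE mul_mx_scalar scalerA.
  rewrite PAP PAe linearZ /= -scalemxAr -scalemxAl !scalerA -scalerDl; congr (_ *: _).
  by rewrite AE /c'; field; rewrite gt_eqF.
rewrite (IH (K :\ i)%SET c' v').
- rewrite -EFinM; congr EFin; rewrite -invfM; congr (_^-1).
  rewrite -sqrtrM ?subr_ge0 ?ltW//; congr Num.sqrt.
  have -> : dot v v = dot v' v' + v i ord0 ^+ 2.
    rewrite !dotE (bigD1 i)//= [in RHS](bigD1 i)//= v'E eqxx mulr0 add0r addrC.
    rewrite -expr2; congr (_ + _); apply: eq_bigr => j ji.
    by rewrite v'E (negbTE ji).
  by rewrite AE /c'; field; rewrite gt_eqF.
- by move: cK; rewrite (cardsD1 i) iK => -[].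
- by rewrite divr_ge0// ltW.
- move=> j jK; rewrite v'E; case: eqVneq => // ji.
  by apply: Kv; move: jK; rewrite !inE ji.
Qed.

End GaussVector.

(** * Nets of the unit ball *)

Section Nets.
Variable R : realType.

Section Lattice.
Variables (p : nat) (dl : R).
Hypotheses (p0 : (0 < p)%N) (dl0 : 0 < dl) (dl1 : dl <= 1).

Let pR0 : 0 < p%:R :> R. Proof. by rewrite ltr0n. Qed.
Let h : R := dl / Num.sqrt p%:R.
Let sp0 : 0 < Num.sqrt p%:R :> R. Proof. by rewrite sqrtr_gt0. Qed.
Let h0 : 0 < h. Proof. by rewrite divr_gt0. Qed.

Let M := Num.truncn (p%:R / dl).
Let F : finType := {ffun 'I_p -> 'I_M.+1 * bool}.

Let coordf (z : 'I_M.+1 * bool) : R := h * ((-1) ^+ z.2 * z.1%:R).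
Let vecf (f : F) : 'cV[R]_p := \col_j coordf (f j).
Let len (f : F) : R := \sum_j (f j).1%:R.

(** Chernoff's bound for counting: the indicator of [len f <= p / dl] is at most
   [expR (p - dl * len f)], and the sum of the latter factorises. *)
Let count_le (P : pred F) : (forall f, P f -> len f <= p%:R / dl) ->
  (#|P|)%:R <= (4 * expR 1 / dl) ^+ p.
Proof.
move=> lenP.
have dR : 0 < 1 - expR (- dl) by rewrite subr_gt0 -expR0 ltr_expR oppr_lt0.
apply: (@le_trans _ _ (\sum_(f : F) expR (p%:R - dl * len f))).
  rewrite -sum1_card natr_sum [leLHS]big_mkcond /=; apply: ler_sum => f _.
  rewrite unfold_in; case: ifPn => [/lenP Pf|_]; last exact: expR_ge0.
  rewrite -[leLHS]expR0 ler_expR subr_ge0 mulrC -ler_pdivlMr//.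
have -> : \sum_(f : F) expR (p%:R - dl * len f) =
    expR p%:R * (\sum_(z : 'I_M.+1 * bool) expR (- (dl * z.1%:R))) ^+ p.
  rewrite -[in X in _ ^+ X](card_ord p) -prodr_const bigA_distr_bigA mulr_sumr.
  apply: eq_bigr => f _; rewrite expRD; congr (_ * _).
  by rewrite /len mulr_sumr -sumrN expR_sum.
rewrite -[p%:R]mul1r mulrC expRM_natr // -exprMn lerXn2r ?nnegrE.
- by [].
- by rewrite mulr_ge0 ?sumr_ge0 ?expR_ge0// => z _; exact: expR_ge0.
- by rewrite divr_ge0 ?mulr_ge0 ?expR_ge0// ltW.
have -> : \sum_(z : 'I_M.+1 * bool) expR (- (dl * z.1%:R)) =
    2 * \sum_(k < M.+1) expR (- dl) ^+ k.
  rewrite -(pair_bigA _ (fun (k : 'I_M.+1) (b : bool) => expR (- (dl * k%:R)))) /=.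
  rewrite mulr_sumr; apply: eq_bigr => k _.
  have e : expR (- (dl * k%:R)) = expR (- dl) ^+ k.
    by rewrite -expRM_natl mulrN [_%:R * _]mulrC.
  by rewrite big_bool /= e; ring.
have geo : \sum_(k < M.+1) expR (- dl) ^+ k <= (1 - expR (- dl))^-1.
  rewrite -[leRHS]div1r ler_pdivlMr// mulrC.
  have := subrX1 (expR (- dl)) M.+1 => e1.
  have -> : (1 - expR (- dl)) * \sum_(k < M.+1) expR (- dl) ^+ k = 1 - expR (- dl) ^+ M.+1.
    by rewrite -[LHS]opprK -mulNr opprB -e1 opprB.
  by rewrite gerBl exprn_ge0 ?expR_ge0.
have low : dl / 2 <= 1 - expR (- dl).
  have := expR_ge1Dx dl => e1.
  have : expR (- dl) * (1 + dl) <= 1.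
    by rewrite -[leRHS](expRxMexpNx_1 dl) mulrC ler_wpM2r ?expR_ge0.
  have := dl1; have := dl0; have := expR_ge0 (- dl); nra.
have inv : (1 - expR (- dl))^-1 <= 2 / dl.
  by rewrite -[leRHS]invrK lef_pV2 ?posrE ?invr_gt0 ?divr_gt0// invf_div.
rewrite [leRHS](_ : _ = 2 * (2 / dl) * expR 1); last by field; rewrite gt_eqF.
rewrite ler_wpM2r ?expR_ge0// ler_wpM2l//; exact: le_trans inv.
Qed.

(** Round every coordinate towards [0] on a grid of mesh [dl / sqrt p]; by
   Cauchy--Schwarz the grid coordinates of a rounded unit vector have l1-norm at
   most [p / dl], and such integer points are counted with their generating
   function. *)
Lemma lattice_net : exists N : seq 'cV[R]_p,
  [/\ (size N)%:R <= (4 * expR 1 / dl) ^+ p,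
      forall u, u \in N -> dot u u <= 1 &
      forall v, dot v v <= 1 ->
        exists2 u, u \in N & dot (v - u) (v - u) <= dl ^+ 2].
Proof.
pose P : pred F := [pred f | (len f <= p%:R / dl) && (dot (vecf f) (vecf f) <= 1)].
exists [seq vecf f | f <- enum P]; split.
- rewrite size_map -cardE; apply: count_le => f; by rewrite /P /= => /andP[].
- by move=> _ /mapP[f + ->]; rewrite mem_enum => /andP[].
move=> v v1.
pose k j := Num.truncn (`|v j ord0| / h).
have kh j : (k j)%:R * h <= `|v j ord0| < ((k j).+1)%:R * h.
  rewrite -ler_pdivlMr// -ltr_pdivrMr//.
  by apply: truncn_itv; rewrite divr_ge0// ltW.
have sumk : \sum_j (k j)%:R <= p%:R / dl :> R.
  apply: (@le_trans _ _ (h^-1 * \sum_j `|v j ord0|)).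
    rewrite mulr_sumr; apply: ler_sum => j _.
    by rewrite mulrC ler_pdivlMr//; case/andP: (kh j).
  have cs : \sum_j `|v j ord0| <= Num.sqrt p%:R.
    rewrite -[leLHS]ger0_norm ?sumr_ge0// -sqrtr_sqr; apply: ler_wsqrtr.
    have := sum_CS xpredT (fun=> 1 : R) (fun j => `|v j ord0|).
    under eq_bigr do rewrite mul1r.
    move=> /le_trans; apply.
    under eq_bigr do rewrite expr1n; rewrite sumr_const card_ord.
    rewrite -[leRHS]mulr1 ler_wpM2l//.
    move: v1; rewrite dotE; congr (_ <= _); apply: eq_bigr => j _.
    by rewrite real_normK ?num_real// expr2.
  apply: (@le_trans _ _ (h^-1 * Num.sqrt p%:R)).
    by apply: ler_wpM2l => //; rewrite invr_ge0 ltW.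
  by rewrite /h invf_div mulrAC -expr2 sqr_sqrtr// ltW.
have kM j : (k j < M.+1)%N.
  have q0 : 0 <= p%:R / dl by rewrite divr_ge0// ltW.
  rewrite ltnS /M truncn_ge_nat//; apply: le_trans sumk; rewrite (bigD1 j)//= lerDl sumr_ge0//.
pose f : F := [ffun j => (Ordinal (kM j), v j ord0 < 0)].
have fE j : vecf f j ord0 = (-1) ^+ (v j ord0 < 0)%R * ((k j)%:R * h).
  by rewrite mxE ffunE /coordf /= mulrCA [h * _]mulrC.
have vE j : v j ord0 = (-1) ^+ (v j ord0 < 0)%R * `|v j ord0|.
  by rewrite {1}[v j ord0]realEsign ?num_real.
have sgnE (b : bool) (r : R) : ((-1) ^+ b * r) ^+ 2 = r ^+ 2.
  by rewrite exprMn sqrr_sign mul1r.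
have lenf : len f <= p%:R / dl by rewrite /len; under eq_bigr do rewrite ffunE.
have kh0 j : 0 <= (k j)%:R * h by rewrite mulr_ge0// ltW.
exists (vecf f).
  apply: map_f; rewrite mem_enum; apply/andP; split=> //.
  apply: le_trans v1; rewrite !dotE; apply: ler_sum => j _.
  rewrite fE [in leRHS]vE -!expr2 !sgnE lerXn2r ?nnegrE//.
  by case/andP: (kh j).
rewrite dotE; apply: (@le_trans _ _ (\sum_(j < p) h ^+ 2)).
  apply: ler_sum => j _; rewrite -expr2 !mxE -/(coordf _).
  have -> : v j ord0 - coordf (f j) = (-1) ^+ (v j ord0 < 0)%R * (`|v j ord0| - (k j)%:R * h).
    by rewrite mulrBr -vE -fE mxE.
  rewrite sgnE; have /andP[k1 k2] := kh j.
  have h3 : `|v j ord0| - (k j)%:R * h <= h.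
    by rewrite lerBlDl ltW//; move: k2; rewrite -natr1 mulrDl mul1r.
  by rewrite lerXn2r ?nnegrE ?subr_ge0// ltW.
rewrite sumr_const card_ord /h expr_div_n sqr_sqrtr; last exact: ltW.
by rewrite -[_ *+ p]mulr_natr divfK// gt_eqF.
Qed.

End Lattice.

Section FromNet.
Variables (n p : nat) (x : 'I_n -> 'cV[R]_p).

Let par (j : 'I_n) (u d : 'cV[R]_p) :
  dot (x j) (u + d) ^+ 2 <= 2 * dot (x j) u ^+ 2 + 2 * dot (x j) d ^+ 2.
Proof.
rewrite dotDr; set a := dot _ _; set b := dot _ _.
have : 0 <= (a - b) ^+ 2 by exact: sqr_ge0.
nra.
Qed.

Let unit_scale (Q : R) (f : 'cV[R]_p -> R) :
  (forall c v, f (c *: v) = c ^+ 2 * f v) ->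
  (forall v, dot v v = 1 -> Q <= f v) -> forall v, Q * dot v v <= f v.
Proof.
move=> fZ fQ v; have [->|v0] := eqVneq v 0.
  by rewrite dot0r mulr0 -(scale0r (0 : 'cV[R]_p)) fZ expr0n mul0r.
have vv := dot_gt0 v0.
have s0 : 0 < Num.sqrt (dot v v) by rewrite sqrtr_gt0.
have ss : Num.sqrt (dot v v) ^+ 2 = dot v v by rewrite sqr_sqrtr// ltW.
have e : dot ((Num.sqrt (dot v v))^-1 *: v) ((Num.sqrt (dot v v))^-1 *: v) = 1.
  by rewrite dotZl dotZr -{3}ss; field; rewrite gt_eqF.
by have := fQ _ e; rewrite fZ exprVn ss mulrC ler_pdivlMr.
Qed.

Let sumZ (Q : pred 'I_n) c v : \sum_(j | Q j) dot (x j) (c *: v) ^+ 2 =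
  c ^+ 2 * \sum_(j | Q j) dot (x j) v ^+ 2.
Proof. by rewrite mulr_sumr; apply: eq_bigr => j _; rewrite dotZr exprMn. Qed.

(** A vector of the ball is a net point plus a vector of half the norm, so that the
   supremum of the form over the ball is bounded by its values on the net and half
   of itself. *)
Lemma gram_upper_net (N : seq 'cV[R]_p) (a : R) :
  (forall v, dot v v <= 1 -> exists2 u, u \in N & dot (v - u) (v - u) <= 2^-1 ^+ 2) ->
  (forall u, u \in N -> \sum_j dot (x j) u ^+ 2 <= a) ->
  forall v, \sum_j dot (x j) v ^+ 2 <= 4 * a * dot v v.
Proof.
move=> cov Na.
pose f v := \sum_j dot (x j) v ^+ 2.
pose S := [set f v | v in [set v | dot v v <= 1]].
have S0 : S !=set0 by exists (f 0); exists 0 => //=; rewrite dot0r ler01.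
have Sub : has_ubound S.
  exists (\sum_j dot (x j) (x j)) => _ [v /= v1 <-].
  apply: ler_sum => j _; apply: (le_trans (dot_CS _ _)).
  by rewrite -[leRHS]mulr1 ler_wpM2l// dot_ge0.
have fS v : f v <= sup S * dot v v.
  rewrite -lerN2 -mulNr.
  apply: (@unit_scale (- sup S) (fun v => - f v)) => [c w|w w1].
    by rewrite /f sumZ mulrN.
  by rewrite lerN2; apply: ub_le_sup => //; exists w => //=; rewrite w1.
have supS : sup S <= 4 * a.
  suff : sup S <= 2 * a + 2 * (4^-1 * sup S) by lra.
  apply: ge_sup => // _ [v /= v1 <-].
  have [u uN uv] := cov v v1.
  apply: (@le_trans _ _ (2 * f u + 2 * f (v - u))).
    rewrite /f !mulr_sumr -big_split /=; apply: ler_sum => j _.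
    by rewrite -{1}(subrKC u v); exact: par.
  apply: lerD; first by rewrite ler_pM2l// Na.
  rewrite ler_pM2l//; apply: (le_trans (fS _)); rewrite mulrC.
  apply: ler_wpM2r; last by move: uv; rewrite expr2 -invfM -natrM.
  have : f 0 <= sup S by apply: ub_le_sup => //; exists 0 => //=; rewrite dot0r ler01.
  by apply: le_trans; apply: sumr_ge0 => j _; exact: sqr_ge0.
by move=> v; apply: (le_trans (fS v)); rewrite ler_wpM2r// dot_ge0.
Qed.

(** The upper bound [L] controls what is lost by moving to the nearest net point.
   Such a point has norm at least [1 / 2], so net points near the origin, where no
   lower bound can hold, do not matter. *)
Lemma gram_lower_net (N : seq 'cV[R]_p) (Q : pred 'I_n) (dl L b : R) :
  dl <= 2^-1 -> 0 <= dl ->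
  (forall v, dot v v <= 1 -> exists2 u, u \in N & dot (v - u) (v - u) <= dl ^+ 2) ->
  (forall v, \sum_j dot (x j) v ^+ 2 <= L * dot v v) -> 0 <= L ->
  (forall u, u \in N -> 4^-1 <= dot u u ->
     2 * b + 2 * (L * dl ^+ 2) <= \sum_(j | Q j) dot (x j) u ^+ 2) ->
  forall v, b * dot v v <= \sum_(j | Q j) dot (x j) v ^+ 2.
Proof.
move=> dl2 dl0 cov up L0 low.
apply: unit_scale => [c v|v v1]; first exact: sumZ.
have v1' : dot v v <= 1 by rewrite v1.
have [u uN uv] := cov v v1'.
have dl4 : dl ^+ 2 <= 4^-1.
  by rewrite (_ : 4^-1 = 2^-1 ^+ 2) ?lerXn2r ?nnegrE ?invr_ge0// expr2 -invfM -natrM.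
have u4 : 4^-1 <= dot u u.
  have : dot v v <= 2 * dot u u + 2 * dot (v - u) (v - u).
    rewrite !dotE !mulr_sumr -big_split; apply: ler_sum => j _ /=.
    rewrite !mxE; set s := v j ord0; set t := u j ord0.
    have : 0 <= (s - 2 * t) ^+ 2 by exact: sqr_ge0.
    nra.
  rewrite v1; lra.
have h1 := low u uN u4.
have h2 : \sum_(j | Q j) dot (x j) u ^+ 2 <=
    2 * (\sum_(j | Q j) dot (x j) v ^+ 2) + 2 * (\sum_(j | Q j) dot (x j) (v - u) ^+ 2).
  rewrite !mulr_sumr -big_split /=; apply: ler_sum => j _.
  have -> : dot (x j) (v - u) ^+ 2 = dot (x j) (u - v) ^+ 2.
    by rewrite -opprB dotNr sqrrN.
  by rewrite -{1}(subrKC v u); exact: par.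
have h3 : \sum_(j | Q j) dot (x j) (v - u) ^+ 2 <= L * dl ^+ 2.
  apply: (@le_trans _ _ (L * dot (v - u) (v - u))).
    apply: le_trans (up _); rewrite [leRHS](bigID Q) /= lerDl.
    by apply: sumr_ge0 => j _; exact: sqr_ge0.
  by rewrite ler_wpM2l.
lra.
Qed.

End FromNet.
End Nets.

(** * Deterministic conditions for closeness *)

Section Events.
Variables (R : realType) (n p : nat) (x : 'I_n -> 'cV[R]_p).

Definition gram_out (J : {set 'I_n}) : 'M[R]_p := gram x (fun j => (j \notin J)%:R).

Lemma dot_gram_out J z v : dot z (gram_out J *m v) =
  \sum_(j | j \notin J) dot (x j) z * dot (x j) v.
Proof.
rewrite /gram_out dot_gram [RHS]big_mkcond /=; apply: eq_bigr => j _.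
by case: ifP; rewrite ?mul1r ?mul0r.
Qed.

Lemma gram_outD J : gram x (fun=> 1) = gram_out J + \sum_(j in J) x j *m (x j)^T.
Proof.
rewrite /gram_out /gram [in RHS]big_mkcond [X in _ = _ + X]big_mkcond -big_split /=.
apply: eq_bigr => j _; case: ifP => _ /=; first by rewrite scale0r add0r scale1r.
by rewrite addr0.
Qed.

Lemma rank1_mul (a v : 'cV[R]_p) : a *m a^T *m v = dot a v *: a.
Proof. by rewrite -mulmxA [a^T *m v]mx11_scalar mul_mx_scalar. Qed.

Variables (K kap eps : R) (k : nat).
Hypotheses (n0 : (0 < n)%N) (p0 : (0 < p)%N).
Hypotheses (K0 : 0 < K) (kap0 : 0 < kap) (eps0 : 0 <= eps).
Hypothesis up : forall v, \sum_j dot (x j) v ^+ 2 <= K * n%:R * dot v v.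
Hypothesis low : forall J : {set 'I_n}, (#|J| <= k.+1)%N ->
  forall v, kap * n%:R * dot v v <= \sum_(j | j \notin J) dot (x j) v ^+ 2.

Let nR0 : 0 < n%:R :> R. Proof. by rewrite ltr0n. Qed.
Let kn0 : 0 < kap * n%:R. Proof. by rewrite mulr_gt0. Qed.

Lemma gram_out_posdef (J : {set 'I_n}) : (#|J| <= k.+1)%N -> posdefmx (gram_out J).
Proof.
move=> cJ; split; first exact: gram_sym.
move=> v v0; rewrite -mulmxA -/(dot _ _) dot_gram_out.
under eq_bigr do rewrite -expr2.
by apply: lt_le_trans (low cJ v); rewrite mulr_gt0// dot_gt0.
Qed.

Let W := gram x (fun=> 1).

Lemma gram_all_posdef : posdefmx W.
Proof.
have := @gram_out_posdef finset.set0 _; rewrite cards0 => /(_ isT).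
by rewrite /W (gram_outD finset.set0) big_set0 addr0.
Qed.

Section LeaveOneOut.
Variable i : 'I_n.
Let M := gram_out [set i]%SET.
Let a := invmx M *m x i.
Let r := dot (x i) a.

Let c1 : (#|[set i]%SET : {set 'I_n}| <= k.+1)%N.
Proof. by rewrite cards1. Qed.

Let Ma : M *m a = x i.
Proof. by rewrite mulKVmx//; apply: posdefmx_unit; exact: gram_out_posdef. Qed.

Let ra : kap * n%:R * dot a a <= r.
Proof.
apply: (le_trans (low c1 a)); rewrite /r -Ma dotC dot_gram_out.
by under [leRHS]eq_bigr do rewrite -expr2.
Qed.

Let r0 : 0 <= r.
Proof. by apply: le_trans ra; rewrite mulr_ge0 ?dot_ge0// ltW. Qed.

Let WE : W = M + x i *m (x i)^T.
Proof. by rewrite /W (gram_outD [set i]%SET) big_set1. Qed.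

Let r10 : 0 < 1 + r. Proof. by have := r0; lra. Qed.

(** Sherman--Morrison for [W = M + x i (x i)^T]. *)
Lemma leverage_loo : dot (x i) (invmx W *m x i) = r / (1 + r).
Proof.
have U := posdefmx_unit gram_all_posdef.
have -> : invmx W *m x i = (1 + r)^-1 *: a.
  apply: (can_inj (mulKmx U)); rewrite mulKVmx// -scalemxAr WE mulmxDl Ma.
  rewrite rank1_mul -/r (_ : x i + r *: x i = (1 + r) *: x i).
    by rewrite scalerA mulVf ?scale1r// gt_eqF.
  by rewrite scalerDl scale1r.
by rewrite dotZr mulrC.
Qed.

(** Adding the sample [i] lowers the trace of the inverse by
   [dot a a / (1 + r)], where [dot a a] is at most [r / (kap n)]. *)
Lemma tr_inv_loo :
  \tr (invmx W) <= \tr (invmx M) <= \tr (invmx W) + (kap * n%:R)^-1.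
Proof.
have U := posdefmx_unit gram_all_posdef.
have UM : M \in unitmx by apply: posdefmx_unit; exact: gram_out_posdef.
have symM : (invmx M)^T = invmx M by rewrite trmx_inv gram_sym.
have -> : invmx W = invmx M - (1 + r)^-1 *: (a *m a^T).
  apply: (can_inj (mulKmx U)); rewrite mulmxV// mulmxBr -scalemxAr.
  have -> : W *m (a *m a^T) = (1 + r) *: (x i *m a^T).
    rewrite mulmxA WE mulmxDl Ma rank1_mul -/r scalemxAl; congr (_ *m _).
    by rewrite scalerDl scale1r.
  rewrite scalerA mulVf ?scale1r ?gt_eqF// WE mulmxDl mulmxV//.
  have -> : x i *m a^T = x i *m (x i)^T *m invmx M by rewrite trmx_mul symM mulmxA.
  by rewrite addrK.
have tE : \tr (invmx M - (1 + r)^-1 *: (a *m a^T)) = \tr (invmx M) - dot a a / (1 + r).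
  rewrite linearB linearZ /= mxtrace_mulC mulrC; congr (_ - _ * _).
  by rewrite /mxtrace big_ord_recl big_ord0 addr0.
rewrite tE; apply/andP; split.
  by rewrite gerBl divr_ge0 ?dot_ge0// ltW.
suff : dot a a / (1 + r) <= (kap * n%:R)^-1 by lra.
have : dot a a <= r / (kap * n%:R) by rewrite ler_pdivlMr// mulrC ra.
move=> h; rewrite ler_pdivrMr//; apply: (le_trans h).
by rewrite mulrC ler_wpM2l ?invr_ge0 ?(ltW kn0)//; have := r0; lra.
Qed.

End LeaveOneOut.

Hypothesis loo : forall i,
  `|dot (x i) (invmx (gram_out [set i]%SET) *m x i) - \tr (invmx (gram_out [set i]%SET))|
    <= eps.

Let e := 2 * eps + (kap * n%:R)^-1.

Let loo_ge0 i : 0 <= dot (x i) (invmx (gram_out [set i]%SET) *m x i).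
Proof.
have c1 : (#|[set i]%SET : {set 'I_n}| <= k.+1)%N by rewrite cards1.
set a := _ *m _; have <- : gram_out [set i]%SET *m a = x i.
  by rewrite mulKVmx//; apply: posdefmx_unit; exact: gram_out_posdef.
by rewrite dotC dot_gram_out; apply: sumr_ge0 => j _; rewrite -expr2 sqr_ge0.
Qed.

(** All leverages are close to each other since the leave-one-out traces are;
   their mean is exactly [p / n], so no expectation has to be computed. *)
Lemma leverage_close i : `|dot (x i) (invmx W *m x i) - p%:R / n%:R| <= e.
Proof.
pose h j := dot (x j) (invmx W *m x j).
have close j l : h j - h l <= e.
  rewrite /h !leverage_loo.
  set r := dot (x j) _; set s := dot (x l) _.
  have r0 : 0 <= r by exact: loo_ge0.
  have s0 : 0 <= s by exact: loo_ge0.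
  have rs : r - s <= e.
    have := loo j; have := loo l; rewrite -/r -/s !ler_norml => /andP[s1 s2] /andP[r1 r2].
    have /andP[t1 t2] := tr_inv_loo j; have /andP[t3 t4] := tr_inv_loo l.
    rewrite /e; lra.
  have e0 : 0 <= e by rewrite /e addr_ge0 ?mulr_ge0// invr_ge0 ltW.
  have [sr|rs'] := leP s r; last first.
    apply: le_trans e0; rewrite subr_le0 ler_pdivrMr ?ltr_pwDl//.
    rewrite mulrAC ler_pdivlMr ?ltr_pwDl//; nra.
  apply: le_trans rs.
  have -> : r / (1 + r) - s / (1 + s) = (r - s) / ((1 + r) * (1 + s)).
    by field; rewrite !gt_eqF ?ltr_pwDl.
  rewrite ler_pdivrMr ?mulr_gt0 ?ltr_pwDl//.
  apply: ler_peMr; first by rewrite subr_ge0.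
  nra.
have sumh : \sum_j h j = p%:R.
  rewrite -(gram_leverage_sum (posdefmx_unit gram_all_posdef)).
  by apply: eq_bigr => j _; rewrite mul1r.
have avg (c : R) : \sum_(j < n) c = n%:R * c by rewrite sumr_const card_ord mulr_natl.
rewrite -/(h i) ler_norml; apply/andP; split.
  have : p%:R <= n%:R * (h i + e).
    rewrite -sumh -avg; apply: ler_sum => j _; have := close j i; lra.
  rewrite mulrC -ler_pdivrMr//; lra.
have : n%:R * (h i - e) <= p%:R.
  rewrite -sumh -avg; apply: ler_sum => j _; have := close i j; lra.
rewrite mulrC -ler_pdivlMr//; lra.
Qed.

Variables (t a b : R).
Hypotheses (t0 : 0 < t) (a0 : 0 < a) (b0 : 0 < b).
Hypothesis (ha : p%:R / n%:R + e <= 1 - a).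
Hypothesis (hb : b <= p%:R / n%:R).
Hypothesis (nk : (2 * k <= n)%N).
Hypotheses (eps1 : eps <= 1 / 2).
Hypothesis hnorm : forall i, `|dot (x i) (x i) - p%:R| <= eps * p%:R.
Hypothesis spread0 : forall i (J : {set 'I_n}), i \notin J -> #|J| = k ->
  let u := invmx (gram_out (i |: J)%SET) *m x i in
  t * n%:R * dot u u <= \sum_(j in J) dot (x j) u ^+ 2.

Let c0 : R := a ^+ 2 * t * b / (4 * K ^+ 2 * (1 + K ^+ 2 / kap ^+ 2)).

Let den0 : 0 < 4 * K ^+ 2 * (1 + K ^+ 2 / kap ^+ 2).
Proof.
rewrite mulr_gt0 ?mulr_gt0 ?exprn_gt0//.
by rewrite ltr_pwDl// divr_ge0 ?sqr_ge0.
Qed.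

Let sub_up (Q : pred 'I_n) v : \sum_(j | Q j) dot (x j) v ^+ 2 <= K * n%:R * dot v v.
Proof.
apply: le_trans (up v); rewrite [leRHS](bigID Q) /= lerDl.
by apply: sumr_ge0 => j _; exact: sqr_ge0.
Qed.

Let Kn0 : 0 < K * n%:R. Proof. by rewrite mulr_gt0. Qed.

Let mul_up J v : dot (gram_out J *m v) (gram_out J *m v) <= (K * n%:R) ^+ 2 * dot v v.
Proof.
set z := _ *m v; have [->|z0] := eqVneq z 0.
  by rewrite dot0r mulr_ge0 ?sqr_ge0 ?dot_ge0.
have zz := dot_gt0 z0.
suff : dot z z * dot z z <= dot z z * ((K * n%:R) ^+ 2 * dot v v) by rewrite ler_pM2l.
have zE : dot z z = \sum_(j | j \notin J) dot (x j) z * dot (x j) v.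
  by rewrite {2}/z dot_gram_out.
rewrite -expr2 {1}zE; apply: (le_trans (sum_CS _ _ _)).
rewrite (_ : dot z z * _ = (K * n%:R * dot z z) * (K * n%:R * dot v v)); last by ring.
apply: ler_pM; rewrite ?sub_up//; apply: sumr_ge0 => j _; exact: sqr_ge0.
Qed.

(** The row of leverages of a sample [i] is spread out over any set [J] not
   containing [i].  With [u] computed from the samples outside [J] and [i], the
   vector [(<x j, u>)_(j in J)] is not small by hypothesis; putting the samples
   of [J] back applies a well conditioned linear map to it. *)
Lemma leverage_spread i (J : {set 'I_n}) : i \notin J -> #|J| = k ->
  c0 <= \sum_(j in J) dot (x j) (invmx W *m x i) ^+ 2.
Proof.
move=> iJ cJ.
have ciJ : (#|(i |: J)%SET| <= k.+1)%N by rewrite cardsU1 iJ cJ.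
set M := gram_out (i |: J)%SET.
have UM : M \in unitmx by apply: posdefmx_unit; exact: gram_out_posdef.
set u' := invmx W *m x i; set B := \sum_(j in J) _.
have B0 : 0 <= B by apply: sumr_ge0 => j _; exact: sqr_ge0.
pose u := invmx M *m x i.
have Mu : M *m u = x i by rewrite mulKVmx.
set h := dot (x i) u'.
have ah : a <= 1 - h.
  have := leverage_close i; rewrite -/u' -/h ler_norml => /andP[_]; have := ha; lra.
pose g := \sum_(j in J) dot (x j) u' *: x j.
have Wu' : M *m u' + g = (1 - h) *: x i.
  have e1 : W *m u' = x i by rewrite mulKVmx//; apply: posdefmx_unit; exact: gram_all_posdef.
  have -> : g = (\sum_(j in J) x j *m (x j)^T) *m u'.
    by rewrite mulmx_suml; apply: eq_bigr => j _; rewrite rank1_mul.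
  rewrite scalerBl scale1r -[X in X - _]e1 /W (gram_outD (i |: J)%SET) -/M.
  rewrite mulmxDl big_setU1//= mulmxDl rank1_mul -/h.
  by rewrite [X in _ = _ + X - _]addrC addrA addrK.
pose q := (1 - h) *: u - u'.
have Mq : M *m q = g.
  by rewrite mulmxBr -scalemxAr Mu -Wu' addrAC subrr add0r.
have q1 : kap * n%:R * dot q q <= \sum_(j in J) dot (x j) u' * dot (x j) q.
  apply: (le_trans (low ciJ q)).
  under eq_bigr do rewrite expr2.
  rewrite -dot_gram_out -/M Mq /g dot_sumr; apply: ler_sum => j _.
  by rewrite dotZr (dotC q).
have q2 : (kap * n%:R * dot q q) ^+ 2 <= B * (K * n%:R * dot q q).
  apply: (@le_trans _ _ ((\sum_(j in J) dot (x j) u' * dot (x j) q) ^+ 2)).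
    rewrite lerXn2r ?nnegrE//; last by apply: le_trans q1; rewrite mulr_ge0 ?dot_ge0// ltW.
    by rewrite mulr_ge0 ?dot_ge0// ltW.
  by apply: (le_trans (sum_CS _ _ _)); rewrite ler_wpM2l// sub_up.
have q3 : K * n%:R * dot q q <= K ^+ 2 / kap ^+ 2 * B.
  have [->|qn0] := eqVneq q 0.
    by rewrite dot0r mulr0 mulr_ge0// divr_ge0 ?sqr_ge0.
  have qq := dot_gt0 qn0.
  have q2' : kap ^+ 2 * n%:R * dot q q <= B * K.
    rewrite -(ler_pM2l (mulr_gt0 nR0 qq)).
    by move: q2; congr (_ <= _); ring.
  rewrite [leRHS]mulrAC ler_pdivlMr ?exprn_gt0//.
  have := ler_wpM2l (ltW K0) q2'; congr (_ <= _); ring.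
have xx : 2^-1 * p%:R <= dot (x i) (x i).
  have := hnorm i; rewrite ler_norml => /andP[h1 _].
  have : eps * p%:R <= 1 / 2 * p%:R by rewrite ler_wpM2r.
  lra.
have uu : 2^-1 * p%:R <= (K * n%:R) ^+ 2 * dot u u.
  by apply: (le_trans xx); rewrite -{1 2}Mu; exact: mul_up.
have ub : t * n%:R * dot u u <= \sum_(j in J) dot (x j) u ^+ 2 by exact: spread0.
have uB : a ^+ 2 * \sum_(j in J) dot (x j) u ^+ 2 <= 2 * (1 + K ^+ 2 / kap ^+ 2) * B.
  apply: (@le_trans _ _ (2 * B + 2 * \sum_(j in J) dot (x j) q ^+ 2)).
    rewrite /B !mulr_sumr -big_split /=; apply: ler_sum => j _.
    apply: (@le_trans _ _ (((1 - h) * dot (x j) u) ^+ 2)).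
      rewrite exprMn ler_wpM2r ?sqr_ge0// lerXn2r ?nnegrE// ltW//.
      exact: lt_le_trans ah.
    have -> : (1 - h) * dot (x j) u = dot (x j) u' + dot (x j) q.
      by rewrite -dotDr /q subrKC dotZr.
    have : 0 <= (dot (x j) u' - dot (x j) q) ^+ 2 by exact: sqr_ge0.
    nra.
  have := le_trans (sub_up (mem J) q) q3; lra.
rewrite /c0 ler_pdivrMr//.
have pb : b * n%:R <= p%:R by rewrite -ler_pdivlMr.
have s1 : 2^-1 * b <= K ^+ 2 * n%:R * dot u u.
  rewrite -(ler_pM2r nR0).
  apply: (@le_trans _ _ (2^-1 * p%:R)); first by rewrite -mulrA ler_pM2l.
  by apply: (le_trans uu); rewrite le_eqVlt; apply/orP; left; apply/eqP; ring.
have s2 : a ^+ 2 * (t * n%:R * dot u u) <= 2 * (1 + K ^+ 2 / kap ^+ 2) * B.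
  by apply: le_trans uB; rewrite ler_pM2l// exprn_gt0.
have s3 : a ^+ 2 * t * (2^-1 * b) <= a ^+ 2 * t * (K ^+ 2 * n%:R * dot u u).
  by rewrite ler_wpM2l// mulr_ge0 ?sqr_ge0// ltW.
have s4 := ler_wpM2l (sqr_ge0 K) s2.
have e1 : a ^+ 2 * t * b = 2 * (a ^+ 2 * t * (2^-1 * b)) by field.
have e2 : B * (4 * K ^+ 2 * (1 + K ^+ 2 / kap ^+ 2)) =
   2 * (K ^+ 2 * (2 * (1 + K ^+ 2 / kap ^+ 2) * B)) by ring.
rewrite e1 e2 ler_pM2l//; apply: (le_trans s3); apply: le_trans s4.
by rewrite le_eqVlt; apply/orP; left; apply/eqP; ring.
Qed.

(** Any large set contains a subset of the size for which the rows are known to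
   be spread out. *)
Lemma leverage_spread_half i (J : {set 'I_n}) : i \notin J -> (n <= 2 * #|J|)%N ->
  c0 <= \sum_(j in J) dot (x j) (invmx W *m x i) ^+ 2.
Proof.
move=> iJ cJ.
have kJ : (k <= #|J|)%N by rewrite -(leq_pmul2l (isT : 0 < 2)%N) (leq_trans nk).
have [J' /andP[J'J /eqP cJ']] : exists J' : {set 'I_n}, (J' \subset J) && (#|J'| == k).
  have /card_geqP [s [us cs sJ]] := kJ.
  exists [set:: s]%SET; apply/andP; split.
    by apply/fintype.subsetP => j; rewrite inE => /sJ.
  by rewrite cardsE (card_uniqP us) cs.
have iJ' : i \notin J' by apply: contra iJ; exact: (fintype.subsetP J'J).
apply: (le_trans (leverage_spread iJ' cJ')).
rewrite [leRHS](big_setID J') /= (finset.setIidPr J'J) lerDl.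
by apply: sumr_ge0 => j _; exact: sqr_ge0.
Qed.

Theorem tyler_close_of_events : 4 * e < c0 ->
  opnorm (p%:R *: tyler x - sample_cov x) <= 2 * K * (4 * e / c0 + eps).
Proof.
move=> ec0.
have e0 : 0 <= e by rewrite /e addr_ge0 ?mulr_ge0// invr_ge0 ltW.
have c00 : 0 < c0 by rewrite divr_gt0// mulr_gt0// mulr_gt0// exprn_gt0.
exact: (tyler_close n0 p0 gram_all_posdef c00 leverage_spread_half e0 ec0
  leverage_close eps0 eps1 (ltW K0) up hnorm).
Qed.

End Events.

(** * Measurability of the matrix functionals *)

Section MeasurableMatrices.
Context (R : realType) (d : measure_display) (T : measurableType d).

Definition mvec p (f : T -> 'cV[R]_p) :=
  forall j, measurable_fun setT (fun t => f t j ord0).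

Definition mmx p q (F : T -> 'M[R]_(p, q)) :=
  forall j k, measurable_fun setT (fun t => F t j k).

(** Written with [ln] and [expR], the inverse is a composite of measurable functions;
   the formula also holds at [0], where both sides vanish. *)
Lemma measurable_invr (f : T -> R) : measurable_fun setT f ->
  measurable_fun setT (fun t => (f t)^-1).
Proof.
move=> mf.
have -> : (fun t => (f t)^-1) = (fun t => f t * expR (- ln (f t ^+ 2))).
  apply/funext => t; have [->|ft] := eqVneq (f t) 0; first by rewrite invr0 mul0r.
  rewrite expRN lnK; first by field.
  by rewrite posrE exprn_even_gt0.
apply: measurable_funM => //; apply: measurableT_comp; first exact: measurable_expR.
apply: measurable_funN; apply: measurableT_comp; first exact: measurable_ln.
exact: measurable_funX.
Qed.

Lemma measurable_prod_set (I : finType) (J : {set I}) (h : I -> T -> R) :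
  (forall j, measurable_fun setT (h j)) ->
  measurable_fun setT (fun t => \prod_(j in J) h j t).
Proof.
move=> mh; under eq_fun do rewrite big_mkcond.
by apply: measurable_prod => j _; case: (j \in J).
Qed.

Lemma mvec_dot p (f g : T -> 'cV[R]_p) : mvec f -> mvec g ->
  measurable_fun setT (fun t => dot (f t) (g t)).
Proof.
move=> mf mg; rewrite (_ : (fun t => _) = (fun t => \sum_j f t j ord0 * g t j ord0)).
  by apply: measurable_sum => j; apply: measurable_funM; [exact: mf|exact: mg].
by apply/funext => t; rewrite dotE.
Qed.

Lemma mvec_mul p q (F : T -> 'M[R]_(p, q)) (g : T -> 'cV[R]_q) : mmx F -> mvec g ->
  mvec (fun t => F t *m g t).
Proof.
move=> mF mg j; rewrite (_ : (fun t => _) = (fun t => \sum_k F t j k * g t k ord0)).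
  by apply: measurable_sum => k; apply: measurable_funM; [exact: mF|exact: mg].
by apply/funext => t; rewrite mxE.
Qed.

Lemma mmx_tr p (F : T -> 'M[R]_p) : mmx F -> measurable_fun setT (fun t => \tr (F t)).
Proof. by move=> mF; apply: measurable_sum => j; exact: mF. Qed.

Lemma mmx_det p (F : T -> 'M[R]_p) : mmx F -> measurable_fun setT (fun t => \det (F t)).
Proof.
move=> mF; apply: measurable_sum => s; apply: measurable_funM => //.
by apply: measurable_prod => j _; exact: mF.
Qed.

(** Agrees with the inverse on invertible matrices, and is visibly a measurable
   function of the entries on all matrices. *)
Definition adj_inv p (M : 'M[R]_p) : 'M[R]_p := (\det M)^-1 *: \adj M.

Lemma adj_invE p (M : 'M[R]_p) : M \in unitmx -> adj_inv M = invmx M.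
Proof. by rewrite /adj_inv /invmx => ->. Qed.

Lemma mmx_adj_inv p (F : T -> 'M[R]_p) : mmx F -> mmx (fun t => adj_inv (F t)).
Proof.
move=> mF j k.
rewrite (_ : (fun t => _) = (fun t => (\det (F t))^-1 * cofactor (F t) k j)).
  apply: measurable_funM; first by apply: measurable_invr; exact: mmx_det.
  apply: measurable_funM => //; apply: mmx_det => l m.
  rewrite (_ : (fun t => _) = (fun t => F t (lift k l) (lift j m))); first exact: mF.
  by apply/funext => t; rewrite !mxE.
by apply/funext => t; rewrite mxE [X in _ * X]mxE.
Qed.

Lemma mmx_gram n p (x : T -> 'I_n -> 'cV[R]_p) (w : 'I_n -> R) :
  (forall i, mvec (x ^~ i)) -> mmx (fun t => gram (x t) w).
Proof.
move=> mx j k.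
rewrite (_ : (fun t => _) = (fun t => \sum_i w i * (x t i j ord0 * x t i k ord0))).
  apply: measurable_sum => i; apply: measurable_funM => //.
  by apply: measurable_funM; exact: mx.
apply/funext => t; rewrite /gram summxE; apply: eq_bigr => i _.
by rewrite mxE; congr (_ * _); rewrite mxE big_ord_recl big_ord0 addr0 mxE.
Qed.

Lemma measurable_set_of_bool (f : T -> bool) : measurable_fun setT f ->
  measurable [set t | f t].
Proof.
move=> mf; have := mf measurableT [set true] I.
by rewrite setTI; congr measurable; apply/seteqP; split.
Qed.

End MeasurableMatrices.

(** * Sets covered by a small measurable set *)

Section Small.
Context (R : realType) (d : measure_display) (T : measurableType d).
Variable mu : probability T R.

(** The events of interest involve the estimator, whose measurability is not known,
   so their size is measured by that of a measurable cover. *)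
Definition outer_le (A : set T) (c : R) :=
  exists2 B, measurable B & A `<=` B /\ (mu B <= c%:E)%E.

Lemma outer_le_sub A B c c' : A `<=` B -> c <= c' -> outer_le B c -> outer_le A c'.
Proof.
move=> AB cc' [C mC [BC muC]]; exists C => //; split; first exact: subset_trans BC.
by apply: (le_trans muC); rewrite lee_fin.
Qed.

Lemma outer_leU A B a b : outer_le A a -> outer_le B b -> outer_le (A `|` B) (a + b).
Proof.
move=> [C mC [AC muC]] [D mD [BD muD]]; exists (C `|` D); first exact: measurableU.
split; first exact: setUSS.
by apply: (le_trans (measureU2 _ mC mD)); rewrite EFinD leeD.
Qed.

Lemma outer_le_seq (I : eqType) (s : seq I) (A : I -> set T) (c : R) :
  (forall i, i \in s -> outer_le (A i) c) ->
  outer_le [set t | exists2 i, i \in s & A i t] ((size s)%:R * c).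
Proof.
elim: s => [|i s IH] h.
  rewrite mul0r; exists set0 => //; rewrite measure0; split=> //.
  by move=> t [i]; rewrite in_nil.
rewrite [size _]/= -natr1 addrC mulrDl mul1r.
have hi : outer_le (A i) c by apply: h; rewrite inE eqxx.
have hs : forall j, j \in s -> outer_le (A j) c.
  by move=> j js; apply: h; rewrite inE js orbT.
apply: outer_le_sub (outer_leU hi (IH hs)) => //.
move=> t [j]; rewrite inE => /orP[/eqP -> Ai|js Aj]; [by left|right].
by exists j.
Qed.

Lemma outer_le_fin (I : finType) (A : I -> set T) (c : R) :
  (forall i, outer_le (A i) c) -> outer_le [set t | exists i, A i t] (#|I|%:R * c).
Proof.
move=> h; have := @outer_le_seq I (enum I) A c (fun i _ => h i).
rewrite -cardE; apply: outer_le_sub => // t [i Ai].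
by exists i => //; rewrite mem_enum.
Qed.

Lemma markov_le (f : T -> bool) (F : T -> R) (c : R) : measurable_fun setT f ->
  measurable_fun setT F -> (forall t, 0 <= F t) -> (forall t, f t -> 1 <= F t) ->
  (\int[mu]_t (F t)%:E <= c%:E)%E -> outer_le [set t | f t] c.
Proof.
move=> mf mF F0 F1 Fc; have mA := measurable_set_of_bool mf.
exists [set t | f t] => //; split=> //; apply: le_trans Fc.
rewrite -[X in mu X]setIT -integral_indic//; apply: ge0_le_integral => //.
- by apply/measurable_EFinP; exact: measurable_indic.
- exact/measurable_EFinP.
- move=> t _; rewrite lee_fin indicE; have [/set_mem ft|_] := boolP (t \in _); last exact: F0.
  exact: F1.
Qed.

End Small.

(** * Chernoff bounds for dependent factors *)

Section Chain.
Local Open Scope ereal_scope.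
Context (R : realType) (d : measure_display) (U : measurableType d) (m : nat).
Let V : measurableType _ := (m.-tuple U)%type.
Variables (mu : probability V R) (nu : 'I_m -> probability U R).
Hypothesis muE : box_product mu nu.

(** A product over [j in J] whose factors depend on the [j]-th coordinate and on
   the coordinates outside [J] is integrated one coordinate at a time. *)
Lemma resample_chain (J : {set 'I_m}) (h : V -> U -> R) (c : R) : (0 <= c)%R ->
  (forall t u, 0 <= h t u)%R ->
  (forall j, measurable_fun setT (fun t : V => h t (tnth t j))) ->
  (forall j, j \in J -> forall t u, h (upd t j u) = h t) ->
  (forall j, j \in J -> forall t, \int[nu j]_u (h t u)%:E <= c%:E) ->
  \int[mu]_t (\prod_(j in J) h t (tnth t j))%:E <= (c ^+ #|J|)%:E.
Proof.
move=> c0 h0 mh hJ hc.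
suff H (n : nat) : forall K : {set 'I_m}, K \subset J -> #|K| = n ->
    \int[mu]_t (\prod_(j in K) h t (tnth t j))%:E <= (c ^+ n)%:E.
  exact: H.
have mprod (K : {set 'I_m}) : measurable_fun setT
    (fun t : V => (\prod_(j in K) h t (tnth t j))%R).
  exact: measurable_prod_set.
elim: n => [|n IH] K KJ cK.
  rewrite (cards0_eq cK); under eq_integral do rewrite big_set0.
  by rewrite integral_cst//= probability_setT mule1.
have [i iK] : exists i, i \in K by apply/set0Pn; rewrite -card_gt0 cK.
have iJ : i \in J by exact: (fintype.subsetP KJ).
pose K' := (K :\ i)%SET.
have cK' : #|K'| = n by move: cK; rewrite (cardsD1 i) iK => -[].
have KJ' : K' \subset J by apply: fintype.subset_trans KJ; exact: subD1set.
apply: le_trans (_ : \int[mu]_t (c%:E * (\prod_(j in K') h t (tnth t j))%:E) <= _).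
  apply: (resample_le muE (i := i)).
  - by move=> t; rewrite lee_fin; apply: prodr_ge0 => j _; exact: h0.
  - by apply/measurable_EFinP; exact: mprod.
  - by apply: measurable_funeM; apply/measurable_EFinP; exact: mprod.
  - move=> t.
    under eq_integral => u _.
      rewrite (big_setD1 i)//= tnth_upd eqxx hJ//.
      under eq_bigr => j.
        rewrite !inE => /andP[ji _].
        rewrite tnth_upd (negbTE ji).
      over.
      rewrite mulrC EFinM.
    over.
    have P0 : (0 <= \prod_(j in K') h t (tnth t j))%R.
      by apply: prodr_ge0 => j _; exact: h0.
    have mht : measurable_fun setT (h t).
      have -> : h t = (fun s : V => h s (tnth s i)) \o (upd t i).
        by apply/funext => u /=; rewrite hJ// tnth_upd eqxx.
      apply: measurableT_comp; first exact: mh.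
      apply/measurable_fun_tnthP => j; have [ji|ji] := eqVneq j i.
        rewrite (_ : _ \o _ = id); first exact: measurable_id.
        by apply/funext => u /=; rewrite tnth_upd ji eqxx.
      rewrite (_ : _ \o _ = cst (tnth t j)); first exact: measurable_cst.
      by apply/funext => u /=; rewrite tnth_upd (negbTE ji).
    rewrite ge0_integralZl//; last 2 first.
    - exact/measurable_EFinP.
    - by move=> u _; rewrite lee_fin.
    by rewrite muleC; apply: lee_wpmul2r; [rewrite lee_fin|exact: hc].
rewrite ge0_integralZl//; last 2 first.
- by apply/measurable_EFinP; exact: mprod.
- by move=> t _; rewrite lee_fin; apply: prodr_ge0 => j _; exact: h0.
by rewrite exprS EFinM; apply: lee_wpmul2l; [rewrite lee_fin|exact: IH].
Qed.

(** Markov's inequality for the product of [resample_chain]: an exponential bound for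
   a sum over [J] in which each summand may be coupled to the samples outside [J]. *)
Lemma chain_tail (J : {set 'I_m}) (h : V -> U -> R) (c q : R) (f : V -> bool) :
  (0 <= c)%R -> (0 <= q)%R -> (forall t u, 0 <= h t u)%R ->
  (forall j, measurable_fun setT (fun t : V => h t (tnth t j))) ->
  (forall j, j \in J -> forall t u, h (upd t j u) = h t) ->
  (forall j, j \in J -> forall t, \int[nu j]_u (h t u)%:E <= c%:E) ->
  measurable_fun setT f ->
  (forall t, f t -> (1 <= q * \prod_(j in J) h t (tnth t j))%R) ->
  outer_le mu [set t | f t] (q * c ^+ #|J|).
Proof.
move=> c0 q0 h0 mh hJ hc mf fq.
have mp : measurable_fun setT (fun t : V => (\prod_(j in J) h t (tnth t j))%R).
  exact: measurable_prod_set.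
have p0 t : (0 <= \prod_(j in J) h t (tnth t j))%R by apply: prodr_ge0 => j _; exact: h0.
apply: (@markov_le _ _ _ mu _ (fun t => q * \prod_(j in J) h t (tnth t j))%R) => //.
- exact: measurable_funM.
- by move=> t; rewrite mulr_ge0.
under eq_integral do rewrite EFinM.
rewrite ge0_integralZl//; last 2 first.
- exact/measurable_EFinP.
- by move=> t _; rewrite lee_fin.
by rewrite EFinM; apply: lee_wpmul2l; [rewrite lee_fin|exact: resample_chain].
Qed.

End Chain.

(** * Tail bounds for Gaussian samples *)

Section InverseBounds.
Variables (R : realType) (p : nat) (G : 'M[R]_p) (g : R).
Hypotheses (symG : G^T = G) (g0 : 0 < g).
Hypothesis lowG : forall v, g * dot v v <= dot v (G *m v).

Lemma lower_unit : G \in unitmx.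
Proof.
apply: posdefmx_unit; split=> // v v0; rewrite -mulmxA -/(dot _ _).
by apply: lt_le_trans (lowG v); rewrite mulr_gt0// dot_gt0.
Qed.

Implicit Types v : 'cV[R]_p.
Let M : 'M[R]_p := invmx G.

Lemma inv_sym : M^T = M.
Proof. by rewrite trmx_inv symG. Qed.

Let GM v : G *m (M *m v) = v.
Proof. by rewrite mulKVmx// lower_unit. Qed.

Let q0 v : g * dot (M *m v) (M *m v) <= quad M v.
Proof. by rewrite /quad -{3}(GM v) dotC; exact: lowG. Qed.

Lemma inv_quad_ge0 v : 0 <= quad M v.
Proof. by apply: le_trans (q0 v); rewrite mulr_ge0 ?dot_ge0// ltW. Qed.

(** Cauchy--Schwarz for [quad M v = <v, M v>] against the bound on [<M v, M v>]. *)
Lemma inv_quad_le v : quad M v <= g^-1 * dot v v.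
Proof.
have [q00|q00] := eqVneq (quad M v) 0.
  by rewrite q00 mulr_ge0 ?dot_ge0// invr_ge0 ltW.
have qp : 0 < quad M v by rewrite lt_neqAle eq_sym q00 inv_quad_ge0.
rewrite -(ler_pM2l qp) -expr2; apply: (le_trans (dot_CS _ _)).
rewrite mulrCA mulrA [leRHS]mulrC; apply: ler_wpM2l; first exact: dot_ge0.
by rewrite mulrC ler_pdivlMr// mulrC.
Qed.

Lemma inv_mul_le v : dot (M *m v) (M *m v) <= g^-1 ^+ 2 * dot v v.
Proof.
have h : dot (M *m v) (M *m v) <= g^-1 * quad M v.
  by rewrite mulrC ler_pdivlMr// mulrC.
apply: (le_trans h); rewrite expr2 -mulrA ler_wpM2l ?inv_quad_le//.
by rewrite invr_ge0 ltW.
Qed.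

(** The trace is the sum of the squared norms of the columns of [M]. *)
Lemma inv_frob : \tr (M *m M) <= p%:R / g ^+ 2.
Proof.
have -> : \tr (M *m M) = \sum_k dot (M *m delta_mx k ord0) (M *m delta_mx k ord0).
  apply: eq_bigr => k _; rewrite mxE dotE; apply: eq_bigr => l _.
  have E m : (M *m (delta_mx k ord0 : 'cV[R]_p)) m ord0 = M m k.
    rewrite mxE (bigD1 k)//= big1 => [|j jk]; rewrite mxE ?eqxx ?mulr1 ?addr0//.
    by rewrite (negbTE jk) mulr0.
  by rewrite E -{1}inv_sym mxE.
apply: (@le_trans _ _ (\sum_(k < p) g^-1 ^+ 2)).
  apply: ler_sum => k _; apply: (le_trans (inv_mul_le _)).
  rewrite dotE (bigD1 k)//= big1 => [|j jk]; first by rewrite mxE !eqxx !mulr1 addr0 mulr1.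
  by rewrite mxE (negbTE jk) mul0r.
by rewrite sumr_const card_ord -[leLHS]mulr_natl exprVn.
Qed.

End InverseBounds.

Section Tails.
Variables (R : realType) (n p : nat).
Let W : measurableType _ := (p.-tuple R)%type.
Let V : measurableType _ := (n.-tuple W)%type.
Variables (mu : probability V R) (nu : 'I_n -> probability W R).
Hypothesis muE : box_product mu nu.
Hypothesis nuE : forall i, box_product (nu i) (fun=> std_normal R).

Definition samples (t : n.-tuple (p.-tuple R)) (i : 'I_n) : 'cV[R]_p :=
  col_of_tuple (tnth t i).

Lemma mvec_samples i : mvec (fun t : V => samples t i).
Proof.
move=> j; rewrite (_ : (fun t => _) = (fun z : W => col_of_tuple z j ord0) \o
  (fun t : V => tnth t i)); last by [].
by apply: measurableT_comp; [exact: measurable_coord|exact: measurable_tnth].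
Qed.

Lemma mvec_cst (d : measure_display) (T : measurableType d) q (u : 'cV[R]_q) :
  mvec (fun _ : T => u).
Proof. by move=> j; exact: measurable_cst. Qed.

Lemma samples_upd (t : V) i z j :
  samples (upd t i z) j = if j == i then col_of_tuple z else samples t j.
Proof. by rewrite /samples tnth_upd; case: ifP. Qed.

Lemma rank1_quad (u v : 'cV[R]_p) (c : R) : quad (c *: (u *m u^T)) v = c * dot u v ^+ 2.
Proof. by rewrite /quad -scalemxAl dotZr rank1_mul dotZr (dotC v) expr2. Qed.

Lemma rank1_sym (u : 'cV[R]_p) (c : R) : (c *: (u *m u^T))^T = c *: (u *m u^T).
Proof. by rewrite linearZ /= trmx_mul trmxK. Qed.

(** Chernoff's bound with the exponent [1 / 16], for which [gauss_quad_mgf] applies to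
   the rank one matrix [8^-1 *: (u *m u^T)]. *)
Lemma upper_tail (u : 'cV[R]_p) (A : R) : dot u u <= 1 ->
  outer_le mu [set t : V | A * n%:R < \sum_j dot (samples t j) u ^+ 2]
    (expR (8^-1 - A / 16) ^+ n).
Proof.
move=> u1.
pose h (t : V) (z : W) : R := expR (16^-1 * dot (col_of_tuple z) u ^+ 2).
have mS j : measurable_fun setT (fun t : V => dot (samples t j) u).
  by apply: mvec_dot; [exact: mvec_samples|exact: mvec_cst].
have mh j : measurable_fun setT (fun t : V => h t (tnth t j)).
  rewrite /h; apply: measurableT_comp; first exact: measurable_expR.
  by apply: measurable_funM => //; apply: measurable_funX; exact: mS.
have -> : expR (8^-1 - A / 16) ^+ n = expR (- (A * n%:R / 16)) * expR 8^-1 ^+ #|[set: 'I_n]%SET|.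
  by rewrite cardsT card_ord -!expRM_natl -expRD; congr expR; field.
apply: (chain_tail muE (h := h)) => //; rewrite ?expR_ge0//.
- by move=> t z; exact: expR_ge0.
- move=> j _ t.
  have := @gauss_quad_mgf _ _ (nu j) (nuE j) (8^-1 *: (u *m u^T)) (rank1_sym _ _).
  have hb v : `|quad (8^-1 *: (u *m u^T)) v| <= 8^-1 * dot v v.
    rewrite rank1_quad ger0_norm; last by rewrite mulr_ge0// sqr_ge0.
    rewrite ler_wpM2l//.
    by apply: (le_trans (dot_CS _ _)); rewrite ler_piMl ?dot_ge0.
  move=> /(_ hb); under eq_integral do rewrite rank1_quad.
  move=> H; apply: (@le_trans _ _ (\int[nu j]_z (expR (2^-1 * (8^-1 * dot u (col_of_tuple z) ^+ 2)))%:E)%E).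
    rewrite le_eqVlt; apply/orP; left; apply/eqP; apply: eq_integral => z _.
    by rewrite /h (dotC u); congr (expR _)%:E; field.
  apply: (le_trans H); rewrite lee_fin ler_expR.
  have -> : \tr (8^-1 *: (u *m u^T)) = 8^-1 * dot u u by rewrite linearZ /= tr_rank1.
  have -> : \tr (8^-1 *: (u *m u^T) *m (8^-1 *: (u *m u^T))) = 8^-1 ^+ 2 * dot u u ^+ 2.
    rewrite -scalemxAl -scalemxAr scalerA -expr2 linearZ /= mulmxA rank1_mul -scalemxAl.
    by rewrite linearZ /= tr_rank1 expr2.
  have := dot_ge0 u; nra.
- apply: measurable_fun_ltr => //; apply: measurable_sum => j.
  by apply: measurable_funX; exact: mS.
- move=> t lt; rewrite (eq_bigl xpredT); last by move=> j; rewrite inE.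
  rewrite -expR_sum -expRD -[leLHS]expR0 ler_expR -mulr_sumr.
  have : 0 <= 16^-1 * (\sum_j dot (samples t j) u ^+ 2 - A * n%:R).
    by rewrite mulr_ge0// subr_ge0 ltW.
  lra.
Qed.

(** The factor [expR (c / 2 * b)] is the price of Chernoff's bound, and each sample
   contributes the Laplace transform of the square of a centred Gaussian of variance
   at least [1 / 4].  For a small threshold [b] the parameter [c] can be taken so
   large that the bound beats any given exponential in the number of samples. *)
Lemma lower_tail (u : 'cV[R]_p) (J : {set 'I_n}) (b c : R) : 0 <= c -> 4^-1 <= dot u u ->
  outer_le mu [set t : V | \sum_(j in J) dot (samples t j) u ^+ 2 < b]
    (expR (2^-1 * c * b) * (Num.sqrt (1 + c / 4))^-1 ^+ #|J|).
Proof.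
move=> c0 u4.
pose h (t : V) (z : W) : R := expR (- (2^-1 * c * dot u (col_of_tuple z) ^+ 2)).
have mS j : measurable_fun setT (fun t : V => dot u (samples t j)).
  by apply: mvec_dot; [exact: mvec_cst|exact: mvec_samples].
have mh j : measurable_fun setT (fun t : V => h t (tnth t j)).
  rewrite /h; apply: measurableT_comp; first exact: measurable_expR.
  apply: measurable_funN; apply: measurable_funM => //; apply: measurable_funX; exact: mS.
apply: (chain_tail muE (h := h)) => //; rewrite ?expR_ge0//.
- by move=> t z; exact: expR_ge0.
- move=> j _ t; rewrite /h (gauss_rank1 (nuE j) u c0) lee_fin.
  have d0 : 0 < 1 + c / 4 by rewrite ltr_pwDl// divr_ge0.
  have cu : c / 4 <= c * dot u u by rewrite ler_wpM2l.
  rewrite lef_pV2 ?posrE ?sqrtr_gt0//; last by lra.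
  by apply: ler_wsqrtr; rewrite lerD2l.
- apply: measurable_fun_ltr => //.
  rewrite (_ : (fun t => _) = (fun t : V => \sum_j (if j \in J then dot u (samples t j) ^+ 2 else 0))).
    apply: measurable_sum => j; case: (j \in J) => //.
    by apply: measurable_funX; exact: mS.
  by apply/funext => t; rewrite big_mkcond; apply: eq_bigr => j _; rewrite (dotC u).
- move=> t lt; rewrite -expR_sum -expRD -[leLHS]expR0 ler_expR sumrN -mulr_sumr.
  under eq_bigr do rewrite dotC.
  have : 0 <= 2^-1 * c * (b - \sum_(j in J) dot (samples t j) u ^+ 2).
    by rewrite mulr_ge0// ?mulr_ge0// subr_ge0 ltW.
  lra.
Qed.

Lemma gram_out_upd (J : {set 'I_n}) (t : V) j z : j \in J ->
  gram_out (samples (upd t j z)) J = gram_out (samples t) J.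
Proof.
move=> jJ; apply: eq_bigr => l _; rewrite samples_upd.
by case: eqVneq => // ->; rewrite jJ !scale0r.
Qed.

Lemma mmx_gram_out (J : {set 'I_n}) : mmx (fun t : V => gram_out (samples t) J).
Proof. by apply: mmx_gram => i; exact: mvec_samples. Qed.

(** The direction [u t] is random but does not depend on the samples in [J], so given
   the others it is fixed; normalising it within [h] makes the bound uniform. *)
Lemma spread_tail (i : 'I_n) (J : {set 'I_n}) (b c : R) : 0 <= c -> i \notin J ->
  let u (t : V) := adj_inv (gram_out (samples t) (i |: J)%SET) *m samples t i in
  outer_le mu
    [set t : V | \sum_(j in J) dot (samples t j) (u t) ^+ 2 < b * dot (u t) (u t)]
    (expR (2^-1 * c * b) * (Num.sqrt (1 + c))^-1 ^+ #|J|).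
Proof.
move=> c0 iJ u.
have mu_ : mvec u.
  apply: mvec_mul; last exact: mvec_samples.
  by apply: mmx_adj_inv; exact: mmx_gram_out.
have uJ j t z : j \in J -> u (upd t j z) = u t.
  move=> jJ; rewrite /u gram_out_upd; last by rewrite !inE jJ orbT.
  rewrite samples_upd; case: eqVneq => // ij.
  by move: iJ; rewrite ij jJ.
pose h (t : V) (z : W) : R := if 0 < dot (u t) (u t) then
  expR (- (2^-1 * (c / dot (u t) (u t)) * dot (u t) (col_of_tuple z) ^+ 2)) else 0.
have mS j : measurable_fun setT (fun t : V => dot (u t) (samples t j)).
  by apply: mvec_dot; [exact: mu_|exact: mvec_samples].
have muu : measurable_fun setT (fun t => dot (u t) (u t)) by exact: mvec_dot.
have mh j : measurable_fun setT (fun t : V => h t (tnth t j)).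
  rewrite /h; apply: measurable_fun_ifT => //; first exact: measurable_fun_ltr.
  apply: measurableT_comp; first exact: measurable_expR.
  apply: measurable_funN; apply: measurable_funM => //; last by apply: measurable_funX; exact: mS.
  apply: measurable_funM => //; apply: measurable_funM => //; exact: measurable_invr.
have h0 t z : 0 <= h t z by rewrite /h; case: ifP => // _; exact: expR_ge0.
apply: (chain_tail muE _ _ h0 mh); [by rewrite invr_ge0 sqrtr_ge0|exact: expR_ge0| | | |].
- by move=> j jJ t z; rewrite /h uJ.
- move=> j _ t; have [uu|uu] := ltrP 0 (dot (u t) (u t)); last first.
    by rewrite /h ltNge uu /= integral0 lee_fin invr_ge0 sqrtr_ge0.
  rewrite /h uu (gauss_rank1 (nuE j) (u t)); last by rewrite divr_ge0// ltW.
  by rewrite divfK// gt_eqF.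
- apply: measurable_fun_ltr => //; last exact: measurable_funM.
  rewrite (_ : (fun t => _) = (fun t : V => \sum_j (if j \in J then dot (u t) (samples t j) ^+ 2 else 0))).
    apply: measurable_sum => j; case: (j \in J) => //.
    by apply: measurable_funX; exact: mS.
  by apply/funext => t; rewrite big_mkcond; apply: eq_bigr => j _; rewrite (dotC (u t)).
- move=> t lt.
  have uu : 0 < dot (u t) (u t).
    rewrite lt_neqAle dot_ge0 andbT; apply: contraTneq lt => /esym uu.
    rewrite uu mulr0 -leNgt; apply: sumr_ge0 => j _; exact: sqr_ge0.
  rewrite /h uu -expR_sum -expRD -[leLHS]expR0 ler_expR sumrN -mulr_sumr.
  under eq_bigr do rewrite dotC.
  set S := \sum_(j in J) _ in lt *.
  have -> : 2^-1 * c * b - 2^-1 * (c / dot (u t) (u t)) * S =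
      2^-1 * c * (b * dot (u t) (u t) - S) / dot (u t) (u t).
    by field; rewrite gt_eqF.
  by rewrite divr_ge0 ?mulr_ge0 ?dot_ge0// subr_ge0 ltW.
Qed.

(** Chernoff's bound on both sides, given the samples other than [i].  They determine
   the matrix [F t] and the event [good] on which it is controlled, so the factor
   integrated over the sample [i] can be cut off outside [good]. *)
Lemma quad_tail (i : 'I_n) (F : V -> 'M[R]_p) (good : V -> bool) (L B s r : R) :
  mmx F -> measurable_fun setT good ->
  (forall t z, F (upd t i z) = F t) -> (forall t z, good (upd t i z) = good t) ->
  (forall t, good t -> [/\ (F t)^T = F t,
     (forall v, `|quad (F t) v| <= L * dot v v) & \tr (F t *m F t) <= B]) ->
  0 <= s -> 2 * s * L <= 8^-1 ->
  outer_le mu [set t : V | good t && (r < `|quad (F t) (samples t i) - \tr (F t)|)]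
    (2 * expR (4 * s ^+ 2 * B - s * r)).
Proof.
move=> mF mgood Fi goodi Fgood s0 sL.
have mq : measurable_fun setT (fun t : V => quad (F t) (samples t i) - \tr (F t)).
  apply: measurable_funB; last exact: mmx_tr.
  by apply: mvec_dot; [exact: mvec_samples|apply: mvec_mul => //; exact: mvec_samples].
have one_side (sg : R) : sg ^+ 2 = 1 -> outer_le mu
    [set t : V | good t && (r < sg * (quad (F t) (samples t i) - \tr (F t)))]
    (expR (4 * s ^+ 2 * B - s * r)).
  move=> sg1.
  pose h (t : V) (z : W) : R := if good t then
    expR (sg * s * (quad (F t) (col_of_tuple z) - \tr (F t))) else 0.
  have h0 t z : 0 <= h t z by rewrite /h; case: ifP => // _; exact: expR_ge0.
  have mh j : measurable_fun setT (fun t : V => h t (tnth t j)).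
    rewrite /h; apply: measurable_fun_ifT => //.
    apply: measurableT_comp; first exact: measurable_expR.
    apply: measurable_funM => //; apply: measurable_funB; last exact: mmx_tr.
    by apply: mvec_dot; [exact: mvec_samples|apply: mvec_mul => //; exact: mvec_samples].
  have -> : expR (4 * s ^+ 2 * B - s * r) =
      expR (- (s * r)) * expR (4 * s ^+ 2 * B) ^+ #|[set i]%SET|.
    by rewrite cards1 expr1 -expRD addrC.
  apply: (chain_tail muE _ _ h0 mh); [exact: expR_ge0|exact: expR_ge0| | | |].
  - by move=> j; rewrite inE => /eqP -> t z; apply/funext => u; rewrite /h Fi goodi.
  - move=> j _ t; case gt: (good t); last first.
      by rewrite /h gt integral0 lee_fin expR_ge0.
    have [symF bF trF] := Fgood t gt.
    pose A := (2 * (sg * s)) *: F t.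
    have sgs : `|sg| = 1.
      have : `|sg| ^+ 2 = 1 by rewrite -normrX sg1 normr1.
      by move=> /eqP; rewrite sqrp_eq1// => /eqP.
    have symA : A^T = A by rewrite linearZ /= symF.
    have qA v : quad A v = 2 * (sg * s) * quad (F t) v.
      by rewrite /quad -scalemxAl dotZr.
    have bA v : `|quad A v| <= 8^-1 * dot v v.
      rewrite qA normrM normrM normrM sgs mul1r (ger0_norm s0) ger0_norm//.
      apply: (@le_trans _ _ (2 * s * (L * dot v v))).
        by apply: ler_wpM2l => //; rewrite mulr_ge0.
      by rewrite mulrA; apply: ler_wpM2r => //; exact: dot_ge0.
    have trA : \tr A = 2 * (sg * s) * \tr (F t) by rewrite linearZ.
    have H := @gauss_quad_mgf _ _ (nu j) (nuE j) A symA bA.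
    apply: (@le_trans _ _ ((expR (- (2^-1 * \tr A)))%:E *
        \int[nu j]_z (expR (2^-1 * quad A (col_of_tuple z)))%:E)%E).
      rewrite -ge0_integralZl//; last exact: measurable_exp_quad.
      rewrite le_eqVlt; apply/orP; left; apply/eqP; apply: eq_integral => z _.
      rewrite /h gt -EFinM -expRD qA trA; congr (expR _)%:E.
      by field.
    apply: le_trans (lee_wpmul2l _ H) _; first by rewrite lee_fin expR_ge0.
    rewrite -EFinM lee_fin -expRD ler_expR addKr.
    have -> : \tr (A *m A) = sg ^+ 2 * (4 * s ^+ 2 * \tr (F t *m F t)).
      rewrite /A -scalemxAl -scalemxAr scalerA linearZ /=; set tr2 := \tr _.
      by field.
    by rewrite sg1 mul1r ler_wpM2l// mulr_ge0// sqr_ge0.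
  - apply: measurable_and => //; apply: measurable_fun_ltr => //.
    exact: measurable_funM.
  - move=> t /andP[gt lt]; rewrite big_set1 /h gt -expRD -[leLHS]expR0 ler_expR.
    rewrite mulrAC -/(samples t i).
    have := ler_wpM2r s0 (ltW lt); lra.
apply: outer_le_sub
  (outer_leU (one_side 1 (expr1n _ _)) (one_side (-1) (sqrr_sign R 1))); last by lra.
move=> t /= /andP[gt]; rewrite ltr_normr => /orP[lt|lt]; [left|right].
  by rewrite gt mul1r.
by rewrite gt mulN1r.
Qed.

Lemma norm_tail (i : 'I_n) (eps : R) : 0 <= eps -> eps <= 1 ->
  outer_le mu [set t : V | eps * p%:R < `|dot (samples t i) (samples t i) - p%:R|]
    (2 * expR (- (32^-1 * eps ^+ 2 * p%:R))).
Proof.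
move=> e0 e1.
have H := @quad_tail i (fun=> 1%:M) xpredT 1 p%:R (eps / 16) (eps * p%:R).
apply: (outer_le_sub _ _ (H _ _ _ _ _ _ _)) => //.
- move=> t /= lt; rewrite mxtrace1 /quad mul1mx; exact: lt.
- rewrite ler_pM2l// ler_expR.
  have : 0 <= eps ^+ 2 * p%:R by rewrite mulr_ge0// sqr_ge0.
  by clear H; lra.
- move=> t _; split; first exact: trmx1.
    by move=> v; rewrite /quad mul1mx mul1r ger0_norm ?dot_ge0.
  by rewrite mulmx1 mxtrace1.
- by rewrite divr_ge0.
- clear H; lra.
Qed.

(** The conditions on a family of vectors that, through nets, bound its Gram form
    from both sides; being finite in number they define a measurable event. *)
Definition net_bounds (N1 N2 : seq 'cV[R]_p) (A b : R) (x : 'I_n -> 'cV[R]_p) : bool :=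
  all (fun u => \sum_j dot (x j) u ^+ 2 <= A) N1 &&
  all (fun u => (4^-1 <= dot u u) ==> (b <= \sum_j dot (x j) u ^+ 2)) N2.

Lemma measurable_all (T : Type) (s : seq T) (f : T -> V -> bool) :
  (forall u, measurable_fun setT (f u)) ->
  measurable_fun setT (fun t => all (f^~ t) s).
Proof.
move=> mf; elim: s => [|u s IH] /=; first exact: measurable_cst.
exact: measurable_and.
Qed.

Lemma measurable_net_bounds N1 N2 A b (x : V -> 'I_n -> 'cV[R]_p) :
  (forall j, mvec (x^~ j)) -> measurable_fun setT (fun t => net_bounds N1 N2 A b (x t)).
Proof.
move=> mx.
have ms u : measurable_fun setT (fun t => \sum_j dot (x t j) u ^+ 2).
  apply: measurable_sum => j; apply: measurable_funX.
  by apply: mvec_dot; [exact: mx|exact: mvec_cst].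
apply: measurable_and; apply: measurable_all => u.
  exact: measurable_fun_ler.
case: (4^-1 <= dot u u) => /=; last exact: measurable_cst.
exact: measurable_fun_ler.
Qed.

Definition omit (x : 'I_n -> 'cV[R]_p) (i j : 'I_n) : 'cV[R]_p :=
  if j == i then 0 else x j.

Lemma sum_omit x i v :
  \sum_j dot (omit x i j) v ^+ 2 = \sum_(j | j \notin [set i]%SET) dot (x j) v ^+ 2.
Proof.
rewrite [RHS]big_mkcond; apply: eq_bigr => j _; rewrite /omit inE.
by case: eqVneq => //= _; rewrite dotC dot0r expr0n.
Qed.

(** The sample [i] is independent of the inverse [M t] of the scatter matrix of the
    others, and [M t] is positive of norm at most [1 / (kap n)] when these satisfy the
    bounds.  The bounds are required of the family with the sample [i] replaced by
    [0], which makes them an event that does not depend on that sample. *)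
Lemma loo_tail (i : 'I_n) (N1 N2 : seq 'cV[R]_p) (K kap dl eps : R) :
  (0 < n)%N -> (p <= n)%N -> 0 < kap -> kap <= 1 -> 0 <= eps -> eps <= 1 -> 0 <= K ->
  0 <= dl -> dl <= 2^-1 ->
  (forall v : 'cV[R]_p, dot v v <= 1 ->
    exists2 u, u \in N1 & dot (v - u) (v - u) <= 2^-1 ^+ 2) ->
  (forall v : 'cV[R]_p, dot v v <= 1 ->
    exists2 u, u \in N2 & dot (v - u) (v - u) <= dl ^+ 2) ->
  let M (t : V) := adj_inv (gram_out (samples t) [set i]%SET) in
  outer_le mu [set t : V |
      net_bounds N1 N2 (K / 4 * n%:R) (2 * (kap * n%:R) + 2 * (K * n%:R * dl ^+ 2))
        (omit (samples t) i) &&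
      (eps < `|quad (M t) (samples t i) - \tr (M t)|)]
    (2 * expR (- (32^-1 * kap ^+ 2 * eps ^+ 2 * n%:R))).
Proof.
move=> n0 pn k0 k1 e0 e1 K0 d0 d2 cov1 cov2 M.
have nR0 : 0 < n%:R :> R by rewrite ltr0n.
have kn0 : 0 < kap * n%:R by rewrite mulr_gt0.
pose good (t : V) := net_bounds N1 N2 (K / 4 * n%:R)
  (2 * (kap * n%:R) + 2 * (K * n%:R * dl ^+ 2)) (omit (samples t) i).
have H := @quad_tail i M good (kap * n%:R)^-1 (p%:R / (kap * n%:R) ^+ 2)
  (16^-1 * kap ^+ 2 * eps * n%:R) eps.
apply: (outer_le_sub _ _ (H _ _ _ _ _ _ _)) => //.
- rewrite ler_pM2l// ler_expR.
  have -> : 4 * (16^-1 * kap ^+ 2 * eps * n%:R) ^+ 2 * (p%:R / (kap * n%:R) ^+ 2) =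
      64^-1 * kap ^+ 2 * eps ^+ 2 * p%:R.
    by field; rewrite !gt_eqF.
  have pn' : p%:R <= n%:R :> R by rewrite ler_nat.
  have h : 0 <= 64^-1 * kap ^+ 2 * eps ^+ 2 by rewrite mulr_ge0 ?sqr_ge0// mulr_ge0 ?sqr_ge0.
  have := ler_wpM2l h pn'.
  have : 0 <= 64^-1 * kap ^+ 2 * eps ^+ 2 * n%:R by rewrite mulr_ge0.
  by clear H; lra.
- by apply: mmx_adj_inv; exact: mmx_gram_out.
- apply: measurable_net_bounds => j; rewrite /omit.
  by case: eqP => _; [exact: mvec_cst|exact: mvec_samples].
- by move=> t z; rewrite /M gram_out_upd// inE.
- move=> t z; rewrite /good; congr net_bounds; apply/funext => j.
  by rewrite /omit samples_upd; case: eqP.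
- move=> t /andP[/allP h1 /allP h2].
  have up : forall v, \sum_j dot (omit (samples t) i j) v ^+ 2 <= K * n%:R * dot v v.
    move=> v; have -> : K * n%:R = 4 * (K / 4 * n%:R) by field.
    exact: (gram_upper_net cov1 h1).
  have low v : kap * n%:R * dot v v <= dot v (gram_out (samples t) [set i]%SET *m v).
    rewrite dot_gram_out; under eq_bigr do rewrite -expr2.
    rewrite -sum_omit.
    apply: (@gram_lower_net _ _ _ _ N2 xpredT dl (K * n%:R)) => //.
    - by rewrite mulr_ge0// ltW.
    - by move=> u uN u4; have /implyP := h2 u uN; exact.
  have sG := gram_sym (samples t) (fun j => (j \notin [set i]%SET)%:R).
  have Mu : M t = invmx (gram_out (samples t) [set i]%SET).
    by rewrite /M adj_invE//; apply: lower_unit low.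
  rewrite Mu; split.
  - exact: inv_sym.
  - by move=> v; rewrite ger0_norm; [exact: inv_quad_le|exact: inv_quad_ge0 low _].
  - exact: inv_frob.
- by rewrite mulr_ge0// ?mulr_ge0// ?sqr_ge0// ltW.
- have -> : 2 * (16^-1 * kap ^+ 2 * eps * n%:R) / (kap * n%:R) = 8^-1 * (kap * eps).
    by field; rewrite !gt_eqF.
  by rewrite ger_pMr// mulr_ile1// ltW.
Qed.

End Tails.

(** * The exceptional events *)

Section ExpBounds.
Variable R : realType.

Lemma pow2_le_exp m : 2 ^+ m <= expR m%:R :> R.
Proof.
rewrite -(mulr1 m%:R) expRM_natl lerXn2r ?nnegrE ?expR_ge0//.
by have := expR_ge1Dx (1 : R).
Qed.

Lemma exp_pow m (a : R) : expR a ^+ m = expR (a * m%:R).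
Proof. by rewrite mulrC expRM_natl. Qed.

End ExpBounds.

Section Exceptional.
Variables (R : realType) (n p : nat).
Let W : measurableType _ := (p.-tuple R)%type.
Let V : measurableType _ := (n.-tuple W)%type.
Variables (mu : probability V R) (nu : 'I_n -> probability W R).
Hypothesis muE : box_product mu nu.
Hypothesis nuE : forall i, box_product (nu i) (fun=> std_normal R).
Hypotheses (n0 : (0 < n)%N) (p0 : (0 < p)%N) (pn : (p <= n)%N).

Lemma outer_le_guard (b : bool) (A : set V) (c : R) : 0 <= c ->
  (b -> outer_le mu A c) -> outer_le mu [set t | b /\ A t] c.
Proof.
move=> c0; case: b => [/(_ isT)|_]; first by apply: outer_le_sub => // t [].
by exists set0 => //; split; [move=> t []|rewrite measure0 lee_fin].
Qed.

Variables (K al eps : R) (k : nat).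
Hypotheses (KE : K = 384) (al0 : 0 <= al).
Let dl : R := expR (- al) / 64.
Let kap : R := K * dl ^+ 2.
Let thr : R := 2 * (kap * n%:R) + 2 * (K * n%:R * dl ^+ 2).

Let dl0 : 0 < dl. Proof. by rewrite divr_gt0// expR_gt0. Qed.

Let dl_le : dl <= 64^-1.
Proof.
by rewrite -[leRHS]mul1r ler_wpM2r// -[leRHS]expR0 ler_expR oppr_le0.
Qed.

Let thrE : thr = 4 * K * dl ^+ 2 * n%:R.
Proof. by rewrite /thr /kap; field. Qed.

Variables N1 N2 : seq 'cV[R]_p.
Hypothesis sN1 : (size N1)%:R <= (4 * expR 1 / 2^-1) ^+ p :> R.
Hypothesis sN2 : (size N2)%:R <= (4 * expR 1 / dl) ^+ p :> R.
Hypothesis bN1 : forall u, u \in N1 -> dot u u <= 1.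

Let pnR : p%:R <= n%:R :> R. Proof. by rewrite ler_nat. Qed.
Let nR1 : 1 <= n%:R :> R. Proof. by rewrite ler1n. Qed.

Let sN1' : (size N1)%:R <= expR (4 * n%:R) :> R.
Proof.
apply: (le_trans sN1).
apply: (@le_trans _ _ (expR 4 ^+ p)).
  rewrite lerXn2r ?nnegrE ?expR_ge0 ?mulr_ge0 ?expR_ge0 ?invr_ge0//.
  rewrite invrK mulrAC (_ : 4 * 2 = 2 ^+ 3); last by field.
  rewrite (_ : expR 4 = expR 3 * expR 1 :> R); last by rewrite -expRD; congr expR; field.
  by rewrite ler_wpM2r ?expR_ge0// pow2_le_exp.
by rewrite exp_pow ler_expR ler_wpM2l.
Qed.

Let sN2' : (size N2)%:R <= expR (9 * n%:R + al * p%:R) :> R.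
Proof.
apply: (le_trans sN2).
apply: (@le_trans _ _ (expR (9 + al) ^+ p)).
  rewrite lerXn2r ?nnegrE ?expR_ge0 ?mulr_ge0 ?expR_ge0 ?invr_ge0 ?(ltW dl0)//.
  rewrite /dl invfM invrK -expRN opprK.
  rewrite (_ : 4 * expR 1 * (expR al * 64) = 2 ^+ 8 * (expR 1 * expR al)); last by field.
  rewrite (_ : expR (9 + al) = expR 8 * (expR 1 * expR al)); last first.
    by rewrite -!expRD; congr expR; field.
  by rewrite ler_wpM2r ?mulr_ge0 ?expR_ge0// pow2_le_exp.
by rewrite exp_pow ler_expR mulrDl lerD2r ler_wpM2l.
Qed.

Let cset : #|{: {set 'I_n}}|%:R <= expR n%:R :> R.
Proof. by rewrite -cardsT -powersetT card_powerset cardsT card_ord natrX pow2_le_exp. Qed.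

(** The net has at most [expR (4 n)] points, and [K = 384] makes Chernoff's bound
   [expR (- (6 - 1 / 8) n)] at each of them. *)
Lemma upper_exceptional : outer_le mu
  [set t : V | exists2 u, u \in N1 & K / 4 * n%:R < \sum_j dot (samples t j) u ^+ 2]
  (expR (- n%:R)).
Proof.
have H := @outer_le_seq _ _ _ mu _ N1 (fun u => [set t : V | _ < \sum_j _]) _
  (fun u uN => upper_tail muE nuE (K / 4) (bN1 uN)).
apply: (outer_le_sub _ _ H) => //; rewrite exp_pow.
apply: le_trans (ler_wpM2r (expR_ge0 _) sN1') _.
rewrite -expRD ler_expR KE; clear H; have h := nR1; lra.
Qed.

(** There are at most [expR n] sets [J] and [expR (9 n + al p)] net points; each event
   has probability at most [expR (n - al (n - k - 1))].  The gain [al (n - k - 1)]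
   outweighs the term [al p] of the net, however large [al] is, because [p] is a
   fraction of [n]. *)
Lemma lower_exceptional : 12 * n%:R <= al * (n%:R - k.+1%:R - p%:R) -> outer_le mu
  [set t : V | exists J : {set 'I_n}, (#|J| <= k.+1)%N /\ exists2 u, u \in N2 &
     4^-1 <= dot u u /\ \sum_(j | j \notin J) dot (samples t j) u ^+ 2 < thr]
  (expR (- n%:R)).
Proof.
move=> hal.
have := @outer_le_fin _ _ _ mu {set 'I_n} (fun J => [set t : V | (#|J| <= k.+1)%N /\ exists2 u, u \in N2 &
     4^-1 <= dot u u /\ \sum_(j | j \notin J) dot (samples t j) u ^+ 2 < thr])
     (expR (9 * n%:R + al * p%:R) * (expR n%:R * expR (- al * (n%:R - k.+1%:R)))).
move=> H; apply: (outer_le_sub _ _ (H _)) => //.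
  apply: le_trans (ler_wpM2r _ cset) _; first by rewrite !mulr_ge0 ?expR_ge0.
  by rewrite -!expRD ler_expR; clear H; have h := hal; lra.
move=> J; apply: outer_le_guard => [|cJ]; first by rewrite !mulr_ge0 ?expR_ge0.
have e0 : 0 <= expR n%:R * expR (- al * (n%:R - k.+1%:R)) by rewrite mulr_ge0 ?expR_ge0.
have HN := @outer_le_seq _ _ _ mu _ N2 (fun u => [set t : V |
  4^-1 <= dot u u /\ \sum_(j | j \notin J) dot (samples t j) u ^+ 2 < thr])
  (expR n%:R * expR (- al * (n%:R - k.+1%:R))).
apply: (outer_le_sub _ _ (HN _)) => //; first exact: ler_wpM2r.
clear H HN; move=> u uN; apply: outer_le_guard => // u4.
apply: (outer_le_sub _ _ (lower_tail muE nuE (~: J)%SET thr (c := 4 * expR (2 * al)) _ u4)).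
- by move=> t; apply: le_lt_trans; rewrite le_eqVlt; apply/orP; left; apply/eqP;
    apply: eq_bigl => j; rewrite inE.
- apply: ler_pM; rewrite ?expR_ge0//.
  + rewrite ler_expR thrE KE /dl.
    have -> : 2^-1 * (4 * expR (2 * al)) * (4 * 384 * (expR (- al) / 64) ^+ 2 * n%:R) =
       3 / 4 * (expR (2 * al) * expR (- al) ^+ 2) * n%:R by field.
    rewrite exp_pow -expRD (_ : 2 * al + - al * 2%:R = 0); last by field.
    by rewrite expR0; have h := nR1; lra.
  + apply: (@le_trans _ _ (expR (- al) ^+ #|(~: J)%SET|)).
      rewrite lerXn2r ?nnegrE ?expR_ge0 ?invr_ge0 ?sqrtr_ge0//.
      rewrite expRN lef_pV2 ?posrE ?expR_gt0 ?sqrtr_gt0 ?ltr_pwDl ?divr_ge0 ?mulr_ge0 ?expR_ge0//.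
      rewrite -[leLHS]ger0_norm ?expR_ge0// -sqrtr_sqr ler_wsqrtr//.
      rewrite exp_pow mulrC (mulrC 4) mulfK//; lra.
    rewrite exp_pow ler_expR ler_wnM2l ?oppr_le0//.
    have E := cardsC J; rewrite card_ord in E.
    by rewrite lerBlDr -natrD ler_nat -{1}E addnC leq_add2l.
- by rewrite mulr_ge0 ?expR_ge0.
Qed.

(** The threshold [2 / expR (2 * al)] cancels the price of Chernoff's bound down to
   [expR n], and each of the [k] samples of [J] contributes [expR (- al)]. *)
Lemma spread_exceptional : 3 * n%:R <= al * k%:R -> outer_le mu
  [set t : V | exists ij : 'I_n * {set 'I_n}, (ij.1 \notin ij.2) && (#|ij.2| == k) /\
     let u := adj_inv (gram_out (samples t) (ij.1 |: ij.2)%SET) *m samples t ij.1 in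
     \sum_(j in ij.2) dot (samples t j) u ^+ 2 < 2 / expR (2 * al) * n%:R * dot u u]
  (n%:R * expR (- n%:R)).
Proof.
move=> hal.
have H := @outer_le_fin _ _ _ mu ('I_n * {set 'I_n})%type (fun ij => [set t : V |
  (ij.1 \notin ij.2) && (#|ij.2| == k) /\
     let u := adj_inv (gram_out (samples t) (ij.1 |: ij.2)%SET) *m samples t ij.1 in
     \sum_(j in ij.2) dot (samples t j) u ^+ 2 < 2 / expR (2 * al) * n%:R * dot u u])
  (expR (- (2 * n%:R))).
apply: (outer_le_sub _ _ (H _)) => //.
  rewrite card_prod card_ord natrM -mulrA ler_wpM2l//.
  apply: le_trans (ler_wpM2r (expR_ge0 _) cset) _.
  by rewrite -expRD ler_expR; clear H; lra.
clear H; case=> i J; apply: outer_le_guard => /= [|/andP[iJ /eqP cJ]]; first exact: expR_ge0.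
apply: (outer_le_sub _ _ (spread_tail muE nuE (2 / expR (2 * al) * n%:R)
  (c := expR (2 * al)) (expR_ge0 _) iJ)) => //.
have -> : 2^-1 * expR (2 * al) * (2 / expR (2 * al) * n%:R) = n%:R :> R.
  by field; rewrite gt_eqF ?expR_gt0.
apply: (@le_trans _ _ (expR n%:R * expR (- al) ^+ k)).
  rewrite cJ ler_wpM2l ?expR_ge0// lerXn2r ?nnegrE ?expR_ge0 ?invr_ge0 ?sqrtr_ge0//.
  rewrite expRN lef_pV2 ?posrE ?expR_gt0 ?sqrtr_gt0 ?ltr_pwDl ?expR_ge0//.
  rewrite -[leLHS]ger0_norm ?expR_ge0// -sqrtr_sqr ler_wsqrtr//.
  rewrite exp_pow mulrC; lra.
by rewrite exp_pow -expRD ler_expR; have h := hal; lra.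
Qed.

Hypotheses (eps0 : 0 <= eps) (eps1 : eps <= 1).

Lemma norm_exceptional (b : R) : b * n%:R <= p%:R -> outer_le mu
  [set t : V | exists i, eps * p%:R < `|dot (samples t i) (samples t i) - p%:R|]
  (2 * n%:R * expR (- (b / 32 * eps ^+ 2 * n%:R))).
Proof.
move=> bp.
have H := @outer_le_fin _ _ _ mu 'I_n (fun i => [set t : V |
  eps * p%:R < `|dot (samples t i) (samples t i) - p%:R|]) _ (fun i => norm_tail muE nuE i eps0 eps1).
apply: (outer_le_sub _ _ H) => //.
rewrite card_ord mulrCA mulrA ler_wpM2l ?mulr_ge0// ler_expR lerN2.
have -> : b / 32 * eps ^+ 2 * n%:R = 32^-1 * eps ^+ 2 * (b * n%:R) by field.
by rewrite ler_wpM2l// mulr_ge0// sqr_ge0.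
Qed.

Hypothesis cov1 : forall v : 'cV[R]_p, dot v v <= 1 ->
  exists2 u, u \in N1 & dot (v - u) (v - u) <= 2^-1 ^+ 2.
Hypothesis cov2 : forall v : 'cV[R]_p, dot v v <= 1 ->
  exists2 u, u \in N2 & dot (v - u) (v - u) <= dl ^+ 2.

Let dl2 : dl <= 2^-1. Proof. by apply: le_trans dl_le _; rewrite lef_pV2 ?posrE// ler_nat. Qed.
Let kap0 : 0 < kap. Proof. by rewrite /kap KE mulr_gt0 ?ltr0n ?exprn_gt0. Qed.
Let kap1 : kap <= 1.
Proof.
have h : dl ^+ 2 <= 64^-1 ^+ 2 by rewrite lerXn2r ?nnegrE ?invr_ge0// ltW.
rewrite /kap KE; lra.
Qed.

Lemma loo_exceptional : outer_le mu
  [set t : V | exists i, let M := adj_inv (gram_out (samples t) [set i]%SET) in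
     net_bounds N1 N2 (K / 4 * n%:R) thr (omit (samples t) i) &&
     (eps < `|quad M (samples t i) - \tr M|)]
  (2 * n%:R * expR (- (kap ^+ 2 / 32 * eps ^+ 2 * n%:R))).
Proof.
have K0 : 0 <= K by rewrite KE ler0n.
have H := @outer_le_fin _ _ _ mu 'I_n _ _ (fun i => loo_tail muE nuE i n0 pn kap0 kap1 eps0 eps1 K0
  (ltW dl0) dl2 cov1 cov2).
apply: (outer_le_sub _ _ H) => //.
by rewrite card_ord mulrCA mulrA [X in - (X * _ * _)]mulrC.
Qed.

Variables a b : R.
Hypotheses (a0 : 0 < a) (b0 : 0 < b) (bp : b * n%:R <= p%:R) (nk : (2 * k <= n)%N).
Hypotheses (hal2 : 12 * n%:R <= al * (n%:R - k.+1%:R - p%:R)) (hal3 : 3 * n%:R <= al * k%:R).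
Let e : R := 2 * eps + (kap * n%:R)^-1.
Let t0 : R := 2 / expR (2 * al).
Let c0 : R := a ^+ 2 * t0 * b / (4 * K ^+ 2 * (1 + K ^+ 2 / kap ^+ 2)).
Hypotheses (ha : p%:R / n%:R + e <= 1 - a) (he : 4 * e < c0) (eps2 : eps <= 1 / 2).

Let dev (t : V) := opnorm (p%:R *: tyler (samples t) - sample_cov (samples t)).

(** On the good event all matrices [gram_out] that occur are positive definite, so
   that the total inverse [adj_inv] is the inverse. *)
Lemma close_outside_exceptional (t : V) :
  (forall u, u \in N1 -> \sum_j dot (samples t j) u ^+ 2 <= K / 4 * n%:R) ->
  (forall J : {set 'I_n}, (#|J| <= k.+1)%N -> forall u, u \in N2 -> 4^-1 <= dot u u ->
     thr <= \sum_(j | j \notin J) dot (samples t j) u ^+ 2) ->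
  (forall i (J : {set 'I_n}), i \notin J -> #|J| = k ->
     let u := adj_inv (gram_out (samples t) (i |: J)%SET) *m samples t i in
     t0 * n%:R * dot u u <= \sum_(j in J) dot (samples t j) u ^+ 2) ->
  (forall i, `|dot (samples t i) (samples t i) - p%:R| <= eps * p%:R) ->
  (forall i, let M := adj_inv (gram_out (samples t) [set i]%SET) in
     net_bounds N1 N2 (K / 4 * n%:R) thr (omit (samples t) i) ->
     `|quad M (samples t i) - \tr M| <= eps) ->
  dev t <= 2 * K * (4 * e / c0 + eps).
Proof.
move=> upN lowN spr nrm lo.
have Kp : 0 < K by rewrite KE ltr0n.
have nRp : 0 < n%:R :> R by rewrite ltr0n.
have up v : \sum_j dot (samples t j) v ^+ 2 <= K * n%:R * dot v v.
  have -> : K * n%:R = 4 * (K / 4 * n%:R) by field.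
  exact: (gram_upper_net cov1 upN).
have low (J : {set 'I_n}) : (#|J| <= k.+1)%N -> forall v,
    kap * n%:R * dot v v <= \sum_(j | j \notin J) dot (samples t j) v ^+ 2.
  move=> cJ; apply: (gram_lower_net dl2 (ltW dl0) cov2 up); first by rewrite mulr_ge0// ltW.
  by move=> u uN u4; exact: lowN.
have unit_out (J : {set 'I_n}) : (#|J| <= k.+1)%N -> gram_out (samples t) J \in unitmx.
  by move=> cJ; apply: posdefmx_unit; exact: (gram_out_posdef n0 kap0 low).
have c1 i : (#|[set i]%SET : {set 'I_n}| <= k.+1)%N by rewrite cards1.
apply: (tyler_close_of_events n0 p0 Kp kap0 eps0 up low _ _ a0 b0 ha _ nk eps2 nrm _ he).
- move=> i; rewrite -(adj_invE (unit_out _ (c1 i))).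
  apply: lo; apply/andP; split; apply/allP => u uN; rewrite ?sum_omit.
    apply: le_trans (upN u uN); rewrite [leRHS](bigID (fun j => j \notin [set i]%SET)) /= lerDl.
    by apply: sumr_ge0 => j _; exact: sqr_ge0.
  by apply/implyP => u4; exact: lowN.
- by rewrite divr_gt0// expR_gt0.
- by rewrite ler_pdivlMr.
- move=> i J iJ cJ; have := spr i J iJ cJ; rewrite adj_invE//.
  by apply: unit_out; rewrite cardsU1 iJ cJ.
Qed.

Lemma close_tail : outer_le mu
  [set t : V | ~ (dev t <= 2 * K * (4 * e / c0 + eps))]
  (7 * n%:R * expR (- (Num.min (b / 32) (kap ^+ 2 / 32) * eps ^+ 2 * n%:R))).
Proof.
have H1 := upper_exceptional. have H2 := lower_exceptional hal2.
have H3 := spread_exceptional hal3. have H4 := norm_exceptional bp.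
have H5 := loo_exceptional.
apply: (outer_le_sub _ _ (outer_leU H1 (outer_leU H2 (outer_leU H3 (outer_leU H4 H5))))).
  move=> t; apply: contra_notP => bad; apply: close_outside_exceptional.
  - move=> u uN; rewrite leNgt; apply/negP => lt; apply: bad; left; by exists u.
  - move=> J cJ u uN u4; rewrite leNgt; apply/negP => lt; apply: bad; right; left.
    by exists J; split => //; exists u.
  - move=> i J iJ cJ; cbv zeta; rewrite leNgt; apply/negP => lt; apply: bad; do 2 right; left.
    by exists (i, J); split => //=; rewrite iJ cJ eqxx.
  - move=> i; rewrite leNgt; apply/negP => lt; apply: bad; do 3 right; left; by exists i.
  - move=> i M nb; rewrite leNgt; apply/negP => lt; apply: bad; do 4 right.
    by exists i; rewrite nb.
set m := Num.min _ _.
have mb : m <= b / 32 by rewrite ge_min lexx.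
have mk : m <= kap ^+ 2 / 32 by rewrite ge_min lexx orbT.
have m1 : m <= 1.
  apply: (le_trans mk); have : kap ^+ 2 <= 1 by rewrite expr_le1// ltW.
  lra.
have ex c : m <= c -> expR (- (c * eps ^+ 2 * n%:R)) <= expR (- (m * eps ^+ 2 * n%:R)).
  by move=> mc; rewrite ler_expR lerN2 !ler_wpM2r// sqr_ge0.
have e2 : eps ^+ 2 <= 1 by rewrite expr_le1.
have h0 := ex _ mb. have h1 := ex _ mk.
have h2 : expR (- n%:R) <= expR (- (m * eps ^+ 2 * n%:R)).
  apply: le_trans (ex 1 m1); rewrite ler_expR lerN2 mul1r ler_piMl//.
set E := expR (- (m * _ * _)) in h0 h1 h2 *.
have E0 : 0 <= E by exact: expR_ge0.
have n0' : 0 <= n%:R :> R by [].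
have := ler_wpM2l n0' h0; have := ler_wpM2l n0' h1; have := ler_wpM2l n0' h2.
have : E <= n%:R * E by rewrite ler_peMl.
clear H1 H2 H3 H4 H5; lra.
Qed.

End Exceptional.

(** * The tail bound *)

Section Arithmetic.
Variable R : realFieldType.
Implicit Types (y n p k r d i q : R).

(** Removing a fraction [(1 - y) / 4] of the samples still leaves, beyond the
    dimension, a positive fraction of them. *)
Lemma aspect_ratio_room y n p k : 0 < y -> y < 1 -> p <= (1 + y) / 2 * n ->
  16 <= (1 - y) * n -> k <= (1 - y) / 8 * n -> (1 - y) / 8 * n < k + 1 ->
  [/\ p <= n, 2 * k <= n, (1 - y) / 8 * (2 * n) <= n - (k + 1) - p &
     (1 - y) / 8 * (n / 2) <= k].
Proof.
move=> y0 y1 py n16 kn kn1.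
have yn : 0 <= y * n by nra.
by split; lra.
Qed.

Lemma error_room y r d i q : 0 < d -> 0 < i -> r <= (1 + y) / 2 ->
  let e := 2 * d + i in
  e <= q / 8 -> e <= 2 * ((1 - y) / 8) -> e <= 1 -> 0 < q ->
  [/\ r + e <= 1 - 2 * ((1 - y) / 8), d <= 1 / 2, d <= e & 4 * e < q].
Proof. by move=> d0 i0 ry e e1 e2 e3 q0; split; rewrite /e in e1 e2 e3 *; lra. Qed.

End Arithmetic.

(** The deterministic statement is used with accuracy [d = eps / (4 D)], where [D]
   is its Lipschitz constant in the error [e = 2 d + 1 / (kap n)].  If
   [c * eps ^+ 2 * n <= 1] the probability bound exceeds [1]; otherwise [1 / n] is
   less than [c * eps ^+ 2], and [eps < kap / (2 D)] makes the second term of [e] at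
   most [eps / (2 D)], like the first. *)
Lemma samples_close_tail (R : realType) (y : R) : 0 < y -> y < 1 ->
  exists C c c' : R, [/\ 0 < C, 0 < c & 0 < c'] /\
  forall (n p : nat) (mu : probability (n.-tuple (p.-tuple R)) R)
    (nu : 'I_n -> probability (p.-tuple R) R),
    box_product mu nu -> (forall i, box_product (nu i) (fun=> std_normal R)) ->
    (0 < p)%N -> y / 2 * n%:R <= p%:R -> p%:R <= (1 + y) / 2 * n%:R ->
    16 <= (1 - y) * n%:R ->
  forall eps, 0 < eps -> eps < c' ->
  outer_le mu [set t | ~ (opnorm (p%:R *: tyler (samples t) - sample_cov (samples t)) <= eps)]
    (C * n%:R * expR (- c * eps ^+ 2 * n%:R)).
Proof.
move=> y0 y1.
pose eta : R := (1 - y) / 8.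
have eta0 : 0 < eta by rewrite /eta; lra.
pose K : R := 384.
have K0 : 0 < K by rewrite ltr0n.
(* chosen so that the exponents [2 eta al n] and [eta al n / 2] are [12 n] and [3 n] *)
pose al : R := 6 / eta.
have al0 : 0 < al by rewrite divr_gt0.
have alE : al * eta = 6 by rewrite divfK// gt_eqF.
pose dl : R := expR (- al) / 64.
have dl0 : 0 < dl by rewrite divr_gt0// expR_gt0.
pose kap : R := K * dl ^+ 2.
have kap0 : 0 < kap by rewrite mulr_gt0// exprn_gt0.
pose t0 : R := 2 / expR (2 * al).
have t00 : 0 < t0 by rewrite divr_gt0// expR_gt0.
pose a : R := 2 * eta.
have a0 : 0 < a by rewrite mulr_gt0.
pose b : R := y / 2.
have b0 : 0 < b by rewrite divr_gt0.
pose c0 : R := a ^+ 2 * t0 * b / (4 * K ^+ 2 * (1 + K ^+ 2 / kap ^+ 2)).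
have c00 : 0 < c0.
  have q0 : 0 < K ^+ 2 / kap ^+ 2 by exact: divr_gt0 (exprn_gt0 2 K0) (exprn_gt0 2 kap0).
  apply: divr_gt0 (mulr_gt0 (mulr_gt0 (exprn_gt0 2 a0) t00) b0) (mulr_gt0 _ _).
    by exact: mulr_gt0 _ (exprn_gt0 2 K0).
  by rewrite addr_gt0.
pose D : R := 2 * K * (4 / c0 + 1).
have D1 : 1 <= D.
  have h : 0 <= 4 / c0 by rewrite divr_ge0// ltW.
  have K1 : 1 <= K by rewrite ler1n.
  by rewrite /D; nra.
have D0 : 0 < D by exact: lt_le_trans D1.
pose es : R := Num.min (c0 / 8) (Num.min a 1).
have es0 : 0 < es by rewrite !lt_min (divr_gt0 c00)//= a0 ltr01.
pose c1 : R := Num.min (b / 32) (kap ^+ 2 / 32).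
have c10 : 0 < c1 by rewrite lt_min (divr_gt0 b0)// (divr_gt0 (exprn_gt0 2 kap0)).
pose c : R := c1 / (16 * D ^+ 2).
have c0' : 0 < c by rewrite divr_gt0// mulr_gt0// exprn_gt0.
have c_le1 : c <= 1.
  have D2 : 1 <= D ^+ 2 by rewrite expr_ge1// ltW.
  have : c1 <= b / 32 by rewrite ge_min lexx.
  rewrite ler_pdivrMr; last by rewrite mulr_gt0// exprn_gt0.
  rewrite /b; lra.
(* [7] comes from the exceptional events, [expR 1] makes the bound vacuous below *)
exists (7 + expR 1), c, (Num.min (kap / (2 * D)) (D * es)); split.
  split=> //.
  by rewrite lt_min (divr_gt0 kap0 (mulr_gt0 _ D0))//= mulr_gt0.
move=> n p mu nu muE nuE p0 yp py n16 eps eps0; rewrite lt_min => /andP[epsk epses].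
have nR0 : 0 < n%:R :> R.
  by rewrite -(pmulr_rgt0 _ (_ : 0 < 1 - y)) ?subr_gt0//; apply: lt_le_trans n16.
have n0 : (0 < n)%N by rewrite -(ltr0n R).
have E1 : 1 <= expR 1 :> R by rewrite -expR0 ler_expR.
have [ce1|ce1] := leP (c * eps ^+ 2 * n%:R) 1.
  exists setT => //; split=> //; rewrite probability_setT lee_fin.
  have h : expR (-1) <= expR (- c * eps ^+ 2 * n%:R) by rewrite ler_expR !mulNr lerN2.
  apply: (@le_trans _ _ (expR 1 * 1 * expR (-1))).
    by rewrite mulr1 -expRD subrr expR0.
  by rewrite ler_pM ?mulr_ge0 ?expR_ge0// ler_pM ?expR_ge0 ?lerDr// ler1n.
pose d := eps / (4 * D).
have d0 : 0 < d by rewrite divr_gt0// mulr_gt0.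
pose e := 2 * d + (kap * n%:R)^-1.
have inv0 : 0 < (kap * n%:R)^-1 by rewrite invr_gt0 mulr_gt0.
have D20 : 0 < 2 * D by rewrite mulr_gt0.
have knR : 0 < kap * n%:R by rewrite mulr_gt0.
have inv_le : (kap * n%:R)^-1 <= eps / (2 * D).
  have h : eps * (2 * D) <= kap by rewrite -(ler_pdivlMr _ _ D20); exact: ltW.
  have : 1 <= eps ^+ 2 * n%:R.
    apply: (le_trans (ltW ce1)); rewrite -mulrA ler_piMl// mulr_ge0// ?sqr_ge0//.
  move=> h1; rewrite (ler_pdivlMr _ _ D20) mulrC (ler_pdivrMr _ _ knR).
  apply: (@le_trans _ _ (2 * D * (eps ^+ 2 * n%:R))); first by rewrite ler_peMr// ltW.
  have -> : 2 * D * (eps ^+ 2 * n%:R) = eps * (2 * D) * (eps * n%:R) by field.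
  by rewrite [leRHS]mulrCA ler_wpM2r// mulr_ge0// ltW.
have dE : 2 * d = eps / (2 * D) by rewrite /d; field; rewrite gt_eqF.
have e_le : e <= eps / D.
  have -> : eps / D = eps / (2 * D) + eps / (2 * D) by field; rewrite gt_eqF.
  by rewrite /e dE lerD2l.
have e_es : e <= es by apply: (le_trans e_le); rewrite ler_pdivrMr// mulrC ltW.
have [es1 [es2 es3]] : e <= c0 / 8 /\ e <= a /\ e <= 1.
  by move: e_es; rewrite !le_min => /and3P[].
pose k := Num.trunc (eta * n%:R).
have k_le : k%:R <= eta * n%:R by rewrite truncn_le ltW// mulr_gt0.
have k_ge : eta * n%:R < k%:R + 1 by rewrite natr1 truncnS_gt.
have [pn' nk' room2 room3] := aspect_ratio_room y0 y1 py n16 k_le k_ge.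
have pn : (p <= n)%N by rewrite -(ler_nat R).
have nk : (2 * k <= n)%N by rewrite -(ler_nat R) natrM.
have half0 : 0 < 2^-1 :> R by rewrite invr_gt0.
have half1 : 2^-1 <= 1 :> R by rewrite invf_le1// ler1n.
have [N1 [sN1 bN1 cN1]] := @lattice_net R p 2^-1 p0 half0 half1.
have dl_le1 : dl <= 1.
  rewrite ler_pdivrMr// mul1r (@le_trans _ _ 1) ?ler1n//.
  by rewrite -expR0 ler_expR oppr_le0 ltW.
have [N2 [sN2 bN2 cN2]] := @lattice_net R p dl p0 dl0 dl_le1.
have alk (r : R) : al * (eta * r) = 6 * r by rewrite mulrA alE.
have hal2 : 12 * n%:R <= al * (n%:R - k.+1%:R - p%:R).
  have -> : 12 * n%:R = al * (eta * (2 * n%:R)) :> R by rewrite alk; field.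
  by rewrite ler_pM2l// -(natr1 k).
have hal3 : 3 * n%:R <= al * k%:R.
  have -> : 3 * n%:R = al * (eta * (n%:R / 2)) :> R by rewrite alk; field.
  by rewrite ler_pM2l.
have pr : p%:R / n%:R <= (1 + y) / 2 by rewrite ler_pdivrMr.
have [ha d2 de he] := error_room d0 inv0 pr es1 es2 es3 c00.
have d1 : d <= 1 by apply: (le_trans d2); rewrite mul1r.
have H := @close_tail R n p mu nu muE nuE n0 p0 pn K al d k erefl (ltW al0) N1 N2 sN1 sN2 bN1
  (ltW d0) d1 cN1 cN2 a b a0 b0 yp nk hal2 hal3 ha he d2.
apply: (outer_le_sub _ _ H).
  move=> t /= nle le; apply: nle; apply: (le_trans le).
  apply: (@le_trans _ _ (D * e)).
    have -> : D * e = 2 * K * (4 * e / c0 + e) by rewrite /D; field; rewrite gt_eqF.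
    by rewrite ler_pM2l ?mulr_gt0// lerD2l.
  by rewrite mulrC -ler_pdivlMr.
rewrite -/dl -/kap -/c1.
have -> : c1 * d ^+ 2 * n%:R = c * eps ^+ 2 * n%:R.
  by rewrite /d /c; field; rewrite gt_eqF.
rewrite !mulNr ler_wpM2r ?expR_ge0// ler_wpM2r// lerDl expR_ge0//.
Qed.

(** * The random samples *)

Section InnerProbability.
Variables (R : realType) (d : measure_display) (T : measurableType d).
Variable P : probability T R.

Lemma outer_le_inner_prob (A : set T) (c : R) :
  outer_le P (~` A) c -> ((1 - c)%:E <= inner_prob P A)%E.
Proof.
move=> [B mB [AB PB]]; apply: (@le_trans _ _ (P (~` B))).
  by rewrite probability_setC// EFinB leeB.
apply: ereal_sup_ubound; exists (~` B) => //=; split; first exact: measurableC.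
by rewrite -(setCK A); exact: subsetC.
Qed.

(** Borel--Cantelli.  The factor [n] is absorbed by half of the exponent, which leaves
   a geometric series. *)
Lemma lim_sup_negligible (A : (set T)^nat) (C a : R) : 0 <= C -> 0 < a ->
  (\forall n \near \oo, outer_le P (A n) (C * n%:R * expR (- (a * n%:R)))) ->
  P.-negligible (lim_sup_set A).
Proof.
move=> C0 a0 [n0 _ hA].
pose q : R := expR (- (a / 2)).
have q1 : `|q| < 1.
  by rewrite ger0_norm ?expR_ge0// -expR0 ltr_expR oppr_lt0 divr_gt0.
pose M : R := C * (2 / a).
have M0 : 0 <= M by rewrite mulr_ge0// divr_ge0// ltW.
have geo n : C * n%:R * expR (- (a * n%:R)) <= M * q ^+ n.
  rewrite /q -expRM_natl.
  have -> : - (a * n%:R) = n%:R * - (a / 2) + - (a / 2 * n%:R) by field.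
  rewrite addrC expRD mulrA ler_wpM2r ?expR_ge0// /M.
  rewrite -(mulrA C); apply: ler_wpM2l => //.
  rewrite expRN ler_pdivrMr ?expR_gt0//.
  have h := expR_ge1Dx (a / 2 * n%:R).
  rewrite [leLHS](_ : _ = 2 / a * (a / 2 * n%:R)); last by field; rewrite gt_eqF.
  by rewrite ler_pM2l ?divr_gt0//; lra.
have /choice[F hF] : forall n, exists F, [/\ measurable F, (n0 <= n)%N -> A n `<=` F &
    (P F <= (M * q ^+ n)%:E)%E].
  move=> n.
  have [nn|nn] := leqP n0 n; last first.
    by exists set0; split=> //; rewrite measure0 lee_fin mulr_ge0// exprn_ge0// expR_ge0.
  have [B mB [AB PB]] := hA n nn; exists B; split=> //.
  by apply: (le_trans PB); rewrite lee_fin.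
have mF k : measurable (F k) by have [] := hF k.
exists (lim_sup_set F); split.
- by apply: bigcap_measurable => // k _; apply: bigcup_measurable.
- apply: lim_sup_set_cvg0 => //.
  apply: (@le_lt_trans _ _ (M * (1 - q)^-1)%:E); last by rewrite ltry.
  apply: lime_le; first exact: is_cvg_nneseries.
  apply: nearW => N; apply: (@le_trans _ _ (series (geometric M q) N)%:E).
    rewrite /series /= -sumEFin; apply: lee_sum => k _; by have [] := hF k.
  by rewrite lee_fin; apply: geometric_le_lim => //; exact: expR_gt0.
- move=> t At k _; have [j /= kj Aj] := At (maxn k n0) I.
  have [_ FA _] := hF j.
  exists j; first by rewrite /= (leq_trans _ kj)// leq_maxl.
  by apply: FA => //; rewrite (leq_trans _ kj)// leq_maxr.
Qed.

End InnerProbability.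

Lemma opnorm_ge0 (R : realType) (p : nat) (A : 'M[R]_p) : 0 <= opnorm A.
Proof.
rewrite /opnorm; set S := [set _ | _ in _].
have [sS|/sup_out ->//] := pselect (has_sup S).
apply: ub_le_sup; first by case: sS.
exists 0; rewrite /= /enorm ?mulmx0 big1 ?sqrtr0// => j _;
  by rewrite mxE expr0n.
Qed.

Section Law.
Variables (R : realType) (d : measure_display) (T : measurableType d).
Variables (P : probability T R) (n p : nat).
Let W : measurableType _ := (p.-tuple R)%type.
Let V : measurableType _ := (n.-tuple W)%type.
Variable X : 'I_n -> {mfun T >-> W}.

Definition joint (w : T) : V := [tuple X i w | i < n].

Lemma measurable_joint : measurable_fun setT joint.
Proof.
apply/measurable_fun_tnthP => i.
rewrite (_ : _ \o _ = X i); first exact: measurable_funPT.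
by apply/funext => w /=; rewrite tnth_mktuple.
Qed.

HB.instance Definition _ := isMeasurableFun.Build _ _ _ _ joint measurable_joint.

Lemma outer_le_joint (A : set V) c : outer_le (distribution P joint) A c ->
  outer_le P (joint @^-1` A) c.
Proof.
move=> [B mB [AB PB]]; exists (joint @^-1` B); last by split=> // w; exact: AB.
by rewrite -[_ @^-1` _]setTI; exact: measurable_joint.
Qed.

Lemma joint_box : mutually_independent P X ->
  box_product (distribution P joint) (fun i => distribution P (X i)).
Proof.
move=> ind A mA; rewrite -(ind A mA); congr (P _).
by apply/seteqP; split=> w /= h i; have := h i; rewrite tnth_mktuple.
Qed.

End Law.

Theorem theorem2p3 (R : realType) (y : R) (y_gt0 : 0 < y) (y_lt1 : y < 1) :
  exists C c c' : R, [/\ 0 < C, 0 < c & 0 < c'] /\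
  forall (p : nat -> nat),
    (forall n, (0 < p n)%N) ->
    p @ \oo --> \oo ->
    (fun n => (p n)%:R / n%:R : R) @ \oo --> y ->
  forall (d : measure_display) (T : measurableType d) (P : probability T R)
    (X : forall n, 'I_n -> {mfun T >-> (p n).-tuple R}),
    (forall n i, std_gaussian_vector P (X n i)) ->
    (forall n, mutually_independent P (X n)) ->
  let x n w : 'I_n -> 'cV[R]_(p n) := fun i => col_of_tuple (X n i w) in
  let dev n w := opnorm ((p n)%:R *: tyler (x n w) - sample_cov (x n w)) in
  {ae P, forall w, (fun n => dev n w) @ \oo --> (0 : R)} /\
  \forall n \near \oo, forall eps : R, 0 < eps -> eps < c' ->
    ((1 - C * n%:R * expR (- c * eps ^+ 2 * n%:R))%:E
      <= inner_prob P [set w | (dev n w <= eps)%R])%E.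
Proof.
have [C [c [c' [[C0 c0 c'0] tail]]]] := samples_close_tail y_gt0 y_lt1.
exists C, c, c'; split=> // p p0 _ py d T P X gaussX indX x dev.
have key : \forall n \near \oo, forall eps : R, 0 < eps -> eps < c' ->
    outer_le P [set w | ~ (dev n w <= eps)] (C * n%:R * expR (- c * eps ^+ 2 * n%:R)).
  have n1 : \forall n \near \oo, 16 / (1 - y) <= n%:R.
    exact: nbhs_infty_ger.
  have n2 : \forall n \near \oo, y / 2 <= (p n)%:R / n%:R.
    by apply: (cvgr_ge _ py); rewrite gtr_pMr// invf_lt1// ltr1n.
  have n3 : \forall n \near \oo, (p n)%:R / n%:R <= (1 + y) / 2.
    by apply: (cvgr_le _ py); lra.
  near=> n => eps eps0 epsc.
  have nR0 : 0 < n%:R :> R.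
    have h : 16 / (1 - y) <= n%:R by near: n.
    by apply: lt_le_trans h; rewrite divr_gt0// subr_gt0.
  have H := tail n (p n) _ _ (joint_box (indX n)) (gaussX n) (p0 n) _ _ _ eps eps0 epsc.
  have h1 : y / 2 * n%:R <= (p n)%:R by rewrite -ler_pdivlMr//; near: n.
  have h2 : (p n)%:R <= (1 + y) / 2 * n%:R by rewrite -ler_pdivrMr//; near: n.
  have h3 : 16 <= (1 - y) * n%:R.
    by rewrite mulrC -ler_pdivrMr ?subr_gt0//; near: n.
  have xE w : samples (joint (X n) w) = x n w.
    by apply/funext => i; rewrite /samples /joint tnth_mktuple.
  have J := outer_le_joint (H h1 h2 h3).
  apply: (@outer_le_sub _ _ _ _ _ _ _ _ _ _ J); last by [].
  by move=> w; rewrite /preimage /= xE.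
split; last first.
  apply: filterS key => n H eps eps0 epsc; apply: outer_le_inner_prob.
  exact: H.
(* accuracies tending to [0] and below [c'], countably many to handle all at once *)
pose e (k : nat) : R := c' / k.+2%:R.
have e0 k : 0 < e k by rewrite divr_gt0.
have ec k : e k < c' by rewrite ltr_pdivrMr// ltr_pMr// ltr1n.
have negl k : P.-negligible (lim_sup_set (fun n => [set w | ~ (dev n w <= e k)])).
  apply: (@lim_sup_negligible _ _ _ _ _ C (c * e k ^+ 2)); first exact: ltW.
    by rewrite mulr_gt0// exprn_gt0.
  by apply: filterS key => n /(_ (e k) (e0 k) (ec k)); rewrite !mulNr.
apply: negligibleS (negligible_bigcup negl) => w /= ncv.
apply: contrapT => nbad; apply: ncv.
apply/cvgrPdist_le => r r0.
have [k kr] : exists k, e k <= r.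
  exists (Num.trunc (c' / r)).
  rewrite /e ler_pdivrMr// mulrC -ler_pdivrMr//.
  apply: (le_trans (ltW (truncnS_gt _))); rewrite ler_nat//.
have : ~ lim_sup_set (fun n => [set w | ~ (dev n w <= e k)]) w.
  by move=> h; apply: nbad; exists k.
move=> /existsNP[m /not_implyP[_ hm]].
exists m => // n /= mn; rewrite sub0r normrN ger0_norm; last exact: opnorm_ge0.
apply: le_trans kr; apply: contrapT => nle; apply: hm; by exists n.
Unshelve. all: by end_near.
Qed.
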